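(* For any integers $k\geq 1$ and $n>2k$, the Schrijver graph $SG(n,k)$ contains a spanning subgraph $QG(n,k)$ that embeds in the real projective space $\mathbb{RP}^{n-2k}$ as a quadrangulation. In particular, $\chi(QG(n,k))=n-2k+2$.
   Context: Let $C_n$ be the cycle on vertex set $[n]=\{1,\dots,n\}$ with edges $\{i,i+1\}$ for $1\le i<n$ and $\{n,1\}$. The Schrijver graph $SG(n,k)$ has as vertices all $k$-element subsets of $[n]$ that are independent sets in $C_n$ (i.e. contain no two cyclically consecutive elements), two such sets being adjacent if and only if they are disjoint. If a space is triangulated by a (generalised) simplicial complex $\mathsf K$, a quadrangulation of that space is a spanning subgraph $G$ of the $1$-skeleton of $\mathsf K$ such that for every maximal simplex of $\mathsf K$, the subgraph of $G$ induced on the vertex set of that simplex is complete bipartite with at least one edge. A graph embeds in $\mathbb{RP}^{d}$ as a quadrangulation if it is (isomorphic to) a quadrangulation of some triangulation of $\mathbb{RP}^d$. $\chi$ denotes the chromatic number. *)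

(* Defs.v *)
From HB Require Import structures.
From mathcomp Require Import all_boot all_order all_algebra.
From mathcomp Require Import all_classical all_reals.
From mathcomp Require Import topology normedtype.

Set Implicit Arguments.
Unset Strict Implicit.
Unset Printing Implicit Defensive.

Import Order.TTheory GRing.Theory Num.Theory.
Import numFieldNormedType.Exports.

Local Open Scope ring_scope.

Record sgraph (V : finType) := SGraph {
  adj :> rel V;
  adj_sym : symmetric adj;
  adj_irr : irreflexive adj }.

Definition spanning_subgraph (V : finType) (G H : sgraph V) : Prop :=
  forall x y, G x y -> H x y.

Definition colorable (V : finType) (G : sgraph V) (m : nat) : bool :=
  [exists c : {ffun V -> 'I_m}, [forall x, forall y, G x y ==> (c x != c y)]].

Lemma colorable_card (V : finType) (G : sgraph V) : exists m, colorable G m.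
Proof.
exists #|V|; apply/existsP; exists [ffun x => enum_rank x].
apply/forallP => x; apply/forallP => y; apply/implyP => Gxy.
rewrite !ffunE; apply: contraTneq Gxy => /enum_rank_inj ->.
by rewrite adj_irr.
Qed.

Definition chromatic_number (V : finType) (G : sgraph V) : nat :=
  ex_minn (colorable_card G).

(* The vertex [i] of the cycle is represented by [i - 1 : 'I_n]; [ordS] is the
   cyclic successor. *)
Definition cycle_adj (n : nat) : rel 'I_n :=
  [rel i j | (j == ordS i) || (i == ordS j)].

Definition stable (n : nat) (A : {set 'I_n}) : bool :=
  [forall i in A, forall j in A, ~~ cycle_adj i j].

Definition schrijver_vertex (n k : nat) : finType :=
  {A : {set 'I_n} | (#|A| == k) && stable A}.

(* For [k >= 1] the clause [A != B] is implied by disjointness; it only keeps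
   the graph loopless at [k = 0]. *)
Definition schrijver_adj (n k : nat) : rel (schrijver_vertex n k) :=
  [rel A B : schrijver_vertex n k | (A != B) && [disjoint sval A & sval B]].

Lemma schrijver_adj_sym n k : symmetric (@schrijver_adj n k).
Proof. by move=> A B; rewrite /schrijver_adj /= eq_sym disjoint_sym. Qed.

Lemma schrijver_adj_irr n k : irreflexive (@schrijver_adj n k).
Proof. by move=> A; rewrite /schrijver_adj /= eqxx. Qed.

Definition schrijver_graph (n k : nat) : sgraph (schrijver_vertex n k) :=
  SGraph (@schrijver_adj_sym n k) (@schrijver_adj_irr n k).

(* A finite generalised simplicial complex, given by its nonempty simplices
   and their face relation.  The vertices of a simplex are pairwise distinct,
   and every nonempty subset of them spans exactly one of its faces, but
   several simplices may have the same vertex set and two simplices may meet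
   in more than one common face.  Antisymmetry of [gface], and
   [gface t t' = (vset t \subset vset t')] for faces [t], [t'] of a common
   simplex, follow from [gface_uniq]. *)
Record gsc := GSC {
  gvert : finType;
  gsimplex : finType;
  vset : gsimplex -> {set gvert};
  gface : rel gsimplex;  (* [gface t s]: [t] is a face of [s] *)
  gface_refl : reflexive gface;
  gface_trans : transitive gface;
  vset_neq0 : forall s, vset s != finset.set0;
  gface_sub : forall t s, gface t s -> vset t \subset vset s;
  gface_ex : forall s (A : {set gvert}), A != finset.set0 -> A \subset vset s ->
    exists2 t, gface t s & vset t = A;
  gface_uniq : forall s t t',
    gface t s -> gface t' s -> vset t = vset t' -> t = t';
  gvert_ex : forall v, exists s, vset s = [set v]%SET;
  gvert_uniq : forall v s t,
    vset s = [set v]%SET -> vset t = [set v]%SET -> s = t }.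

Definition maximal_simplex (K : gsc) (s : gsimplex K) : Prop :=
  forall t, gface s t -> t = s.

Section Realization.
Local Open Scope classical_set_scope.
Variable R : realType.

(* Barycentric coordinates: the simplex spanned by the unit vectors indexed by
   [S], inside R^V with the product topology. *)
Definition std_simplex (V : finType) (S : {set V}) :
    set (prod_topology (fun _ : V => R)) :=
  [set x | [/\ forall v, 0 <= x v, \sum_v x v = 1 &
               forall v, v \notin S -> x v = 0]].

Variable K : gsc.

Definition cell (s : gsimplex K) : topologicalType :=
  set_type (std_simplex (vset s)).

Definition coords (p : {s : gsimplex K & cell s}) :
    prod_topology (fun _ : gvert K => R) := set_val (tagged p).

Definition glued (p q : {s : gsimplex K & cell s}) : bool :=
  `[< coords p = coords q /\
      exists r, [/\ gface r (tag p), gface r (tag q) &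
                    std_simplex (vset r) (coords p)] >].

Lemma glued_equiv : equiv_class_of glued.
Proof.
split.
- move=> [s x]; apply/asboolP; split=> //; exists s.
  by split; rewrite ?gface_refl//; exact: set_valP.
- move=> p q; apply/asboolP/asboolP => -[e [r [rp rq xr]]];
    by split=> //; exists r; rewrite -?e // e.
- move=> q p r /asboolP[epq [s [sp sq xs]]] /asboolP[eqr [t [tq tr xt]]].
  apply/asboolP; split; first by rewrite epq.
  pose A := vset s :&: vset t.
  have A0 : A != finset.set0.
    apply/eqP => A0; case: (xs) => _ s1 xs0; case: xt => _ _ xt0.
    have : \sum_v coords p v = 0.
      apply: big1 => v _; have := finset.in_set0 v; rewrite -A0 !inE => /negbT.
      by rewrite negb_and => /orP[/xs0 //|/xt0]; rewrite epq.
    by rewrite s1 => /eqP; rewrite oner_eq0.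
  have As : A \subset vset s by exact: subsetIl.
  have At : A \subset vset t by exact: subsetIr.
  have [a as_ aA] := gface_ex A0 As; have [b bt bA] := gface_ex A0 At.
  have ab : a = b.
    apply: (@gface_uniq K (tag q)); last by rewrite aA bA.
    - exact: gface_trans sq.
    - exact: gface_trans tq.
  exists a; split.
  - exact: gface_trans sp.
  - by rewrite ab; exact: gface_trans tr.
  - case: xs => x0 x1 xs0; split=> // v; rewrite aA !inE negb_and.
    by case: xt => _ _ xt0 /orP[/xs0 //|/xt0]; rewrite epq.
Qed.

Canonical glued_equiv_rel := EquivRelPack glued_equiv.

Definition realization : topologicalType :=
  quotient_topology {eq_quot glued_equiv_rel}%qT.

End Realization.

Section ProjectiveSpace.
Local Open Scope classical_set_scope.
Variables (R : realType) (d : nat).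

Definition sphere : set 'rV[R]_d.+1 := [set x | \sum_i x 0 i ^+ 2 = 1].

Definition antipodal (x y : set_type sphere) : bool :=
  (set_val x == set_val y) || (set_val x == - set_val y).

Lemma antipodal_equiv : equiv_class_of antipodal.
Proof.
split.
- by move=> x; rewrite /antipodal eqxx.
- by move=> x y; rewrite /antipodal eq_sym -eqr_oppLR [- _ == _]eq_sym.
- move=> y x z /orP[]/eqP xy /orP[]/eqP yz; apply/orP; rewrite xy yz ?opprK;
  by [left | right].
Qed.

Canonical antipodal_equiv_rel := EquivRelPack antipodal_equiv.

Definition real_projective_space : topologicalType :=
  quotient_topology {eq_quot antipodal_equiv_rel}%qT.

End ProjectiveSpace.

Definition homeomorphic (X Y : topologicalType) : Prop :=
  exists (f : X -> Y) (g : Y -> X),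
    [/\ continuous f, continuous g, cancel f g & cancel g f].

Definition triangulates (R : realType) (K : gsc) (X : topologicalType) : Prop :=
  homeomorphic (realization R K) X.

(* The 1-skeleton of a generalised simplicial complex is a multigraph, whose
   edges are the 1-simplices; a spanning subgraph is a set of 1-simplices. *)
Definition skeleton_subgraph (K : gsc) (E : {set gsimplex K}) : Prop :=
  forall e, e \in E -> #|vset e| = 2.

(* Only edges lying in [s] itself are considered: a parallel 1-simplex with the
   same ends that is not a face of [s] does not count. *)
Definition adj_in_simplex (K : gsc) (E : {set gsimplex K}) (s : gsimplex K) :
    rel (gvert K) :=
  [rel x y | [exists e in E, gface e s && (vset e == [set x; y]%SET)]].

Definition complete_bipartite_on (V : finType) (S : {set V}) (r : rel V) :
    Prop :=
  exists A B : {set V}, [/\ A :|: B = S, [disjoint A & B] &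
    {in S &, forall x y,
      r x y = ((x \in A) && (y \in B)) || ((x \in B) && (y \in A))}].

Definition quadrangulation (K : gsc) (E : {set gsimplex K}) : Prop :=
  skeleton_subgraph E /\
  forall s, maximal_simplex s ->
    complete_bipartite_on (vset s) (adj_in_simplex E s) /\
    exists x y, [/\ x \in vset s, y \in vset s & adj_in_simplex E s x y].

(* [G] is isomorphic to the multigraph with vertices [gvert K] and edges [E]:
   adjacent vertices of [G] are joined by exactly one edge, nonadjacent ones by
   none. *)
Definition isomorphic_to_skeleton_subgraph (V : finType) (G : sgraph V)
    (K : gsc) (E : {set gsimplex K}) : Prop :=
  exists f : V -> gvert K, bijective f /\
    forall x y, #|[set e in E | vset e == [set f x; f y]%SET]| = G x y :> nat.

Definition embeds_as_quadrangulation (R : realType) (V : finType)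
    (G : sgraph V) (X : topologicalType) : Prop :=
  exists (K : gsc) (E : {set gsimplex K}),
    [/\ triangulates R K X, quadrangulation E
      & isomorphic_to_skeleton_subgraph G E].

(* Main.v *)
(* Put nodes tau_i = M^i, with M large, on the vertices of the cycle, and let V
   be the space of vectors c in R^n orthogonal to the values at the nodes of all
   polynomials of degree at most 2k - 2, so that dim V = n - 2k + 1.  A stable
   k-set A defines the functional c |-> sum_(i in A) c_i on V.  Giving the
   functionals generic heights close to 1, the vectors +A and -A span a centrally
   symmetric complete simplicial fan, whose quotient by the antipodal map
   triangulates the projective space; QG(n,k) consists of the edges joining
   vectors of opposite signs.

   Opposite signs in a cone force disjoint sets: for the normal c of a facet, an
   exchange argument puts the sets of maximal weight inside {c > 0}, and those of
   minimal weight inside {c < 0}.  No facet has constant signs: all its sets would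
   lie in {c > 0}, but a facet normal has few nonpositive entries, by a count of
   roots of polynomials whose values at the nodes are dominated geometrically.
   Hence QG(n,k) is a quadrangulation.  For a colouring with n - 2k + 1 colours, a
   Fan-type parity argument along the flag of coordinate subspaces would give a
   facet with constant signs, so that n - 2k + 2 colours are needed; the colouring
   of a set by its minimum, truncated at n - 2k + 1, shows that they suffice. *)
Require Import Defs.
From mathcomp Require Import all_boot all_order all_algebra.
From mathcomp Require Import boolp reals.
From mathcomp Require polyrcf.
From mathcomp Require Import ring lra zify.

Set Implicit Arguments.
Unset Strict Implicit.
Unset Printing Implicit Defensive.

Import Order.TTheory GRing.Theory Num.Theory.

Local Open Scope ring_scope.

(** * A symmetric simplicial fan and its colourings *)

(** The fan is never listed cone by cone. It is the normal fan of the polytope of all [x] with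
    [|dot x (u a)| <= h a], so that completeness and uniqueness of cones are linear programming
    duality, and the parity argument follows edges of the sections of this polytope by the
    coordinate flag. Generic heights make these sections simple; their limit 1 is where weights of
    stable sets are compared. The obstacle is to bound by [k] the number of nonpositive entries of a
    normal [c] determined by its sets of weight 1. These sets span a face of the polytope of
    fractional stable sets, so [c] is a combination of the active inequalities plus a multiple of
    the all-ones vector. Testing [c] with a polynomial that kills every active form but the one at
    [b] relates its sign at [b] to the sign of the sum of its values at the other nodes. For
    arbitrary nodes this sum is out of control. With nodes [M^i], [M = 100 n], one node [u], the
    same for all [b], decides its sign, and counting roots between [b] and [u] leaves for [b] only
    half of the available positions. *)

Section Dot.
Variables (R : comNzRingType) (N : nat).
Implicit Types (x y : 'rV[R]_N).

Definition dot x y : R := \sum_i x 0 i * y 0 i.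

Lemma dotDl x1 x2 y : dot (x1 + x2) y = dot x1 y + dot x2 y.
Proof. by rewrite -big_split; apply: eq_bigr => i _; rewrite mxE mulrDl. Qed.

Lemma dotZl a x y : dot (a *: x) y = a * dot x y.
Proof. by rewrite mulr_sumr; apply: eq_bigr => i _; rewrite mxE mulrA. Qed.

Lemma dotC x y : dot x y = dot y x.
Proof. by apply: eq_bigr => i _; rewrite mulrC. Qed.

Lemma dotDr x y1 y2 : dot x (y1 + y2) = dot x y1 + dot x y2.
Proof. by rewrite dotC dotDl !(dotC x). Qed.

Lemma dotZr a x y : dot x (a *: y) = a * dot x y.
Proof. by rewrite dotC dotZl dotC. Qed.

Lemma dotNl x y : dot (- x) y = - dot x y.
Proof. by rewrite -scaleN1r dotZl mulN1r. Qed.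

Lemma dot0l y : dot 0 y = 0.
Proof. by rewrite -(scale0r 0) dotZl mul0r. Qed.

Lemma dot_sumr (I : Type) (r : seq I) (P : pred I) x (F : I -> 'rV[R]_N) :
  dot x (\sum_(i <- r | P i) F i) = \sum_(i <- r | P i) dot x (F i).
Proof.
elim/big_rec2: _ => [|i a b _ <-]; first by rewrite dotC dot0l.
by rewrite dotDr.
Qed.

End Dot.

Section Kernel.
Variable F : fieldType.

Lemma annihilator_ex (N : nat) (s : seq 'rV[F]_N) :
  (size s < N)%N -> exists2 x : 'rV[F]_N, x != 0 & {in s, forall y, dot x y = 0}.
Proof.
move=> sN; pose A := \matrix_(i < size s) s`_i : 'M[F]_(size s, N).
have : kermx A^T != 0.
  rewrite -mxrank_eq0 mxrank_ker mxrank_tr -lt0n subn_gt0.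
  exact: leq_ltn_trans (rank_leq_row _) sN.
case/matrix0Pn => i [j kij]; exists (row i (kermx A^T)).
  by apply/matrix0Pn; exists 0, j; rewrite mxE.
move=> y ys; have lt_i : (index y s < size s)%N by rewrite index_mem.
have /rowP/(_ (Ordinal lt_i)) : row i (kermx A^T) *m A^T = 0.
  by rewrite -row_mul mulmx_ker row0.
rewrite !mxE => e; rewrite -[RHS]e; apply: eq_bigr => l _.
by rewrite !mxE nth_index.
Qed.

Lemma dependency_ex (I : finType) (w : I -> nat -> F) (j : nat) (A : {set I}) :
  (j < #|A|)%N -> exists al : I -> F, [/\ exists2 v, v \in A & al v != 0,
    forall v, v \notin A -> al v = 0 &
    forall i, (i < j)%N -> \sum_v al v * w v i = 0].
Proof.
move=> jA; pose s := [seq \row_(a < #|A|) w (enum_val a) i | i <- iota 0 j].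
have [|x x0 xs] := @annihilator_ex #|A| s; first by rewrite size_map size_iota.
pose al v := if [pick a : 'I_#|A| | enum_val a == v] is Some a then x 0 a else 0.
have alE a : al (enum_val a) = x 0 a.
  rewrite /al; case: pickP => [b /eqP/enum_val_inj -> //|/(_ a)].
  by rewrite eqxx.
have al0 v : v \notin A -> al v = 0.
  rewrite /al; case: pickP => // a /eqP <-; by rewrite enum_valP.
exists al; split=> //.
  case/rV0Pn: x0 => a xa; exists (enum_val a); rewrite ?enum_valP ?alE //.
move=> i ij; rewrite (bigID (mem A)) /= addrC big1 ?add0r; last first.
  by move=> v /al0 ->; rewrite mul0r.
rewrite big_enum_val /=; apply: etrans (xs (\row_a w (enum_val a) i) _).
  by apply: eq_bigr => a _; rewrite alE mxE.
by apply/mapP; exists i; rewrite // mem_iota.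
Qed.

End Kernel.

(** * Parity of the alternating facets of one simplex *)

Section Alternating.
Variables (V : finType) (c : V -> nat) (e : V -> bool).
Implicit Types (s : {set V}) (v w : V).

Definition below s v : nat := #|[set w in s | (c w < c v)%N]|.
(** Alternating simplices in the sense of Ky Fan: listed by increasing colour, the signs alternate,
    and the first one is [b]. *)
Definition alt (b : bool) s : bool :=
  [forall v in s, forall w in s, (c v == c w) ==> (v == w)] &&
  [forall v in s, e v == b (+) odd (below s v)].

Lemma altP b s : reflect ({in s &, injective c} /\
  {in s, forall v, e v = b (+) odd (below s v)}) (alt b s).
Proof.
apply: (iffP andP) => -[h1 h2]; split.
- move=> v w vs ws /eqP cvw; apply/eqP.
  by move/forall_inP: h1 => /(_ v vs)/forall_inP/(_ w ws)/implyP/(_ cvw).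
- by move=> v vs; apply/eqP; move/forall_inP: h2 => /(_ v vs).
- apply/forall_inP => v vs; apply/forall_inP => w ws; apply/implyP => /eqP cvw.
  by apply/eqP; exact: h1.
- by apply/forall_inP => v vs; apply/eqP; exact: h2.
Qed.

Lemma below_del s v w : v \in s -> below s w = ((c v < c w) + below (s :\ v) w)%N.
Proof.
move=> vs; rewrite /below (cardsD1 v) inE vs /=; congr (_ + _)%N.
by apply: eq_card => z; rewrite !inE andbA.
Qed.

(** Two vertices that agree in colour and sign are interchangeable: swapping them changes no rank.
    Hence the alternating facets opposite to them come in pairs. *)
Lemma alt_del_repeated s v v' : v \in s -> v' \in s -> v != v' -> c v = c v' ->
  e v = e v' -> alt false (s :\ v) -> alt false (s :\ v').
Proof.
move=> vs v's vv' cvv' evv' /altP[inj he].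
have be w : below (s :\ v) w = below (s :\ v') w.
  by apply/eqP; rewrite -(eqn_add2l (c v < c w)%N) -below_del // cvv' -below_del.
apply/altP; split.
  have aux a b : a \in s :\ v' -> b \in s :\ v' -> c a = c b -> a = v -> b = v.
    move=> av' bv' cab av; apply/eqP; apply: contraT => bv.
    have : b = v'.
      apply: inj; rewrite ?in_setD1 ?bv ?v's ?(eq_sym v') ?vv' //.
      - by move: bv'; rewrite in_setD1 => /andP[].
      - by rewrite -cvv' -av.
    by move=> bE; rewrite bE in_setD1 eqxx in bv'.
  move=> a b av' bv' cab.
  have [av|av] := eqVneq a v; first by rewrite av (aux a b).
  have [bv|bv] := eqVneq b v; first by rewrite bv (aux b a).
  move: av' bv'; rewrite !in_setD1 => /andP[_ as_] /andP[_ bs].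
  by apply: inj; rewrite ?in_setD1 ?av ?bv.
move=> w; rewrite in_setD1 => /andP[wv' ws]; rewrite -be.
have [->|wv] := eqVneq w v; last by apply: he; rewrite in_setD1 wv.
rewrite evv' he ?in_setD1 ?v's 1?eq_sym ?vv' //.
by rewrite /below cvv'.
Qed.

(** The local step of Fan's lemma. A repeated colour pairs off the alternating facets and excludes
    that [s] alternates. For distinct colours everything is read from the set [D] of vertices whose
    sign breaks the alternation starting with [false]. *)
Lemma odd_alt_del s : {in s &, forall v w, c v = c w -> e v = e w} ->
  odd #|[set v in s | alt false (s :\ v)]| = alt false s (+) alt true s.
Proof.
move=> hs.
case: (pselect (exists v v', [/\ v \in s, v' \in s, v != v' & c v = c v'])).
  move=> [v [v' [vs v's vv' cvv']]].
  have nalt b : alt b s = false.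
    by apply/negP => /altP[inj _]; case/eqP: vv'; exact: inj.
  rewrite !nalt; have ee := hs v v' vs v's cvv'.
  have sub w : w \in s -> alt false (s :\ w) -> (w == v) || (w == v').
    move=> ws /altP[inj _]; apply: contraT; rewrite negb_or => /andP[wv wv'].
    case/eqP: vv'; apply: inj => //; by rewrite in_setD1 eq_sym ?wv ?wv'.
  case: (boolP (alt false (s :\ v))) => av.
    rewrite (_ : [set _ in _ | _] = [set v; v']) ?cards2 ?vv' //.
    apply/setP => w; rewrite !inE; apply/andP/orP => [[ws /(sub w ws)/orP//]|[]/eqP ->] //.
    by split=> //; exact: alt_del_repeated av.
  rewrite (_ : [set _ in _ | _] = set0) ?cards0 //.
  apply/setP => w; rewrite !inE; apply/negP => /andP[ws aw].
  case/orP: (sub w ws aw) => /eqP ew; first by rewrite -ew aw in av.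
  case/negP: av; rewrite ew in aw; apply: (alt_del_repeated _ _ _ _ _ aw) => //.
  by rewrite eq_sym.
move=> ninj; have inj : {in s &, injective c}.
  move=> v w vs ws cvw; apply/eqP; apply: contraT => vw.
  by case: ninj; exists v, w.
pose d v := e v (+) odd (below s v).
pose D := [set v in s | d v].
pose Up v := [set w in s | (c v < c w)%N].
pose Upe v := [set w in s | (c v <= c w)%N].
have alt0 : alt false s = (D == set0).
  apply/altP/eqP => [[_ he]|D0].
    by apply/setP => v; rewrite !inE; apply/negP => /andP[/he ev]; rewrite /d ev addbb.
  split=> // v vs; have := in_set0 v; rewrite -D0 inE vs /= /d.
  by case: (e v); case: (odd _).
have alt1 : alt true s = (D == s).
  apply/altP/eqP => [[_ he]|D0].
    by apply/setP => v; rewrite !inE; case: (boolP (v \in s)) => //= /he ev; rewrite /d ev addbK.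
  split=> // v vs; move: (vs); rewrite -{1}D0 inE vs /= /d.
  by case: (e v); case: (odd _).
(* Deleting [v] lowers by one exactly the ranks above [v], so the remaining facet alternates if and
   only if the defects outside [v] are the vertices above [v]; [v] itself may be defective or
   not. *)
have good v : v \in s -> alt false (s :\ v) = (D == Up v) || (D == Upe v).
  move=> vs.
  have -> : alt false (s :\ v) = [forall w in s :\ v, d w == (c v < c w)%N].
    apply/altP/forall_inP => [[_ he] w ws|he].
      rewrite /d he // (below_del w vs) oddD oddb.
      by case: (_ < _)%N; case: (odd _).
    split=> [a b|w ws]; first by rewrite !in_setD1 => /andP[_ ?] /andP[_ ?]; exact: inj.
    have := he w ws; rewrite /d (below_del w vs) oddD oddb.
    by case: (_ < _)%N; case: (odd _); case: (e w).
  apply/forall_inP/orP => [he|].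
    case: (boolP (d v)) => dv; [right|left]; apply/eqP/setP => w; rewrite !inE.
      case: (boolP (w \in s)) => //= ws; have [->|wv] := eqVneq w v; first by rewrite dv leqnn.
      rewrite (eqP (he w _)) ?in_setD1 ?wv // [RHS]leq_eqVlt; case: eqP => //= cvw.
      by case/eqP: wv; apply: inj.
    case: (boolP (w \in s)) => //= ws; have [->|wv] := eqVneq w v.
      by rewrite (negbTE dv) ltnn.
    by rewrite (eqP (he w _)) ?in_setD1 ?wv.
  case=> /eqP DE w; rewrite in_setD1 => /andP[wv ws].
    by have /setP/(_ w) := DE; rewrite !inE ws /= => ->.
  have /setP/(_ w) := DE; rewrite !inE ws /= => ->.
  rewrite [X in X == _]leq_eqVlt; case: (eqVneq (c v) (c w)) => //= cvw.
  by case/eqP: wv; apply: inj.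
have disj v : v \in s -> Up v != Upe v.
  by move=> vs; apply/eqP => /setP/(_ v); rewrite !inE vs ltnn leqnn.
pose G1 := [set v in s | D == Up v]; pose G2 := [set v in s | D == Upe v].
have -> : odd #|[set v in s | alt false (s :\ v)]| = odd #|G1| (+) odd #|G2|.
  rewrite -oddD -cardsUI (_ : G1 :&: G2 = set0) ?cards0 ?addn0.
    by congr odd; apply: eq_card => v; rewrite !inE; case: (boolP (v \in s)) => //= /good ->.
  apply/setP => v; rewrite !inE; apply/negP => /andP[/andP[vs /eqP DE] /andP[_ /eqP DE']].
  by have := disj v vs; rewrite -DE -DE' eqxx.
have wlog_c v w : v \in s -> w \in s -> (c v <= c w)%N -> (c w <= c v)%N -> v = w.
  by move=> vs ws h1 h2; apply: inj => //; apply/eqP; rewrite eqn_leq h1.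
have G1uniq v w : v \in G1 -> w \in G1 -> v = w.
  rewrite !inE => /andP[vs /eqP DE] /andP[ws /eqP DE'].
    have /setP/(_ w) := DE; rewrite DE' !inE ws ltnn /= => /esym/negbT; rewrite -leqNgt => h3.
  have /setP/(_ v) := DE'; rewrite DE !inE vs ltnn /= => /esym/negbT; rewrite -leqNgt => h4.
  exact: wlog_c.
have G2uniq v w : v \in G2 -> w \in G2 -> v = w.
  rewrite !inE => /andP[vs /eqP DE] /andP[ws /eqP DE'].
  have /setP/(_ w) := DE; rewrite DE' !inE ws leqnn /= => /esym h3.
  have /setP/(_ v) := DE'; rewrite DE !inE vs leqnn /= => /esym h4.
  exact: wlog_c.
have cardG (G : {set V}) : (forall v w, v \in G -> w \in G -> v = w) -> odd #|G| = (G != set0).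
  move=> Gu; case: (set_0Vmem G) => [->|[v vG]]; first by rewrite cards0 eqxx.
  rewrite (_ : G = [set v]) ?cards1; first by apply/esym/set0Pn; exists v; rewrite set11.
  by apply/setP => w; rewrite inE; apply/idP/eqP => [wG|->//]; exact: Gu.
rewrite alt0 alt1 (cardG G1 G1uniq) (cardG G2 G2uniq).
(* If [D] is not closed upwards, both sides vanish. If it is, [G1] is a singleton unless [D = s],
   and [G2] is a singleton unless [D] is empty, which gives the parity on the right. *)
case: (pselect (forall v w, v \in D -> w \in s -> (c v <= c w)%N -> w \in D)); last first.
  move=> nup.
  have -> : G1 = set0.
    apply/setP => a; rewrite inE in_set0; apply/negP => /andP[as_ /eqP DE]; case: nup => v w.
    by rewrite DE !inE => /andP[_ h1] -> h2; rewrite (leq_trans h1 h2).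
  have -> : G2 = set0.
    apply/setP => a; rewrite inE in_set0; apply/negP => /andP[as_ /eqP DE]; case: nup => v w.
    by rewrite DE !inE => /andP[_ h1] -> h2; rewrite (leq_trans h1 h2).
  have -> : (D == set0) = false.
    by apply/negP => /eqP D0; apply: nup => v w; rewrite D0 inE.
  have -> : (D == s) = false by apply/negP => /eqP Ds; apply: nup => v w _; rewrite Ds.
  by rewrite eqxx.
move=> up.
have Dsub : D \subset s by apply/subsetP => v; rewrite inE => /andP[].
have -> : (G1 != set0) = (D != s).
  apply/idP/idP => [/set0Pn[v]|Ds].
    rewrite inE => /andP[vs /eqP DE]; apply/eqP => Ds.
    by move: vs; rewrite -Ds DE inE ltnn andbF.
  have /subsetPn[v0 v0s v0D] : ~~ (s \subset D).
    by apply: contra Ds => sD; rewrite eqEsubset Dsub.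
  have P0 : (v0 \in s) && (v0 \notin D) by rewrite v0s.
  case: (@arg_maxnP V v0 (fun v => (v \in s) && (v \notin D)) c P0) => v /= /andP[vs vD] vmax.
  apply/set0Pn; exists v; rewrite inE vs /=; apply/eqP/setP => w.
  rewrite [in RHS]inE; case: (boolP (w \in s)) => /= ws; last first.
    by apply/negbTE; apply: contra ws => /(subsetP Dsub).
  apply/idP/idP => [wD|cvw].
    by rewrite ltnNge; apply: contra vD => cwv; apply: (up w v).
  by apply: contraT => wD; have := vmax w; rewrite ws wD leqNgt cvw => /(_ isT).
have -> : (G2 != set0) = (D != set0).
  apply/idP/idP => [/set0Pn[v]|/set0Pn[v0 v0D]].
    rewrite inE => /andP[vs /eqP DE]; apply/eqP => D0.
    by have := in_set0 v; rewrite -D0 DE inE vs leqnn.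
  case: (@arg_minnP V v0 (mem D) c v0D) => v /= vD vmin.
  have vs := subsetP Dsub v vD.
  apply/set0Pn; exists v; rewrite inE vs /=; apply/eqP/setP => w.
  rewrite [in RHS]inE; case: (boolP (w \in s)) => /= ws; last first.
    by apply/negbTE; apply: contra ws => /(subsetP Dsub).
  by apply/idP/idP => [/vmin //|cvw]; apply: (up v w).
by case: (D == s); case: (D == set0).
Qed.

End Alternating.

(** * The polytope of feasible normals and its normal fan *)

Section Fan.
Variables (R : realFieldType) (T : finType) (N : nat).
Variables (u : T -> 'rV[R]_N) (h : T -> R).

Notation vertex := (T * bool)%type.
Implicit Types (x y : 'rV[R]_N) (v w : vertex) (s : {set vertex}).

Definition sv v : 'rV[R]_N := (-1) ^+ v.2 *: u v.1.
Definition opp v : vertex := (v.1, ~~ v.2).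

(** The polar side of the fan: the vertices of this centrally symmetric polytope are the facet
    normals, and the cone of a facet is generated by the signed vectors tight at its vertex. *)
Definition feas x := forall a, `|dot x (u a)| <= h a.
Definition tight x : {set vertex} := [set v | dot x (sv v) == h v.1].
Definition inV (j : nat) x := forall i : 'I_N, (j <= i)%N -> x 0 i = 0.

Definition face s := exists2 x, feas x & s \subset tight x.

Hypothesis h_gt0 : forall a, 0 < h a.
Hypothesis span : forall x, (forall a, dot x (u a) = 0) -> x = 0.
(** General position along the flag: at a point whose coordinates from [j] on vanish, the tight
    vectors stay independent after restriction to the first [j] coordinates. So the section of the
    polytope by each member of the flag is simple. *)
Hypothesis gp : forall (j : nat) x (al : vertex -> R), inV j x ->
  (forall v, v \notin tight x -> al v = 0) ->
  (forall i : 'I_N, (i < j)%N -> \sum_v al v * sv v 0 i = 0) -> forall v, al v = 0.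

Lemma oppK : involutive opp.
Proof. by case=> a b; rewrite /opp /= negbK. Qed.

Lemma opp_inj : injective opp. Proof. exact: inv_inj oppK. Qed.

Lemma sv_opp v : sv (opp v) = - sv v.
Proof. by rewrite /sv /= signrN scaleNr. Qed.

Lemma feasP x : feas x <-> forall v, dot x (sv v) <= h v.1.
Proof.
split=> [fx [a b]|fx a].
  rewrite /sv /= dotZr; case: b => /=; have := fx a; rewrite ler_norml => /andP[].
    by rewrite expr1 mulN1r lerNl.
  by rewrite expr0 mul1r.
rewrite ler_norml; have := fx (a, false); have := fx (a, true).
by rewrite /sv /= !dotZr expr1 expr0 mulN1r mul1r lerNl => -> ->.
Qed.

Lemma inVN x : inV N x.
Proof. by move=> i; rewrite leqNgt ltn_ord. Qed.

Lemma inVD j x y (a : R) : inV j x -> inV j y -> inV j (x + a *: y).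
Proof. by move=> xj yj i ji; rewrite !mxE xj // yj // mulr0 addr0. Qed.

Lemma dotNr x y : dot x (- y) = - dot x y.
Proof. by rewrite dotC dotNl dotC. Qed.

Lemma feasN x : feas x -> feas (- x).
Proof. by move=> fx a; rewrite dotNl normrN. Qed.

Lemma inVN1 j x : inV j x -> inV j (- x).
Proof. by move=> xj i ji; rewrite mxE xj // oppr0. Qed.

Lemma tightN x : tight (- x) = opp @: tight x.
Proof.
apply/setP => v; rewrite -{2}(oppK v) (mem_imset _ _ opp_inj) !inE sv_opp.
by rewrite dotNl dotNr.
Qed.

Lemma tight_opp x v : v \in tight x -> opp v \notin tight x.
Proof.
rewrite !inE sv_opp dotNr => /eqP -> /=; apply/eqP => e.
by have := h_gt0 v.1; lra.
Qed.

Lemma card_tight j x : inV j x -> (j <= N)%N -> (#|tight x| <= j)%N.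
Proof.
move=> xj jN; rewrite leqNgt; apply/negP => jt.
pose w v (i : nat) : R := if insub i is Some i' then sv v 0 i' else 0.
have [al [[v _ alv] al0 al1]] := dependency_ex w jt.
move: alv; rewrite (gp xj al0) ?eqxx // => i ij.
rewrite -[RHS](al1 i ij); apply: eq_bigr => v' _.
by rewrite /w; case: insubP => [i' _ /val_inj -> //|]; rewrite ltn_ord.
Qed.

Lemma annihilator_inV j s : (j <= N)%N -> (#|s| < j)%N ->
  exists d, [/\ d != 0, inV j d & forall v, v \in s -> dot d (sv v) = 0].
Proof.
move=> jN sj; pose A := [set widen_ord jN i | i : 'I_j].
have cA : #|A| = j by rewrite card_imset ?card_ord // => a b [] /val_inj.
pose l := [seq sv v | v <- enum s].
have [|al [[i _ ali] al0 al1]] := @dependency_ex R 'I_N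
  (fun i m => (nth 0 l m) 0 i) #|s| A; first by rewrite cA.
exists (\row_i al i); split.
- by apply/rV0Pn; exists i; rewrite mxE.
- move=> i' ji'; rewrite mxE al0 //; apply/imsetP => -[i'' _ e].
  by move: ji'; rewrite e /= leqNgt ltn_ord.
move=> v vs; have := al1 (index v (enum s)).
rewrite cardE index_mem mem_enum => /(_ vs) e; rewrite -[RHS]e.
apply: eq_bigr => i' _; rewrite mxE /l (nth_map v) ?index_mem ?mem_enum //.
by rewrite nth_index ?mem_enum.
Qed.

(** The ratio test of the simplex method. No constraint tight at [x] becomes violated along [d],
    [span] makes some constraint block the way, and the first one to block determines [r]. *)
Lemma pivot j x d : feas x -> inV j x -> inV j d -> d != 0 ->
    (forall v, v \in tight x -> dot d (sv v) <= 0) ->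
  exists r w, let x' := x + r *: d in
    [/\ 0 < r, feas x', inV j x', w \in tight x' & 0 < dot d (sv w)].
Proof.
move=> fx xj dj d0 dt.
have [w0 dw0] : exists w, 0 < dot d (sv w).
  have [a da] : exists a, dot d (u a) != 0.
    apply/existsP; rewrite -[[exists _, _]]negbK negb_exists; apply: contra d0 => /forallP d0.
    by apply/eqP/span => a; apply/eqP; rewrite -[_ == _]negbK d0.
  case: (ltrgt0P (dot d (u a))) da => // da _.
    by exists (a, false); rewrite /sv dotZr mul1r.
  by exists (a, true); rewrite /sv dotZr mulN1r oppr_gt0.
pose q w := (h w.1 - dot x (sv w)) / dot d (sv w).
case: (@Order.TotalTheory.arg_minP _ _ _ w0 (fun w => 0 < dot d (sv w)) q dw0) => w dw qmin.
have q_gt0 : 0 < q w.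
  have := (feasP x).1 fx w; rewrite le_eqVlt => /orP[wt|lt].
    by have := dt w; rewrite inE wt leNgt dw => /(_ isT).
  by rewrite divr_gt0 // subr_gt0.
exists (q w), w; split=> //.
- apply/feasP => v; rewrite dotDl dotZl.
  have := (feasP x).1 fx v; case: (ltrP 0 (dot d (sv v))) => [dv|dv xv].
    by move=> _; have := qmin v dv; rewrite {2}/q ler_pdivlMr // lerBrDl.
  by rewrite (le_trans _ xv) // gerDl mulr_ge0_le0 // ltW.
- exact: inVD.
- rewrite inE dotDl dotZl /q divfK; last by rewrite gt_eqF.
  by apply/eqP; rewrite addrC subrK.
Qed.

Lemma extend j x : (j <= N)%N -> feas x -> inV j x ->
  exists x', [/\ feas x', inV j x', tight x \subset tight x' & #|tight x'| = j].
Proof.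
move=> jN fx xj; have [m] := ubnP (j - #|tight x|)%N.
elim: m x fx xj => // m IH x fx xj lt_m.
have := card_tight xj jN; rewrite leq_eqVlt => /orP[/eqP tj|tj]; first by exists x.
have [d [d0 dj dt]] := annihilator_inV jN tj.
have [|r [w [r0 fx' xj' wt dw]]] := pivot fx xj dj d0.
  by move=> v /dt ->.
have sub : tight x \subset tight (x + r *: d).
  by apply/subsetP => v vt; move: (vt); rewrite !inE dotDl dotZl (dt v vt) mulr0 addr0.
have prop : tight x \proper tight (x + r *: d).
  rewrite properE sub; apply/subsetPn; exists w => //.
  by apply: contraL dw => /dt ->; rewrite ltxx.
have [|x'' [? ? s'' ?]] := IH _ fx' xj'.
  by have := proper_card prop; have := card_tight xj' jN; lia.
by exists x''; split=> //; exact: subset_trans s''.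
Qed.

Lemma feas0 : feas 0.
Proof. by move=> a; rewrite dot0l normr0 ltW. Qed.

Lemma face_sub s s' : s \subset s' -> face s' -> face s.
Proof. by move=> ss' [x fx xs]; exists x => //; exact: subset_trans xs. Qed.

Lemma face_full s : face s -> exists x, [/\ feas x, s \subset tight x & #|tight x| = N].
Proof.
move=> [x fx sx]; have [x' [fx' _ xx' c]] := extend (leqnn N) fx (@inVN x).
by exists x'; split=> //; exact: subset_trans xx'.
Qed.

Lemma tight_free x (al : vertex -> R) : (forall v, v \notin tight x -> al v = 0) ->
  \sum_v al v *: sv v = 0 -> forall v, al v = 0.
Proof.
move=> al0 /rowP e; apply: (gp (@inVN x) al0) => i _.
transitivity ((\sum_v al v *: sv v) 0 i); last by rewrite e mxE.
by rewrite summxE; apply: eq_bigr => v _; rewrite [RHS]mxE.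
Qed.


(** A nonzero [d] would carry [x], with all of [s] kept tight, to a point where one more equality
    holds; [card_tight] forbids [j + 1] equalities. *)
Lemma annihilator_tight j x d s : inV j x -> (j <= N)%N -> inV j d ->
  s \subset tight x -> #|s| = j -> (forall v, v \in s -> dot d (sv v) = 0) -> d = 0.
Proof.
move=> xj jN dj sx cs ds; apply: contrapT => /eqP d0.
have [v dv] : exists v, dot d (sv v) != 0.
  apply: contrapT => nv; move/eqP: d0; apply; apply: span => a.
  apply: contrapT => /eqP da; apply: nv; exists (a, false).
  by rewrite /sv dotZr mul1r.
pose r := (h v.1 - dot x (sv v)) / dot d (sv v).
have := card_tight (inVD r xj dj) jN; rewrite leqNgt => /negP; apply.
apply: (@leq_trans #|v |: s|).
  rewrite cardsU1 cs; case: (boolP (v \in s)) => // /ds e.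
  by rewrite e eqxx in dv.
apply: subset_leq_card; apply/subsetP => w; rewrite !inE => /orP[/eqP ->|ws].
  by apply/eqP; rewrite dotDl dotZl /r divfK // addrC subrK.
by have := subsetP sx w ws; rewrite inE dotDl dotZl ds // mulr0 addr0.
Qed.

Lemma tight_basis x y : #|tight x| = N ->
  exists2 t : vertex -> R, (forall v, v \notin tight x -> t v = 0) & y = \sum_v t v *: sv v.
Proof.
move=> cx; pose A := \matrix_(a < #|tight x|) sv (enum_val a).
pose ext (w : 'rV[R]_#|tight x|) v :=
  if [pick a | enum_val a == v] is Some a then w 0 a else 0.
have extE (z : 'rV_#|tight x|) a : ext z (enum_val a) = z 0 a.
  rewrite /ext; case: pickP => [b /eqP/enum_val_inj -> //|/(_ a)].
  by rewrite eqxx.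
have ext0 (z : 'rV_#|tight x|) v : v \notin tight x -> ext z v = 0.
  rewrite /ext; case: pickP => // a /eqP <-; by rewrite enum_valP.
have extM (z : 'rV_#|tight x|) : z *m A = \sum_v ext z v *: sv v.
  rewrite (bigID (mem (tight x))) /= addrC big1 ?add0r; last first.
    by move=> v /ext0 ->; rewrite scale0r.
  rewrite big_enum_val /= mulmx_sum_row; apply: eq_bigr => a _.
  by rewrite extE rowK.
have /eqP rA : row_free A.
  apply: inj_row_free => z /eqP; rewrite extM => /eqP /(tight_free (ext0 z)) e.
  by apply/rowP => a; rewrite mxE -extE e.
have /submxP[z ->] : (y <= A)%MS by apply: submx_full; rewrite /row_full rA cx.
by exists (ext z) => //; exact: ext0.
Qed.

(** Completeness of the fan by linear programming: at the vertex maximising [dot x y], a negative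
    coefficient of [y] in the basis of tight vectors would allow an improving pivot. *)
Lemma decomposition y : exists x (t : vertex -> R),
  [/\ feas x, forall v, 0 <= t v, forall v, v \notin tight x -> t v = 0 &
      y = \sum_v t v *: sv v].
Proof.
(* Vertices are represented by their tight sets, which form a finite type, so that a maximiser
   exists; [X] recovers the vertex from its tight set. *)
pose good s x := [/\ feas x, tight x = s & #|s| = N].
have ex s : exists x, (exists x', good s x') -> good s x.
  case: (pselect (exists x, good s x)) => [[x gx]|n]; first by exists x.
  by exists 0.
have [X XP] := choice ex.
have [x0 [fx0 _ _ cx0]] := extend (leqnn N) feas0 (@inVN 0).
have P0 : `[< exists x, good (tight x0) x >] by apply/asboolP; exists x0.
case: (@Order.TotalTheory.arg_maxP _ _ _ (tight x0)
  (fun s => `[< exists x, good s x >]) (fun s => dot (X s) y) P0) => s /asboolP gs smax.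
have [fx tx cs] := XP s gs; set x := X s in fx tx smax *.
have [|t t0 yt] := @tight_basis x y; first by rewrite tx.
exists x, t; split=> // v; rewrite leNgt; apply/negP => tv.
have vx : v \in tight x by apply: contraT => /t0 tv0; rewrite tv0 ltxx in tv.
have [|d0 [d0n _ d0s]] := @annihilator_inV N (tight x :\ v) (leqnn N).
  by rewrite tx -cs (cardsD1 v s) -tx vx.
have [d [dn dv ds]] : exists d, [/\ d != 0, dot d (sv v) < 0 &
    forall w, w \in tight x :\ v -> dot d (sv w) = 0].
  have d0v : dot d0 (sv v) != 0.
    apply: contra d0n => /eqP e; apply/eqP.
    apply: (@annihilator_tight N x d0 (tight x)) => //; [exact: inVN|exact: inVN|by rewrite tx|].
    by move=> w wx; case: (eqVneq w v) => [->//|wv]; apply: d0s; rewrite in_setD1 wv.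
  case: (ltrgt0P (dot d0 (sv v))) d0v => // d0v _; last by exists d0.
  exists (- d0); rewrite oppr_eq0 dotNl oppr_lt0; split=> // w /d0s e.
  by rewrite dotNl e oppr0.
have [|r [w [r0 fx' _ wt dw]]] := pivot fx (@inVN x) (@inVN d) dn.
  move=> w wx; case: (eqVneq w v) => [->|wv]; first exact: ltW.
  by rewrite ds // in_setD1 wv.
have sub : w |: (tight x :\ v) \subset tight (x + r *: d).
  apply/subsetP => w'; rewrite in_setU1 => /orP[/eqP -> //|w's].
  rewrite inE dotDl dotZl ds // mulr0 addr0.
  by move: w's; rewrite in_setD1 => /andP[_]; rewrite inE.
have cx' : #|tight (x + r *: d)| = N.
  apply/eqP; rewrite eqn_leq card_tight ?leqnn //; last exact: inVN.
  apply: leq_trans (subset_leq_card sub); rewrite cardsU1.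
  have -> : w \notin tight x :\ v by apply/negP => /ds e; rewrite e ltxx in dw.
  by rewrite tx -cs (cardsD1 v s) -tx vx.
have gx' : exists x1, good (tight (x + r *: d)) x1 by exists (x + r *: d).
have /= := smax (tight (x + r *: d)) (asboolT gx').
have [fX tX _] := XP _ gx'.
have -> : X (tight (x + r *: d)) = x + r *: d.
  apply/eqP; rewrite -subr_eq0; apply/eqP.
  apply: (@annihilator_tight N (x + r *: d) _ (tight (x + r *: d))) => //; try exact: inVN.
  move=> w'; rewrite dotDl dotNl; set z := X _ in tX *; move=> w't.
  by move: (w't); rewrite -tX inE => /eqP ->; move: w't; rewrite inE => /eqP ->; rewrite subrr.
(* The pivot changes the objective by [r * (t v * dot d (sv v))], where [r] is positive and both
   other factors are negative. *)
rewrite dotDl dotZl gerDl leNgt => /negP; apply.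
rewrite mulr_gt0 // yt dot_sumr (bigD1 v) //= big1 ?addr0 => [|w' w'v].
  by rewrite dotZr nmulr_rgt0.
rewrite dotZr; case: (boolP (w' \in tight x)) => [w'x|/t0 ->]; last by rewrite mul0r.
by rewrite ds ?mulr0 // in_setD1 w'v.
Qed.

(** Complementary slackness: the sum of [t v * h v.1] is the maximum of [dot z y] over feasible [z],
    so it is the same for both decompositions. This confines the support of [t'] to the vectors
    tight at [x], and those are independent. *)
Lemma decomposition_uniq x x' (t t' : vertex -> R) : feas x -> feas x' ->
  (forall v, 0 <= t v) -> (forall v, 0 <= t' v) ->
  (forall v, v \notin tight x -> t v = 0) -> (forall v, v \notin tight x' -> t' v = 0) ->
  \sum_v t v *: sv v = \sum_v t' v *: sv v -> forall v, t v = t' v.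
Proof.
move=> fx fx' t_ge0 t'_ge0 t0 t'0 e.
have val z (s : vertex -> R) : (forall v, v \notin tight z -> s v = 0) ->
    dot z (\sum_v s v *: sv v) = \sum_v s v * h v.1.
  move=> s0; rewrite dot_sumr; apply: eq_bigr => v _; rewrite dotZr.
  by case: (boolP (v \in tight z)) => [|/s0 ->]; rewrite ?mul0r // inE => /eqP ->.
have bound z (s : vertex -> R) : feas z -> (forall v, 0 <= s v) ->
    dot z (\sum_v s v *: sv v) <= \sum_v s v * h v.1.
  move=> fz s_ge0; rewrite dot_sumr; apply: ler_sum => v _; rewrite dotZr.
  by apply: ler_wpM2l => //; apply: (feasP z).1.
have eqh : \sum_v t v * h v.1 = \sum_v t' v * h v.1.
  apply/eqP; rewrite eq_le -{1}(val x t t0) e bound //=.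
  by rewrite -(val x' t' t'0) -e bound.
have t'x v : v \notin tight x -> t' v = 0.
  move=> vx; apply/eqP; apply: contraT => t'v.
  have : dot x (\sum_v t' v *: sv v) < \sum_v t' v * h v.1.
    rewrite dot_sumr (bigD1 v) //= [X in _ < X](bigD1 v) //= dotZr.
    apply: ltr_leD; last first.
      by apply: ler_sum => w _; rewrite dotZr ler_wpM2l //; apply: (feasP x).1.
    rewrite ltr_pM2l; last by rewrite lt_def t'v t'_ge0.
    by rewrite lt_neqAle ((feasP x).1 fx) andbT; move: vx; rewrite inE.
  by rewrite -e (val x t t0) eqh ltxx.
have ext v : v \notin tight x -> t v - t' v = 0 by move=> vx; rewrite t0 // t'x // subrr.
move=> v; apply/eqP; rewrite -subr_eq0; apply/eqP; move: v.
apply: (tight_free ext); under eq_bigr do rewrite scalerBl.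
by rewrite sumrB e subrr.
Qed.


(** Keeping [i] constraints tight inside [inV i.+1] leaves an edge of the section; by general
    position each end gains exactly one further tight constraint. *)
Lemma segment i s x0 : (i < N)%N -> #|s| = i -> feas x0 -> inV i.+1 x0 -> s \subset tight x0 ->
  exists x1 d r w1 w2, let x2 := x1 + r *: d in
    [/\ [/\ 0 < r, feas x1, feas x2, inV i.+1 x1 & inV i.+1 d],
        [/\ tight x1 = w1 |: s, tight x2 = w2 |: s, w1 \notin s & w2 \notin s] &
        [/\ forall v, v \in s -> dot d (sv v) = 0, dot d (sv w1) < 0 & 0 < dot d (sv w2)]].
Proof.
move=> iN cs fx0 x0i sx0.
have [x1 [fx1 x1i x01 cx1]] := extend iN fx0 x0i.
have sx1 : s \subset tight x1 := subset_trans sx0 x01.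
have [w1 tx1 w1s] : exists2 w1, tight x1 = w1 |: s & w1 \notin s.
  have /cards1P[w1 e] : #|tight x1 :\: s| == 1%N.
    by rewrite cardsD (setIidPr sx1) cx1 cs subSnn.
  exists w1; first by rewrite -e -[LHS](setID _ s) (setIidPr sx1) setUC.
  by have := set11 w1; rewrite -e inE => /andP[].
have [|d0 [d0n d0i d0s]] := @annihilator_inV i.+1 s iN; first by rewrite cs.
have d0w : dot d0 (sv w1) != 0.
  apply: contra d0n => /eqP e; apply/eqP.
  apply: (@annihilator_tight i.+1 x1 d0 (tight x1)) => // v.
  by rewrite tx1 in_setU1 => /orP[/eqP ->|/d0s].
have [d [dn di ds dw1]] : exists d, [/\ d != 0, inV i.+1 d,
    forall v, v \in s -> dot d (sv v) = 0 & dot d (sv w1) < 0].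
  case: (ltrgt0P (dot d0 (sv w1))) d0w => // d0w _; last by exists d0.
  exists (- d0); rewrite oppr_eq0 dotNl oppr_lt0; split=> // [|v vs]; first exact: inVN1.
  by rewrite dotNl d0s // oppr0.
have [|r [w2 [r0 fx2 x2i w2t dw2]]] := pivot fx1 x1i di dn.
  by move=> v; rewrite tx1 in_setU1 => /orP[/eqP ->|/ds ->//]; exact: ltW.
have w2s : w2 \notin s by apply/negP => /ds e; rewrite e ltxx in dw2.
exists x1, d, r, w1, w2; split; split=> //.
apply/esym/eqP; rewrite eqEcard cardsU1 w2s cs (card_tight x2i iN) andbT.
apply/subsetP => v; rewrite in_setU1 => /orP[/eqP -> //|vs].
have := subsetP sx1 v vs; by rewrite !inE dotDl dotZl ds // mulr0 addr0.
Qed.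

Lemma inV_le i j x : (i <= j)%N -> inV i x -> inV j x.
Proof. by move=> ij xi l jl; apply: xi; exact: leq_trans jl. Qed.

Lemma inV_pred (i0 : 'I_N) x : inV i0.+1 x -> x 0 i0 = 0 -> inV i0 x.
Proof.
move=> xi e l; rewrite leq_eqVlt => /orP[/eqP il|]; last exact: xi.
by rewrite -e; congr (x 0 _); exact: val_inj.
Qed.

Lemma feas_conv x d r q : feas x -> feas (x + r *: d) -> 0 <= q -> q <= r -> 0 < r ->
  feas (x + q *: d).
Proof.
move=> /feasP f1 /feasP f2 q0 qr r0; apply/feasP => v.
have := f1 v; have := f2 v; rewrite !dotDl !dotZl => h2 h1.
have : dot x (sv v) + q * dot d (sv v) = (1 - q / r) * dot x (sv v) +
   (q / r) * (dot x (sv v) + r * dot d (sv v)) by field; rewrite gt_eqF.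
move=> ->; have qr0 : 0 <= q / r by rewrite divr_ge0 // ltW.
have qr1 : q / r <= 1 by rewrite ler_pdivrMr // mul1r.
have : (1 - q / r) * dot x (sv v) <= (1 - q / r) * h v.1 by rewrite ler_wpM2l // subr_ge0.
have := ler_wpM2l qr0 h2; lra.
Qed.


(** * Fan-type parity argument along the flag *)

Section Parity.
Variable col : T -> 'I_N.
Hypothesis col_proper : forall v w, face [set v; w] -> v.2 != w.2 -> col v.1 != col w.1.

(* Signs twisted by the parity of the colour: a simplex using all colours whose
   twisted signs alternate has constant signs. *)
Definition eta v : bool := v.2 (+) odd (col v.1).
Notation alt := (alt (fun v : vertex => col v.1 : nat) eta).

(** Vertices of the section by [inV i0.+1], recorded by their tight sets, on the side where the
    newest coordinate is positive. *)
Definition hemi (i0 : 'I_N) s : bool := `[< exists x,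
  [/\ feas x, inV i0.+1 x, tight x = s, #|s| = i0.+1 & 0 < x 0 i0] >].

(** The constraints of [s] cut out an edge of the section. No end has newest coordinate 0, since a
    point of [inV i0] has at most [i0] tight constraints. So exactly one end is on the positive side
    if and only if the edge crosses the previous section, at a point whose tight set is [s]. *)
Lemma card_hemi (i0 : 'I_N) s : #|s| = i0 ->
  odd #|[set s' | hemi i0 s' & s \subset s']| =
  `[< exists x, [/\ feas x, inV i0 x & tight x = s] >].
Proof.
move=> cs; have i0N := ltn_ord i0.
case: (pselect (exists x0, [/\ feas x0, inV i0.+1 x0 & s \subset tight x0])); last first.
  move=> nx; rewrite (_ : [set _ | _ & _] = set0) ?cards0.
    apply/esym/asboolPn => -[x [fx xi tx]]; apply: nx; exists x; split=> //.
      exact: inV_le xi.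
    by rewrite tx.
  apply/setP => s'; rewrite !inE; apply/negbTE/negP => /andP[/asboolP[x [fx xi tx _ _]] ss'].
  by apply: nx; exists x; rewrite tx.
move=> [x0 [fx0 x0i sx0]].
have [x1 [d [r [w1 [w2 [[r0 f1 f2 x1i di] [t1 t2 w1s w2s] [ds dw1 dw2]]]]]]] :=
  segment i0N cs fx0 x0i sx0.
set x2 := x1 + r *: d in f2 t2.
have online y : feas y -> inV i0.+1 y -> s \subset tight y ->
    exists q, [/\ 0 <= q, q <= r & y = x1 + q *: d].
  move=> fy yi sy; pose q := (dot y (sv w1) - dot x1 (sv w1)) / dot d (sv w1).
  have yE : y = x1 + q *: d.
    apply/eqP; rewrite -subr_eq0; apply/eqP.
    apply: (@annihilator_tight i0.+1 x1 _ (tight x1)) => //.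
    - move=> l il; rewrite !mxE yi // x1i // di // mulr0; lra.
    - by rewrite t1 cardsU1 w1s cs.
    move=> v; rewrite t1 in_setU1 dotDl dotNl dotDl dotZl => /orP[/eqP ->|vs].
      by rewrite /q divfK ?lt_eqF //; lra.
    have := subsetP sy v vs; rewrite inE => /eqP ->.
    have : v \in tight x1 by rewrite t1 in_setU1 vs orbT.
    by rewrite inE => /eqP ->; rewrite ds // mulr0; lra.
  have w1t : dot x1 (sv w1) = h w1.1 by apply/eqP; have := setU11 w1 s; rewrite -t1 inE.
  have w2t : dot x2 (sv w2) = h w2.1 by apply/eqP; have := setU11 w2 s; rewrite -t2 inE.
  exists q; split=> //.
    have := (feasP y).1 fy w1; rewrite yE dotDl dotZl w1t gerDl.
    by rewrite nmulr_lle0.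
  have := (feasP y).1 fy w2; rewrite -w2t yE !dotDl !dotZl lerD2l.
  by rewrite ler_pM2r.
have inner q : 0 < q -> q < r -> tight (x1 + q *: d) = s.
  move=> q0 qr; apply/setP => v; apply/idP/idP; last first.
    move=> vs; have : v \in tight x1 by rewrite t1 in_setU1 vs orbT.
    by rewrite !inE dotDl dotZl ds // mulr0 addr0.
  rewrite inE dotDl dotZl => /eqP vt.
  have h1 := (feasP x1).1 f1 v; have := (feasP x2).1 f2 v; rewrite /x2 dotDl dotZl => h2.
  case: (ltrgt0P (dot d (sv v))) => dv.
  - have : q * dot d (sv v) < r * dot d (sv v) by rewrite ltr_pM2r.
    lra.
  - have : q * dot d (sv v) < 0 by rewrite pmulr_rlt0.
    lra.
  have : v \in tight x1 by rewrite inE -vt dv mulr0 addr0.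
  by rewrite t1 in_setU1 => /orP[/eqP vw|//]; move: dw1; rewrite -vw dv ltxx.
have c1 : #|w1 |: s| = i0.+1 by rewrite cardsU1 w1s cs.
have c2 : #|w2 |: s| = i0.+1 by rewrite cardsU1 w2s cs.
have x2i : inV i0.+1 x2 by exact: inVD.
have n1 : x1 0 i0 != 0.
  apply/eqP => e; have := card_tight (inV_pred x1i e) (ltnW i0N).
  by rewrite t1 c1 ltnn.
have n2 : x2 0 i0 != 0.
  apply/eqP => e; have := card_tight (inV_pred x2i e) (ltnW i0N).
  by rewrite t2 c2 ltnn.
have t12 : w1 |: s != w2 |: s.
  rewrite -t2; apply/eqP => e; have : w1 \in tight x2 by rewrite -e setU11.
  rewrite inE /x2 dotDl dotZl => /eqP; have : w1 \in tight x1 by rewrite t1 setU11.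
  rewrite inE => /eqP ->; have : r * dot d (sv w1) < 0 by rewrite pmulr_rlt0.
  lra.
have hemiE s' : s \subset s' -> hemi i0 s' =
    ((s' == w1 |: s) && (0 < x1 0 i0)) || ((s' == w2 |: s) && (0 < x2 0 i0)).
  move=> ss'; apply/asboolP/orP.
    move=> [y [fy yi ty cy y0]].
    have [|q [q0 qr yE]] := online y fy yi; first by rewrite ty.
    case: (ltrgtP q 0) q0 => // [q0 _|q0 _]; last first.
      by left; move: ty y0; rewrite yE q0 scale0r addr0 t1 => <- ->; rewrite eqxx.
    case: (ltrgtP q r) qr => // [qr _|qr _]; last first.
      by right; move: ty y0; rewrite yE qr -/x2 t2 => <- ->; rewrite eqxx.
    move: cy; rewrite -ty yE inner // cs => /esym/eqP.
    by rewrite -[X in _ == X]addn0 -addn1 eqn_add2l.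
  case=> /andP[/eqP -> p0]; first by exists x1.
  by exists x2.
have -> : odd #|[set s' | hemi i0 s' & s \subset s']| = (0 < x1 0 i0) (+) (0 < x2 0 i0).
  have -> : [set s' | hemi i0 s' & s \subset s'] =
      (if 0 < x1 0 i0 then [set w1 |: s] else set0) :|:
      (if 0 < x2 0 i0 then [set w2 |: s] else set0).
    apply/setP => s'; rewrite inE; case: (boolP (s \subset s')) => ss'.
      rewrite andbT hemiE // in_setU.
      by case: (0 < x1 0 i0); case: (0 < x2 0 i0); rewrite !inE ?andbT ?andbF.
    rewrite andbF; apply/esym/negbTE; apply: contra ss'; rewrite in_setU.
    move=> /orP[]; [case: (0 < x1 0 i0)|case: (0 < x2 0 i0)]; rewrite inE // => /eqP ->;
      by rewrite subsetUr.
  case: (0 < x1 0 i0); case: (0 < x2 0 i0); rewrite ?setU0 ?set0U ?cards1 ?cards0 //.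
  by rewrite cards2 t12.
apply/idP/asboolP.
  move=> sgn; pose q := - x1 0 i0 / d 0 i0.
  have lin : x2 0 i0 = x1 0 i0 + r * d 0 i0 by rewrite /x2 !mxE.
  have [q0 qr e] : [/\ 0 < q, q < r & x1 0 i0 + q * d 0 i0 = 0].
    have d0 : d 0 i0 != 0.
      apply/eqP => e; move: sgn; rewrite lin e mulr0 addr0; by case: (_ < _).
    have e : x1 0 i0 + q * d 0 i0 = 0 by rewrite /q divfK // subrr.
    move: sgn n1 n2; rewrite lin.
    case: (ltrgt0P (x1 0 i0)) => // p1; case: (ltrgt0P (x1 0 i0 + r * d 0 i0)) => // p2 _ _ _.
      have d_lt0 : d 0 i0 < 0 by rewrite -(pmulr_rlt0 _ r0); lra.
      split=> //; first by rewrite /q ltr_ndivlMr // mul0r oppr_lt0.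
      by rewrite -(ltr_nM2r d_lt0); lra.
    have d_gt0 : 0 < d 0 i0 by rewrite -(pmulr_rgt0 _ r0); lra.
    split=> //; first by rewrite /q divr_gt0 // oppr_gt0.
    by rewrite -(ltr_pM2r d_gt0); lra.
  exists (x1 + q *: d); split; [exact: feas_conv (ltW q0) (ltW qr) r0| |exact: inner].
  by apply: inV_pred; [exact: inVD|rewrite !mxE].
move=> [y [fy yi ty]].
have [|q [q0 qr yE]] := online y fy (inV_le (leqnSn _) yi); first by rewrite ty.
have e : x1 0 i0 + q * d 0 i0 = 0 by have := yi i0 (leqnn _); rewrite yE !mxE.
have lin : x2 0 i0 = x1 0 i0 + r * d 0 i0 by rewrite /x2 !mxE.
have e' : (r - q) * x1 0 i0 + q * x2 0 i0 = 0.
  rewrite lin; have : q * d 0 i0 = - x1 0 i0 by lra.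
  have -> : (r - q) * x1 0 i0 + q * (x1 0 i0 + r * d 0 i0) = r * (x1 0 i0 + q * d 0 i0) by ring.
  by rewrite e mulr0.
have qs : 0 <= r - q by rewrite subr_ge0.
have sum0 (a b : R) : b != 0 -> a * b = 0 -> a = 0.
  by move=> b0 /eqP; rewrite mulf_eq0 (negbTE b0) orbF => /eqP.
have concl : q * x2 0 i0 = 0 -> (r - q) * x1 0 i0 = 0 -> False.
  move=> /(sum0 _ _ n2) a0 /(sum0 _ _ n1); rewrite a0 subr0 => r00.
  by rewrite r00 ltxx in r0.
have [p1|p1] : x1 0 i0 < 0 \/ 0 < x1 0 i0 by apply/orP; exact: lt_total.
  have [p2|p2] : x2 0 i0 < 0 \/ 0 < x2 0 i0 by apply/orP; exact: lt_total.
    have h1 := mulr_ge0_le0 qs (ltW p1); have h2 := mulr_ge0_le0 q0 (ltW p2).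
    by case: concl; lra.
  by rewrite p2 lt_gtF.
have [p2|p2] : x2 0 i0 < 0 \/ 0 < x2 0 i0 by apply/orP; exact: lt_total.
  by rewrite p1 [0 < x2 _ _]lt_gtF.
have h1 := mulr_ge0 qs (ltW p1); have h2 := mulr_ge0 q0 (ltW p2).
by case: concl; lra.
Qed.

Lemma hemi_sub (i0 : 'I_N) s v w : hemi i0 s -> v \in s -> w \in s ->
  col v.1 = col w.1 :> nat -> eta v = eta w.
Proof.
move=> /asboolP[x [fx _ tx _ _]] vs ws cvw; rewrite /eta cvw.
case: (eqVneq v.2 w.2) => [->//|vw].
suff /col_proper/(_ vw) : face [set v; w] by rewrite (val_inj cvw) eqxx.
by exists x => //; apply/subsetP => z; rewrite tx !inE => /orP[]/eqP ->.
Qed.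

Lemma alt_opp b s : alt b (opp @: s) = alt (~~ b) s.
Proof.
suff aux b' s' : alt b' s' -> alt (~~ b') (opp @: s').
  apply/idP/idP => [/aux|/aux]; last by rewrite negbK.
  by rewrite -imset_comp (eq_imset _ oppK) imset_id.
have be v : below (fun v : vertex => col v.1 : nat) (opp @: s') (opp v) =
    below (fun v : vertex => col v.1 : nat) s' v.
  rewrite /below -[RHS](card_imset _ opp_inj); apply: eq_card => w.
  by rewrite -(oppK w) (mem_imset _ _ opp_inj) !inE (mem_imset _ _ opp_inj).
move=> /altP[inj he]; apply/altP; split.
  by move=> _ _ /imsetP[v vs ->] /imsetP[w ws ->] /= cvw; congr opp; apply: inj.
move=> _ /imsetP[v vs ->]; rewrite be /eta /= addNb addNb; congr negb.
exact: he.
Qed.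

Definition altcount (i0 : 'I_N) b := #|[set s | hemi i0 s & alt b s]|.

Definition flat (j : nat) s : bool := `[< exists x, [/\ feas x, inV j x & tight x = s] >].

(** Double counting of pairs formed by a member of the hemisphere and an alternating subset with one
    element less: [odd_alt_del] counts along the larger set, [card_hemi] along the smaller one. *)
Lemma altcount_flat (i0 : 'I_N) : odd (altcount i0 false) (+) odd (altcount i0 true) =
  odd #|[set s | [&& flat i0 s, #|s| == i0 & alt false s]]|.
Proof.
have sumodd (I : finType) (F : I -> nat) : odd (\sum_i F i)%N = \big[addb/false]_i odd (F i).
  exact: (big_morph odd oddD).
have cardE (P : pred {set vertex}) : odd #|[set s | P s]| = \big[addb/false]_s P s.
  rewrite -sum1dep_card big_mkcond sumodd; apply: eq_bigr => s _; by case: (P s).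
rewrite !cardE -big_split /=.
have -> : \big[addb/false]_s ((hemi i0 s && alt false s) (+) (hemi i0 s && alt true s)) =
    \big[addb/false]_s \big[addb/false]_(r : {set vertex})
       [&& hemi i0 s, r \subset s, #|r| == i0 & alt false r].
  apply: eq_bigr => s _; case: (boolP (hemi i0 s)) => hs /=; last by rewrite big1.
  rewrite -odd_alt_del; last by move=> v w vs ws; exact: (hemi_sub hs vs ws).
  have cs : #|s| = i0.+1 by case/asboolP: hs => x [].
  rewrite -cardE.
  have inj : {in [set v in s | alt false (s :\ v)] &, injective (fun v => s :\ v)}.
    move=> v w; rewrite !inE => /andP[vs _] /andP[ws _] /setP/(_ v).
    by rewrite !in_setD1 eqxx vs /= andbT => /esym/negbFE/eqP.
  rewrite -(card_in_imset inj); congr odd; apply: eq_card => r; rewrite inE.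
  apply/imsetP/and3P => [[v]|[rs /eqP cr ar]].
    rewrite inE => /andP[vs av] ->; rewrite subD1set; split=> //.
    by have := cardsD1 v s; rewrite vs cs add1n => -[] ->.
  have /cards1P[v e] : #|s :\: r| == 1%N by rewrite cardsD (setIidPr rs) cs cr subSnn.
  have vs : v \in s :\: r by rewrite e set11.
  have rE : r = s :\ v.
    by rewrite -e setDDr setDv set0U (setIidPr rs).
  by exists v => //; rewrite inE -rE ar andbT; move: vs; rewrite inE => /andP[].
rewrite exchange_big /=; apply: eq_bigr => r _.
case: (boolP (#|r| == i0)) => cr /=; last first.
  by rewrite big1 ?andbF // => s _; rewrite !andbF.
case: (boolP (alt false r)) => ar /=; last by rewrite big1 ?andbF // => s _; rewrite !andbF.
rewrite andbT /flat -(card_hemi (eqP cr)) cardE; apply: eq_bigr => s _.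
by rewrite andbT.
Qed.

Lemma flat_card (i0 : 'I_N) s x : feas x -> inV i0.+1 x -> tight x = s -> #|s| = i0.+1 ->
  flat i0.+1 s && (#|s| == i0.+1) = (hemi i0 s (+) hemi i0 (opp @: s)).
Proof.
move=> fx xi tx cs; rewrite cs eqxx andbT.
have -> : flat i0.+1 s by apply/asboolP; exists x.
have xn : x 0 i0 != 0.
  apply/eqP => e; have := card_tight (inV_pred xi e) (ltnW (ltn_ord i0)).
  by rewrite tx cs ltnn.
have uniq y : feas y -> inV i0.+1 y -> tight y = s -> y = x.
  move=> fy yi ty; apply/eqP; rewrite -subr_eq0; apply/eqP.
  apply: (@annihilator_tight i0.+1 x _ (tight x)) => //.
  - by move=> l il; rewrite !mxE yi // xi // subrr.
  - by rewrite tx cs.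
  move=> w wx; rewrite dotDl dotNl; have := wx; rewrite tx -ty inE => /eqP ->.
  by move: wx; rewrite inE => /eqP ->; rewrite subrr.
have cN : #|opp @: s| = i0.+1 by rewrite (card_imset _ opp_inj).
have hs : hemi i0 s = (0 < x 0 i0).
  by apply/asboolP/idP => [[y [fy yi ty _ y0]]|x0]; [rewrite -(uniq y)|exists x].
have hsN : hemi i0 (opp @: s) = (x 0 i0 < 0).
  apply/asboolP/idP => [[y [fy yi ty _ y0]]|x0].
    rewrite -(uniq (- y)); [by rewrite mxE oppr_lt0|exact: feasN|exact: inVN1|].
    by rewrite tightN ty -imset_comp (eq_imset _ oppK) imset_id.
  exists (- x); rewrite mxE oppr_gt0 tightN tx; split=> //; [exact: feasN|exact: inVN1].
by rewrite hs hsN; case: (ltrgt0P (x 0 i0)) xn.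
Qed.

Lemma flat_hemi (i0 : 'I_N) s :
  flat i0.+1 s && (#|s| == i0.+1) = (hemi i0 s (+) hemi i0 (opp @: s)).
Proof.
case: (boolP (flat i0.+1 s && (#|s| == i0.+1))) => [/andP[/asboolP[x [fx xi tx]] /eqP cs]|nf].
  by rewrite -(flat_card fx xi tx cs) cs eqxx andbT; apply/esym/asboolP; exists x.
apply/esym/negbTE; apply: contra nf.
case: (boolP (hemi i0 s)) => [/asboolP[x [fx xi tx cs _]] _|_ /asboolP[x [fx xi tx cs _]]].
  by rewrite cs eqxx andbT; apply/asboolP; exists x.
rewrite -(card_imset _ opp_inj) cs eqxx andbT; apply/asboolP; exists (- x).
split; [exact: feasN|exact: inVN1|].
by rewrite tightN tx -imset_comp (eq_imset _ oppK) imset_id.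
Qed.

(** Induction on the dimension. The flat sets of one dimension form two hemispheres exchanged by the
    antipode, which also exchanges [alt false] and [alt true]. The induction starts from the empty
    set. *)
Lemma altcount_odd (i : nat) (iN : (i < N)%N) :
  odd (altcount (Ordinal iN) false) (+) odd (altcount (Ordinal iN) true).
Proof.
have cardE (P : pred {set vertex}) : odd #|[set s | P s]| = \big[addb/false]_s P s.
  rewrite -sum1dep_card big_mkcond (big_morph odd oddD erefl); apply: eq_bigr => s _.
  by case: (P s).
elim: i iN => [|i IH] iN; rewrite altcount_flat /=.
  rewrite (_ : [set s | _] = [set set0]) ?cards1 //.
  apply/setP => s; rewrite !inE; apply/and3P/eqP => [[_ /eqP c0 _]|->].
    exact: cards0_eq.
  split; last by apply/altP; split=> [v w|v]; rewrite inE.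
    apply/asboolP; exists 0; split=> //; first exact: feas0.
      by move=> j _; rewrite mxE.
    apply/setP => v; rewrite !inE dot0l; apply/negbTE; rewrite eq_sym; exact: lt0r_neq0.
  by rewrite cards0.
have iN' := ltnW iN; suff -> : odd #|[set s | [&& flat i.+1 s, #|s| == i.+1 & alt false s]]| =
  odd (altcount (Ordinal iN') false) (+) odd (altcount (Ordinal iN') true) by exact: IH.
rewrite cardE; under eq_bigr => s _ do rewrite andbA (flat_hemi (Ordinal iN')) andb_addl.
rewrite big_split /= !cardE; congr addb.
rewrite (reindex_inj (imset_inj opp_inj)) /=; apply: eq_bigr => s _.
by rewrite alt_opp -imset_comp (eq_imset _ oppK) imset_id.
Qed.

(** An alternating facet has [N] distinct colours, hence all of them. Rank and colour then coincide,
    and undoing the twist of [eta] leaves the constant sign [b]. *)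
Lemma monochromatic_facet : (0 < N)%N -> exists x b,
  [/\ feas x, #|tight x| = N & {in tight x, forall v, v.2 = b}].
Proof.
move=> N0; have iN : (N.-1 < N)%N by rewrite prednK.
have [b] : exists b, odd (altcount (Ordinal iN) b).
  have := altcount_odd iN; case: (boolP (odd (altcount (Ordinal iN) true))).
    by exists true.
  by rewrite addbF; exists false.
rewrite /altcount; case: (set_0Vmem [set s | hemi (Ordinal iN) s & alt b s]) => [->|[s]].
  by rewrite cards0.
rewrite inE => /andP[/asboolP[x [fx _ tx cs _]] /altP[inj he]] _; rewrite /= prednK // in cs.
exists x, b; rewrite tx; split=> // v vs.
suff bE : below (fun v : vertex => col v.1 : nat) s v = col v.1.
  by have := he v vs; rewrite /eta bE; case: (v.2); case: (b); case: (odd _).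
have inj' : {in s &, injective (fun v : vertex => col v.1)}.
  by move=> w w' ws w's /(congr1 val) /=; exact: inj.
have imT : (fun v : vertex => col v.1) @: s = setT.
  by apply/eqP; rewrite eqEcard subsetT /= cardsT card_ord card_in_imset ?cs.
rewrite /below -(@card_in_imset _ _ (fun v : vertex => col v.1)); last first.
  by move=> w w'; rewrite !inE => /andP[ws _] /andP[w's _]; exact: inj'.
rewrite -[RHS](card_ord (col v.1)) -cardsT.
have winj : injective (widen_ord (ltnW (ltn_ord (col v.1)))).
  by move=> a a' /(congr1 val) /= e; exact: val_inj.
rewrite -[RHS](card_imset _ winj).
apply: eq_card => j; apply/imsetP/imsetP.
  move=> [w]; rewrite inE => /andP[_ cw] ->; exists (Ordinal cw); rewrite ?inE //.
  exact: val_inj.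
move=> [l _ ->].
have /imsetP[w ws we] : widen_ord (ltnW (ltn_ord (col v.1))) l \in
    (fun v : vertex => col v.1) @: s by rewrite imT inE.
by exists w; rewrite // inE ws -we /=.
Qed.

End Parity.
End Fan.

(** * Stable sets and nodes *)

Section CyclicOrder.
Variable n : nat.
Implicit Types (A B : {set 'I_n}) (i j : 'I_n).

Lemma ordS_inj : injective (@ordS n).
Proof. exact: can_inj (@ordSK n). Qed.

Lemma ordSE i : (i.+1 < n)%N -> ordS i = i.+1 :> nat.
Proof. by move=> h; rewrite /= modn_small. Qed.

Lemma ordS_last i : i.+1 = n -> ordS i = 0 :> nat.
Proof. by move=> h; rewrite /= h modnn. Qed.

Lemma stableP A : reflect {in A, forall i, ordS i \notin A} (stable A).
Proof.
apply: (iffP idP) => [/forall_inP sA i iA|sA].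
  apply/negP => SA; have /forall_inP/(_ _ SA) := sA i iA.
  by rewrite /cycle_adj /= eqxx.
apply/forall_inP => i iA; apply/forall_inP => j jA; rewrite /cycle_adj /= negb_or.
apply/andP; split; apply/eqP => e; first by have := sA i iA; rewrite -e jA.
by have := sA j jA; rewrite -e iA.
Qed.

Lemma stable_sub A B : A \subset B -> stable B -> stable A.
Proof.
move=> AB /stableP sB; apply/stableP => i iA; apply/negP => SA.
by have := sB i (subsetP AB i iA); rewrite (subsetP AB).
Qed.

Lemma subset_card m A : (m <= #|A|)%N -> exists2 B : {set 'I_n}, B \subset A & #|B| = m.
Proof.
elim: m => [_|m IH mA]; first by exists set0; rewrite ?sub0set ?cards0.
have [B BA cB] := IH (ltnW mA).
have /subsetPn[x xA xB] : ~~ (A \subset B).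
  by apply/negP => /subset_leq_card; rewrite cB leqNgt mA.
by exists (x |: B); rewrite ?cardsU1 ?xB ?cB // subUset sub1set xA.
Qed.

End CyclicOrder.

(** * Augmenting stable sets by starts of positive runs *)

Section Exchange.
Variables (R : realFieldType) (n : nat) (c : 'I_n -> R).
Implicit Types (A Q : {set 'I_n}) (i j a q : 'I_n).

Definition weight A : R := \sum_(i in A) c i.
Definition starts : {set 'I_n} := [set i | (0 < c i) && (c (ord_pred i) <= 0)].
Definition nbrs Q : {set 'I_n} := [set a | (ordS a \in Q) || (ord_pred a \in Q)].

Lemma starts_pos i : i \in starts -> 0 < c i.
Proof. by rewrite inE => /andP[]. Qed.

Lemma starts_pred i : ordS i \in starts -> c i <= 0.
Proof. by rewrite inE ordSK => /andP[]. Qed.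

Lemma starts_stable : stable starts.
Proof.
apply/stableP => i /starts_pos ci; apply/negP => /starts_pred; by rewrite leNgt ci.
Qed.

(* The augmentation is made along an inclusion-minimal violator [Q] of Hall's
   condition, so that every element it displaces lies between two starts. *)
Lemma exchange A k : stable A -> #|A| = k -> (k < #|starts|)%N ->
  exists B, [/\ stable B, #|B| = k.+1 & weight A < weight B].
Proof.
move=> sA cA kS; pose D := starts :\: A.
pose viol Q := [&& Q != set0, Q \subset D & (#|A :&: nbrs Q| < #|Q|)%N].
have sS := starts_stable.
(* Starts form a stable set, so the neighbours of [D] in [A] are not starts; and as [starts] has
   more elements than [A], there are fewer of them than elements of [D]. *)
have violD : viol D.
  have cD : (#|A :\: starts| < #|D|)%N.
    have := cardsID starts A; have := cardsID A starts; rewrite setIC cA /D; lia.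
  apply/and3P; split=> //; first by rewrite -card_gt0; apply: leq_ltn_trans cD.
  apply: leq_ltn_trans cD; apply/subset_leq_card/subsetP => a; rewrite !inE => /andP[aA].
  rewrite aA andbT => /orP[/andP[_ /andP[_]]|/andP[_ /andP[h _]]].
    by rewrite ordSK => h; rewrite leNgt in h; rewrite (negbTE h).
  by rewrite [c (ord_pred a) <= 0]leNgt h andbF.
case: (@arg_minnP _ D viol (fun Q => #|Q|) violD) => Q /and3P[Q0 QD Qlt] Qmin.
have QS : Q \subset starts by apply: subset_trans QD (subsetDl _ _).
have nviol q : q \in Q -> (1 < #|Q|)%N -> (#|Q| <= (#|A :&: nbrs (Q :\ q)|).+1)%N.
  move=> qQ Q1; have cQ : #|Q| = #|Q :\ q|.+1 by rewrite (cardsD1 q) qQ.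
  rewrite leqNgt; apply/negP => h.
  have : viol (Q :\ q).
    apply/and3P; split; [by rewrite -card_gt0; lia| |lia].
    exact: subset_trans (subD1set _ _) QD.
  by move=> /Qmin; rewrite cQ ltnn.
have mono q : A :&: nbrs (Q :\ q) \subset A :&: nbrs Q.
  apply: setIS; apply/subsetP => a; rewrite !inE.
  by case/orP => /andP[_ ->]; rewrite ?orbT.
have Qeq : #|A :&: nbrs Q|.+1 = #|Q|.
  apply/eqP; rewrite eqn_leq Qlt /=; have [Q1|Q1] := ltnP 1 #|Q|; last exact: leq_trans Q1 _.
  have /set0Pn[q qQ] := Q0; apply: leq_trans (nviol q qQ Q1) _.
  by rewrite ltnS subset_leq_card.
(* An element of [A] with only one neighbour [q] in [Q] would make [Q :\ q] a smaller violator. With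
   both neighbours in [Q] it precedes a start, so its entry is nonpositive and removing it loses no
   weight. *)
have both a : a \in A :&: nbrs Q -> (ordS a \in Q) && (ord_pred a \in Q).
  move=> aN; apply: contraT => nb.
  have [q qQ qa] : exists2 q, q \in Q & a \notin nbrs (Q :\ q).
    move: aN nb; rewrite !inE => /andP[_ /orP[]] aQ; rewrite aQ ?andbT /= => nb.
      by exists (ordS a); rewrite // !inE eqxx /= negb_and nb orbT.
    by exists (ord_pred a); rewrite // !inE eqxx /= orbF negb_and nb orbT.
  have Q1 : (1 < #|Q|)%N by rewrite -Qeq ltnS card_gt0; apply/set0Pn; exists a.
  have := nviol q qQ Q1; rewrite -Qeq ltnS leqNgt => /negP[]; apply: proper_card.
  rewrite properE mono; apply/subsetPn; exists a => //.
  by rewrite inE negb_and qa orbT.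
pose B := (A :\: nbrs Q) :|: Q; exists B.
have disj : [disjoint A :\: nbrs Q & Q].
  rewrite disjoints_subset; apply/subsetP => a; rewrite !inE => /andP[_ aA].
  by apply/negP => /(subsetP QD); rewrite inE aA.
split.
- apply/stableP => a; rewrite !inE => /orP[/andP[aN aA]|aQ].
    rewrite (negbTE (stableP _ sA a aA)) andbF /=.
    by apply: contra aN => ->.
  rewrite ordSK aQ orbT /=; apply/negP => SQ.
  by have /stableP/(_ a (subsetP QS _ aQ)) := sS; rewrite (subsetP QS).
- rewrite /B cardsU (disjoint_setI0 disj) cards0 subn0 -Qeq addnS addnC cardsID cA //.
have -> : weight B = weight A - weight (A :&: nbrs Q) + weight Q.
  have -> : weight A = weight (A :&: nbrs Q) + weight (A :\: nbrs Q).
    exact: big_setID.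
  have -> : weight B = weight (A :\: nbrs Q) + weight Q by rewrite /weight /B -bigU //=; apply: eq_bigl => i; rewrite !inE.
  by rewrite [X in X - _]addrC addrK.
have : weight (A :&: nbrs Q) <= 0.
  apply: sumr_le0 => a /both /andP[/(subsetP QS) /starts_pred //].
have : 0 < weight Q.
  have /set0Pn[q qQ] := Q0; rewrite /weight (bigD1 q) //= ltr_pwDl //.
    exact/starts_pos/(subsetP QS).
  by apply: sumr_ge0 => i /andP[/(subsetP QS)/starts_pos/ltW].
lra.
Qed.

(** If the entry at [i] were nonpositive, dropping [i] and augmenting the remaining [k - 1] elements
    by [exchange] would give a heavier stable set. *)
Lemma max_pos A k : stable A -> #|A| = k -> (k <= #|starts|)%N ->
  (forall B, stable B -> #|B| = k -> weight B <= weight A) ->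
  {in A, forall i, 0 < c i}.
Proof.
move=> sA cA kS Amax i iA; rewrite ltNge; apply/negP => ci.
have cA' : k = #|A :\ i|.+1 by rewrite -cA (cardsD1 i) iA.
have [||B [sB cB]] := @exchange (A :\ i) k.-1 (stable_sub (subD1set _ _) sA).
- by rewrite cA'.
- by apply: leq_trans kS; rewrite {2}cA' cA'.
have : weight A = c i + weight (A :\ i) by rewrite /weight (big_setD1 i).
have := Amax B sB; rewrite cB cA' => /(_ erefl); lra.
Qed.

End Exchange.

(** * Sign changes of orthogonal vectors, and fractional stable sets *)

Section Nodes.
Variables (R : rcfType) (n k : nat).
Hypotheses (k_gt0 : (0 < k)%N) (kn : (2 * k < n)%N).
Implicit Types (c : 'I_n -> R) (A : {set 'I_n}).

(* The nodes are spread geometrically so that among the values of a polynomial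
   of controlled roots the last one dominates. *)
Definition ratio : R := (100 * n)%:R.
Definition tau (i : nat) : R := ratio ^+ i.

Definition orth c := forall p : {poly R}, (size p <= (2 * k).-1)%N ->
  \sum_i c i * p.[tau i] = 0.

Lemma ratio_ge : 100 * n%:R <= ratio.
Proof. by rewrite /ratio natrM. Qed.

Lemma ratio_ge100 : 100 <= ratio.
Proof.
by apply: le_trans ratio_ge; rewrite -[X in X <= _]mulr1 ler_wpM2l // ler1n; lia.
Qed.

Lemma ratio_gt1 : 1 < ratio. Proof. have := ratio_ge100; lra. Qed.

Lemma tau_gt0 i : 0 < tau i.
Proof. by apply: exprn_gt0; have := ratio_gt1; lra. Qed.

Lemma tauS i : tau i.+1 = ratio * tau i. Proof. exact: exprS. Qed.

Lemma ler_tau i j : (tau i <= tau j) = (i <= j)%N.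
Proof. by rewrite /tau ler_eXn2l // ratio_gt1. Qed.

Lemma ltr_tau i j : (tau i < tau j) = (i < j)%N.
Proof. by rewrite /tau ltr_eXn2l // ratio_gt1. Qed.

Lemma prod_sign (X : {set 'I_n}) (rho : 'I_n -> R) (i : nat) :
  (forall j, j \in X -> (j < i)%N -> rho j < tau i) ->
  (forall j, j \in X -> (i <= j)%N -> tau i < rho j) ->
  0 < (-1) ^+ #|[set j in X | (i <= j)%N]| * \prod_(j in X) (tau i - rho j).
Proof.
move=> lo hi.
have -> : (-1) ^+ #|[set j in X | (i <= j)%N]| = \prod_(j in X) (-1) ^+ (i <= j)%N :> R.
  rewrite -expr_sum; congr (_ ^+ _); rewrite -sum1_card big_mkcond [RHS]big_mkcond /=.
  by apply: eq_bigr => j _; rewrite inE; case: (_ \in _); case: (_ <= _)%N.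
rewrite -big_split /=; apply: prodr_gt0 => j jX.
case: (leqP i j) => ij; rewrite ?expr0 ?expr1 ?mul1r ?mulN1r; last by rewrite subr_gt0 lo.
by rewrite opprB subr_gt0 hi.
Qed.

(** With fewer than [k] positive runs there are at most [2k - 2] sign changes. A polynomial with a
    root midway between the nodes of each change agrees in sign with [c] at every node, an entry 0
    being grouped with the negative ones, so its pairing with [c] would be positive. *)
Lemma card_starts c : orth c -> (exists i, c i != 0) -> (k <= #|starts c|)%N.
Proof.
move=> oc [i0 ci0]; rewrite leqNgt; apply/negP => Sk.
pose pos i := 0 < c i.
pose bd (i : 'I_n) := pos i != pos (ordS i).
pose X : {set 'I_n} := [set i : 'I_n | (i.+1 < n)%N && bd i].
pose rho (i : 'I_n) := (tau i + tau i.+1) / 2.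
have tS i : tau i < tau i.+1 by rewrite ltr_tau.
have cX : (#|X| <= 2 * #|starts c|)%N.
  pose Up := [set i | ~~ pos i && pos (ordS i)]; pose Dn := [set i | pos i && ~~ pos (ordS i)].
  have XS : X \subset Up :|: Dn.
    by apply/subsetP => i; rewrite !inE /bd => /andP[_]; case: (pos i); case: (pos _).
  have cUp : #|Up| = #|starts c|.
    rewrite -(card_imset _ (@ordS_inj n)); apply: eq_card => i; rewrite inE.
    apply/imsetP/andP => [[j]|[ci cpi]].
      by rewrite inE /pos -leNgt => /andP[h1 h2] ->; rewrite ordSK.
    by exists (ord_pred i); rewrite ?ord_predK // inE /pos -leNgt ord_predK cpi.
  have cDn : #|Dn| = #|Up|.
    pose Pos := [set i | pos i]; pose PosS := [set i | pos (ordS i)].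
    have cP : #|PosS| = #|Pos|.
      rewrite -[LHS](card_imset _ (@ordS_inj n)); apply: eq_card => i; rewrite inE.
      apply/imsetP/idP => [[j]|pi]; first by rewrite inE => pj ->.
      by exists (ord_pred i); rewrite ?ord_predK // inE ord_predK.
    have := cardsID PosS Pos; have := cardsID Pos PosS; rewrite setIC.
    have -> : PosS :\: Pos = Up by apply/setP => i; rewrite !inE.
    have -> : Pos :\: PosS = Dn by apply/setP => i; rewrite !inE andbC.
    lia.
  apply: leq_trans (subset_leq_card XS) _; by rewrite cardsU cDn cUp mul2n -addnn leq_subr.
have last_lt : (n.-1 < n)%N by lia.
pose last := Ordinal last_lt.
have par (i : 'I_n) : pos i = pos last (+) odd #|[set j in X | (i <= j)%N]|.
  have [m im] : exists m, (m + i)%N = n.-1 by exists (n.-1 - i)%N; have := ltn_ord i; lia.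
  elim: m i im => [|m IH] i im.
    have -> : i = last by apply: val_inj.
    rewrite (_ : [set _ in _ | _] = set0) ?cards0 ?addbF //.
    apply/setP => j; rewrite !inE; apply/negP => /andP[/andP[h _]] /=; lia.
  have iS : (i.+1 < n)%N by lia.
  have eS := ordSE iS.
  rewrite (cardsD1 i) !inE iS leqnn /= andbT oddD oddb.
  have -> : [set j in X | (i <= j)%N] :\ i = [set j in X | (ordS i <= j)%N].
    apply/setP => j; rewrite !inE eS -(inj_eq val_inj) /=.
    by case: (_ && bd j); rewrite ?andbF //=; lia.
  rewrite addbCA -(IH (ordS i)) ?eS; last lia.
  by rewrite /bd; case: (pos i); case: (pos _).
pose s : R := if pos last then 1 else -1.
pose q : {poly R} := s *: \prod_(j in X) ('X - (rho j)%:P).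
have sq : (size q <= (2 * k).-1)%N.
  apply: leq_trans (size_scale_leq _ _) _.
  by rewrite -big_enum /= size_prod_XsubC -cardE; move: cX Sk; move: #|X| #|starts c| => x y; lia.
have qi (i : 'I_n) : 0 < (if pos i then 1 else -1) * q.[tau i].
  rewrite /q hornerZ horner_prod.
  have -> : \prod_(j in X) ('X - (rho j)%:P).[tau i] = \prod_(j in X) (tau i - rho j).
    by apply: eq_bigr => j _; rewrite hornerXsubC.
  have := @prod_sign X rho i; rewrite -signr_odd => /(_ _ _).
  have lo (j : 'I_n) : j \in X -> (j < i)%N -> rho j < tau i.
    move=> _ ji; have : tau j.+1 <= tau i by rewrite ler_tau.
    by have := tS j; rewrite /rho; lra.
  have hi (j : 'I_n) : j \in X -> (i <= j)%N -> tau i < rho j.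
    move=> _ ji; have : tau i <= tau j by rewrite ler_tau.
    by have := tS j; rewrite /rho; lra.
  move=> /(_ lo hi); rewrite par /s mulrA.
  by case: (pos last); case: (odd _); rewrite /= ?expr1 ?expr0 ?mulrNN ?mul1r ?mulr1.
have : 0 < \sum_i c i * q.[tau i].
  have term i : 0 <= c i * q.[tau i].
    have := qi i; rewrite /pos; case: (ltP 0 (c i)) => ci; rewrite ?mul1r ?mulN1r => h.
      by rewrite mulr_ge0 // ltW.
    by rewrite mulr_le0 // ltW // -oppr_gt0.
  rewrite (bigD1 i0) //= ltr_pwDl ?sumr_ge0 //.
  rewrite lt_def term andbT mulf_neq0 //.
  by apply: contraTneq (qi i0) => ->; rewrite mulr0 ltxx.
by rewrite oc // ltxx.
Qed.

Lemma sum_orth c : orth c -> \sum_i c i = 0.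
Proof.
move=> oc; rewrite -[RHS](oc 1) ?size_poly1; last lia.
by apply: eq_bigr => i _; rewrite hornerE mulr1.
Qed.

(* Hermite's identity for the floors of [(m + t) / T]. *)
Lemma sum_floor (T m : nat) : (0 < T)%N -> (\sum_(t < T) (m + t) %/ T = m)%N.
Proof.
move=> T0; elim: m => [|m IH].
  by apply: big1 => t _; rewrite add0n divn_small.
case: T T0 IH => // T _ IH.
have e : ((m.+1 + T) %/ T.+1 = (m %/ T.+1).+1)%N by rewrite addSnnS divnDr // divnn addn1.
rewrite big_ord_recr /= e addnS; congr _.+1.
rewrite -[RHS]IH big_ord_recl /= addn0 addnC; congr (_ + _)%N.
by apply: eq_bigr => t _; rewrite /bump /= addSnnS.
Qed.

(** An integer decomposition property: [h] is a sum of [T] stable [k]-sets. Intervals of lengths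
    [h i] are laid end to end on a circle of length [k * T], and [A t] collects those containing a
    point congruent to [-t] modulo [T]. Two consecutive intervals have total length at most [T] and
    cannot both be hit, and the [i]-th one is hit for [h i] values of [t]. *)
Lemma fractional_weight c (T : nat) (h : 'I_n -> nat) :
  (0 < T)%N -> (forall i, h i + h (ordS i) <= T)%N -> (\sum_i h i = k * T)%N ->
  (forall A, stable A -> #|A| = k -> weight c A <= 1) ->
  \sum_i c i * (h i)%:R <= T%:R.
Proof.
move=> T0 hT hs cA.
pose H (m : nat) := (\sum_(i < n | (i < m)%N) h i)%N.
have H0 : H 0 = 0%N by apply: big1.
have Hn : H n = (k * T)%N by rewrite -hs; apply: eq_bigl => i; rewrite ltn_ord.
have HS (i : 'I_n) : H i.+1 = (H i + h i)%N.
  rewrite /H (bigD1 i) //= addnC; congr (_ + _)%N; apply: eq_bigl => j.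
  by rewrite -(inj_eq val_inj) /=; lia.
pose a (t : nat) (i : 'I_n) := ((H i.+1 + t) %/ T - (H i + t) %/ T)%N.
have mono t (i : 'I_n) : ((H i + t) %/ T <= (H i.+1 + t) %/ T)%N.
  by apply: leq_div2r; rewrite HS; lia.
have step x y : (y <= x + T)%N -> (y %/ T <= (x %/ T).+1)%N.
  by move=> yx; apply: leq_trans (leq_div2r T yx) _; rewrite divnDr // divnn T0 addn1.
have hle i : (h i <= T)%N by have := hT i; lia.
have a01 t i : (a t i <= 1)%N.
  have : ((H i.+1 + t) %/ T <= ((H i + t) %/ T).+1)%N.
    by apply: step; rewrite HS; have := hle i; lia.
  rewrite /a; lia.
pose A (t : nat) := [set i | a t i == 1%N].
have aE t i : a t i = (i \in A t) by rewrite inE; have := a01 t i; case: (a t i) => [|[]].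
have suma t : (t < T)%N -> (\sum_i a t i = k)%N.
  move=> tT; have tel m : (m <= n)%N -> (\sum_(i < n | (i < m)%N) a t i = (H m + t) %/ T)%N.
    elim: m => [_|m IH mn].
      by rewrite big1 // H0 add0n divn_small.
    rewrite (bigD1 (Ordinal mn)) //=.
    have -> : (\sum_(i < n | (i < m.+1)%N && (i != Ordinal mn)) a t i =
               \sum_(i < n | (i < m)%N) a t i)%N.
      by apply: eq_bigl => j; rewrite -(inj_eq val_inj) /=; lia.
    by rewrite IH; [rewrite /a /= subnK //; exact: mono (Ordinal mn)|lia].
  have := tel n (leqnn n); rewrite Hn divnMDl // divn_small // addn0 => <-.
  by apply: eq_bigl => i; rewrite ltn_ord.
have cardA t : (t < T)%N -> #|A t| = k.
  move=> tT; rewrite -[RHS](suma t tT) -sum1_card big_mkcond /=; apply: eq_bigr => i _.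
  by rewrite aE; case: (_ \in _).
have stabA t : (t < T)%N -> stable (A t).
  move=> tT; apply/stableP => i; rewrite !inE => /eqP ai; apply/eqP => aSi.
  suff : (a t i + a t (ordS i) <= 1)%N by rewrite ai aSi.
  have hS := hT i; have iS := HS i; have oS := HS (ordS i).
  have m1 := mono t i; have m2 := mono t (ordS i).
  have [iS1|iS1] := ltnP i.+1 n.
    have e := ordSE iS1; rewrite /a; move: oS m2; rewrite e => oS m2.
    have : ((H i.+2 + t) %/ T <= ((H i + t) %/ T).+1)%N by apply: step; lia.
    lia.
  (* At the seam of the circle [H n] is a multiple of [T], so the quotients continue past [n] as
     they began at 0. *)
  have in_ : i.+1 = n by have := ltn_ord i; lia.
  have e := ordS_last in_; rewrite /a; move: oS m2; rewrite e H0 add0n in_ Hn => oS m2.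
  have : ((k * T + (H 1 + t)) %/ T <= ((H i + t) %/ T).+1)%N.
    apply: step; move: iS oS hS; rewrite in_ Hn; move: (k * T)%N (H 1) (H i) (h _) (h _); lia.
  move: m1; rewrite in_ Hn !divnMDl // (divn_small tT) addn0.
  by move: (_ %/ _)%N (_ %/ _)%N => x y; lia.
have -> : \sum_i c i * (h i)%:R = \sum_(t < T) weight c (A t).
  have hE i : h i = (\sum_(t < T) a t i)%N.
    have : (\sum_(t < T) a t i + H i = H i.+1)%N.
      rewrite -{1}(sum_floor (H i) T0) -[RHS](sum_floor (H i.+1) T0) -big_split /=.
      by apply: eq_bigr => t _; rewrite subnK // mono.
    by rewrite HS; lia.
  under eq_bigr => i _ do rewrite hE natr_sum mulr_sumr.
  rewrite exchange_big /=; apply: eq_bigr => t _; rewrite /weight [RHS]big_mkcond /=.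
  by apply: eq_bigr => i _; rewrite aE; case: (_ \in _); rewrite ?mulr1 ?mulr0.
have -> : T%:R = \sum_(t < T) 1 :> R by rewrite sumr_const card_ord.
by apply: ler_sum => t _; apply: cA; [exact: stabA|exact: cardA].
Qed.

End Nodes.

(** * Polynomials with prescribed roots between the nodes *)

Section Shape.
Variables (R : rcfType) (n k : nat).
Hypotheses (k_gt0 : (0 < k)%N) (kn : (2 * k < n)%N).
Notation tau := (@tau R n).
Implicit Types (X : {set 'I_n}) (g : {poly R}).

Let ltr_tau := @ltr_tau R n k k_gt0 kn.
Let ler_tau := @ler_tau R n k k_gt0 kn.
Let tau_gt0 := @tau_gt0 R n k k_gt0 kn.
Let ratio_ge100 := @ratio_ge100 R n k k_gt0 kn.

(** The last node is set apart because its constraint may compare it with node 0, and then no root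
    between neighbouring nodes is forced. *)
Definition inner X := [set j in X | (j.+1 < n)%N].
(** The nodes at which the cofactor left by the forced roots is sure not to vanish. *)
Definition live X (i : nat) := (i < n)%N && ((i.+1 < n)%N || ~~ [exists j in X, j.+1 == n]).

Definition constrained X g :=
  forall j : 'I_n, j \in X -> g.[tau j] = 0 \/ g.[tau j] = - g.[tau (ordS j)].

Lemma node_root g (i : nat) : g.[tau i] = 0 \/ g.[tau i] = - g.[tau i.+1] ->
  exists r, [/\ tau i <= r, r < tau i.+1, root g r & g.[tau i] = 0 -> r = tau i].
Proof.
have t01 : tau i < tau i.+1 by rewrite ltr_tau.
move=> gi; case: (eqVneq g.[tau i] 0) => [g0|g0].
  by exists (tau i); rewrite lexx; split=> //; apply/rootP.
case: gi => [/eqP|ge]; first by rewrite (negbTE g0).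
have [|x xin rx] := @polyrcf.poly_ivtoo _ g (tau i) (tau i.+1) (ltW t01).
  by rewrite ge mulNr oppr_lt0 -expr2 exprn_even_gt0 //= -oppr_eq0 -ge.
move: xin; rewrite in_itv /= => /andP[x1 x2].
by exists x; split=> // [|/eqP]; rewrite ?ltW // (negbTE g0).
Qed.

Lemma horner_size2 (e : {poly R}) x : (size e <= 2)%N -> e.[x] = e`_0 + e`_1 * x.
Proof.
by move=> se; rewrite (horner_coef_wide _ se) !big_ord_recl big_ord0 /= expr0 mulr1 expr1 addr0.
Qed.

(** Every inner constraint forces a root in its own half-open interval, so the roots are distinct
    and the degree leaves a cofactor that is at most linear, and constant if the last node carries
    no constraint. *)
Lemma shape_factor X g : (#|X| = (2 * k).-2)%N -> g != 0 -> (size g <= (2 * k).-1)%N ->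
  constrained X g -> exists (rho : 'I_n -> R) (e : {poly R}),
  [/\ forall j, j \in inner X -> [/\ tau j <= rho j, rho j < tau j.+1 &
        g.[tau j] = 0 -> rho j = tau j],
      g = e * \prod_(j in inner X) ('X - (rho j)%:P), e != 0, (size e <= 2)%N &
      ~~ [exists j in X, j.+1 == n] -> (size e <= 1)%N].
Proof.
move=> cX g0 sg cg.
have ex (j : 'I_n) : exists r, j \in inner X ->
    [/\ tau j <= r, r < tau j.+1, root g r & g.[tau j] = 0 -> r = tau j].
  case: (boolP (j \in inner X)) => [|_]; last by exists 0.
  rewrite inE => /andP[jX jn]; have := cg j jX; rewrite ordSE // => /node_root[r hr].
  by exists r.
have [rho rhoP] := choice ex.
pose rs := [seq rho j | j <- enum (inner X)].
have inj : {in inner X &, injective rho}.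
  have aux (i j : 'I_n) : i \in inner X -> j \in inner X -> (i < j)%N -> rho i < rho j.
    move=> /rhoP[_ h1 _ _] /rhoP[h2 _ _ _] ij; apply: lt_le_trans h1 _.
    by apply: le_trans h2; rewrite ler_tau.
  move=> i j iX jX e; apply: val_inj; case: (ltngtP i j) => // ij.
    by have := aux i j iX jX ij; rewrite e ltxx.
  by have := aux j i jX iX ij; rewrite e ltxx.
have urs : uniq_roots rs.
  rewrite uniq_rootsE map_inj_in_uniq ?enum_uniq // => i j.
  by rewrite !mem_enum; exact: inj.
have ars : all (root g) rs.
  by apply/allP => x /mapP[j jI ->]; move: jI; rewrite mem_enum => /rhoP[].
have [e ge] := uniq_roots_prod_XsubC ars urs.
rewrite big_map big_enum /= in ge.
have e0 : e != 0 by apply: contra_eq_neq ge => ->; rewrite mul0r.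
have se : size g = (size e + #|inner X|)%N.
  rewrite ge size_Mmonic ?monic_prod_XsubC // -big_enum /= size_prod_XsubC -cardE.
  by rewrite addnS.
have last_lt : (n.-1 < n)%N by lia.
have cI : #|X| = (#|inner X| + [exists j in X, j.+1 == n])%N.
  case: (boolP [exists j in X, j.+1 == n]) => [/exists_inP[j jX /eqP jn]|/exists_inPn nx].
    rewrite (cardsD1 j) jX addnC; congr (_ + _)%N; apply: eq_card => i; rewrite !inE.
    rewrite -(inj_eq val_inj) /= andbC; case: (_ \in _) => //=.
    by have := ltn_ord i; lia.
  rewrite addn0; apply: eq_card => i; rewrite inE; case: (boolP (i \in X)) => //= iX.
  by apply/esym; have := nx i iX; have := ltn_ord i; lia.
exists rho, e; split=> //.
- by move=> j /rhoP[].
- by move: cI se sg; rewrite cX; case: [exists j in X, j.+1 == n];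
    move: #|inner X| (size e) (size g) => x y z /=; lia.
move=> /negbTE hl; move: cI se sg; rewrite cX hl.
by move: #|inner X| (size e) (size g) => x y z /=; lia.
Qed.

Lemma inner_prod_last X (rho : 'I_n -> R) :
  (forall j, j \in inner X -> rho j < tau j.+1) ->
  0 < \prod_(j in inner X) (tau n.-1 - rho j).
Proof.
move=> h; apply: prodr_gt0 => j jX; rewrite subr_gt0; apply: lt_le_trans (h j jX) _.
by rewrite ler_tau; move: jX; rewrite inE; lia.
Qed.

(** Only a linear cofactor needs an argument. Either it vanishes at the last node, or the wrapped
    constraint makes [g] take opposite values at the two extreme nodes; as there are [2k - 3] inner
    roots, an odd number, the cofactor then has equal signs there. By linearity the sign persists in
    between. *)
Lemma cofactor_sign X g (rho : 'I_n -> R) (e : {poly R}) : (#|X| = (2 * k).-2)%N ->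
  constrained X g -> (forall j, j \in inner X -> tau j <= rho j /\ rho j < tau j.+1) ->
  g = e * \prod_(j in inner X) ('X - (rho j)%:P) -> e != 0 -> (size e <= 2)%N ->
  (~~ [exists j in X, j.+1 == n] -> (size e <= 1)%N) ->
  exists s : bool, (forall i, live X i -> 0 < (-1) ^+ s * e.[tau i]) /\
    0 <= (-1) ^+ s * e.[tau n.-1].
Proof.
move=> cX cg rhoP ge e0 se se1.
case: (boolP [exists j in X, j.+1 == n]) => [/exists_inP[j jX /eqP jn]|nx]; last first.
  have [a a0 ea] : exists2 a : R, a != 0 & e = a%:P.
    by apply/size_poly1P; rewrite eqn_leq se1 //= lt0n size_poly_eq0.
  have ev x : e.[x] = a by rewrite ea hornerC.
  exists (a < 0)%R; have h : 0 < (-1) ^+ (a < 0)%R * a.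
    case: (ltrgt0P a) a0 => // h _; rewrite ?expr0 ?expr1 ?mul1r // mulN1r.
    by rewrite oppr_gt0.
  by split=> [i _|]; rewrite ev // ltW.
have el x := horner_size2 x se.
have Pn := inner_prod_last (fun j jX => (rhoP j jX).2).
have gE x : g.[x] = e.[x] * \prod_(j in inner X) (x - rho j).
  rewrite ge hornerM horner_prod; congr (_ * _); apply: eq_bigr => i _.
  by rewrite hornerXsubC.
have jE : j = n.-1 :> nat by have := jn; lia.
have tl i : (i.+1 < n)%N -> tau i < tau n.-1 by rewrite ltr_tau; lia.
have t0 := tl 0; have t0n : tau 0 < tau n.-1 by apply: t0; lia.
have key : exists s : bool, 0 < (-1) ^+ s * e.[tau 0] /\ 0 <= (-1) ^+ s * e.[tau n.-1].
  have e00 : e.[tau n.-1] = 0 -> e.[tau 0] != 0.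
    move=> e1; apply: contra e0 => /eqP e2; move: e1 e2; rewrite !el => e1 e2.
    have d : e`_1 * (tau n.-1 - tau 0) = 0 by rewrite mulrBr; lra.
    move/eqP: d; rewrite mulf_eq0 subr_eq0 (gt_eqF t0n) orbF => /eqP c1.
    rewrite c1 mul0r addr0 in e2; apply/eqP/polyP => i; rewrite coef0.
    by case: i => [//|[//|i]]; rewrite nth_default // (leq_trans se).
  have sgn (x : R) : x != 0 -> exists s : bool, 0 < (-1) ^+ s * x.
    move=> x0; exists (x < 0)%R; case: (ltrgt0P x) x0 => // h _.
      by rewrite expr0 mul1r.
    by rewrite expr1 mulN1r oppr_gt0.
  case: (eqVneq g.[tau j] 0) => [gj|gj].
    have el0 : e.[tau n.-1] = 0.
      move/eqP: gj; rewrite jE gE mulf_eq0 (gt_eqF Pn) orbF => /eqP //.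
    by have [s hs] := sgn _ (e00 el0); exists s; rewrite el0 mulr0.
  case: (cg j jX) => [/eqP|gj0]; first by rewrite (negbTE gj).
  rewrite (ordS_last jn) in gj0.
  have odd_inner : odd #|inner X|.
    have : #|X| = #|inner X|.+1.
      rewrite (cardsD1 j) jX add1n; congr _.+1; apply: eq_card => i; rewrite !inE.
      rewrite -(inj_eq val_inj) /= andbC; case: (_ \in _) => //=.
      by have := ltn_ord i; lia.
    by rewrite cX; move: #|inner X| => x; lia.
  have P0 : \prod_(i in inner X) (tau 0 - rho i) <= 0.
    have -> : \prod_(i in inner X) (tau 0 - rho i) = - \prod_(i in inner X) (rho i - tau 0).
      under eq_bigr => i _ do rewrite -opprB.
      by rewrite prodrN -signr_odd odd_inner expr1 mulN1r.
    rewrite oppr_le0; apply: prodr_ge0 => i iX; rewrite subr_ge0.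
    by apply: le_trans (rhoP i iX).1; rewrite ler_tau.
  move: gj0; rewrite jE !gE => eq1.
  have eT : e.[tau 0] != 0.
    apply/eqP => e1; move: eq1; rewrite e1 mul0r oppr0 => /eqP.
    rewrite mulf_eq0 (gt_eqF Pn) orbF => /eqP /e00; by rewrite e1 eqxx.
  have [s hs] := sgn _ eT; exists s; split=> //.
  rewrite -(pmulr_lge0 _ Pn) -mulrA eq1 -mulrN mulrA.
  by rewrite mulr_ge0 ?oppr_ge0 // ltW.
have [s [s0 sn]] := key; exists s; split=> // i.
rewrite /live => /andP[_]; have -> : [exists j in X, j.+1 == n].
  by apply/exists_inP; exists j => //; apply/eqP.
rewrite orbF => iN; have ti := tl i iN.
have ti0 : tau 0 <= tau i by rewrite ler_tau.
have id : (tau n.-1 - tau 0) * ((-1) ^+ s * e.[tau i]) =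
   (tau n.-1 - tau i) * ((-1) ^+ s * e.[tau 0]) +
   (tau i - tau 0) * ((-1) ^+ s * e.[tau n.-1]) by rewrite !el; ring.
have d0 : 0 < tau n.-1 - tau 0 by rewrite subr_gt0.
rewrite -(pmulr_rgt0 _ d0) id; apply: ltr_pwDl.
  by apply: mulr_gt0; rewrite ?subr_gt0.
by apply: mulr_ge0; rewrite ?subr_ge0.
Qed.

(** For the last clause: a linear cofactor that does not change sign up to the last node decreases
    from [i] to [i'] at most by the ratio of the distances to that node. This ratio is at most 2
    because [tau i'] is at most half of the last node. *)
Lemma shape X g : (#|X| = (2 * k).-2)%N -> g != 0 -> (size g <= (2 * k).-1)%N ->
  constrained X g -> exists (rho : 'I_n -> R) (E : nat -> R) (s : bool),
  [/\ forall j, j \in inner X -> [/\ tau j <= rho j, rho j < tau j.+1 &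
        g.[tau j] = 0 -> rho j = tau j],
      forall i, g.[tau i] = E i * \prod_(j in inner X) (tau i - rho j),
      forall i, live X i -> 0 < (-1) ^+ s * E i &
      forall i i', (i < i')%N -> live X i' -> `|E i| <= 2 * `|E i'|].
Proof.
move=> cX g0 sg cg; have [rho [e [rP ge e0 se se1]]] := shape_factor cX g0 sg cg.
have rP' j : j \in inner X -> tau j <= rho j /\ rho j < tau j.+1 by case/rP.
have [s [sP sn]] := cofactor_sign cX cg rP' ge e0 se se1.
exists rho, (fun i => e.[tau i]), s; split=> //.
  move=> i; rewrite ge hornerM horner_prod; congr (_ * _); apply: eq_bigr => j _.
  by rewrite hornerXsubC.
move=> i i' ii' li'.
have li : live X i by move: li'; rewrite /live; case: [exists j in X, j.+1 == n]; rewrite ?orbF ?orbT; lia.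
have nE x : `|e.[x]| = `|(-1) ^+ s * e.[x]| by rewrite normrM normr_sign mul1r.
rewrite !nE !gtr0_norm ?sP //.
case: (boolP [exists j in X, j.+1 == n]) => [hx|nx]; last first.
  have [a a0 ea] : exists2 a : R, a != 0 & e = a%:P.
    by apply/size_poly1P; rewrite eqn_leq se1 //= lt0n size_poly_eq0.
  by have := sP i li; rewrite ea !hornerC; lra.
have el x := horner_size2 x se.
have i'n : (i'.+1 < n)%N by move: li'; rewrite /live hx orbF => /andP[].
have t1 : tau i < tau i' by rewrite ltr_tau.
have t2 : ratio R n * tau i' <= tau n.-1 by rewrite -tauS ler_tau; lia.
have t3 : 2 * tau i' <= tau n.-1.
  apply: le_trans t2; rewrite ler_wpM2r //; first exact/ltW/tau_gt0.
  by have := ratio_ge100; lra.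
have id : (tau n.-1 - tau i) * ((-1) ^+ s * e.[tau i']) =
   (tau n.-1 - tau i') * ((-1) ^+ s * e.[tau i]) +
   (tau i' - tau i) * ((-1) ^+ s * e.[tau n.-1]) by rewrite !el; ring.
have ti0 := tau_gt0 i.
have d0 : 0 < tau n.-1 - tau i by lra.
rewrite -(ler_pM2l d0) [X in _ <= X]mulrCA id mulrDr.
have h1 : 0 <= (tau i' - tau i) * ((-1) ^+ s * e.[tau n.-1]).
  by rewrite mulr_ge0 // subr_ge0 ltW.
have : (tau n.-1 - tau i) * ((-1) ^+ s * e.[tau i]) <=
  (2 * (tau n.-1 - tau i')) * ((-1) ^+ s * e.[tau i]).
  by apply: ler_wpM2r; [exact/ltW/sP|lra].
rewrite -mulrA; lra.
Qed.

Lemma constrained_sign X g : (#|X| = (2 * k).-2)%N -> g != 0 -> (size g <= (2 * k).-1)%N ->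
  constrained X g -> exists s : bool, forall i : 'I_n, i \notin X ->
  g.[tau i] != 0 /\ (g.[tau i] < 0) = s (+) odd #|[set j in inner X | (i < j)%N]|.
Proof.
move=> cX g0 sg cg; have [rho [E [s [rP gE Es _]]]] := shape cX g0 sg cg.
exists s => i iX.
have li : live X i.
  rewrite /live ltn_ord /=; case: (ltnP i.+1 n) => //= iN.
  apply/exists_inPn => j jX; apply/eqP => jn.
  have ij : i = j by apply: val_inj; have := ltn_ord i; move=> /=; lia.
  by rewrite ij jX in iX.
have iI j : j \in inner X -> (i <= j)%N -> (i < j)%N.
  move=> jX; rewrite leq_eqVlt => /orP[/eqP/val_inj ij|//].
  by move: jX iX; rewrite inE -ij => /andP[->].
have := @prod_sign R n (inner X) rho i.
have lo j : j \in inner X -> (j < i)%N -> rho j < tau i.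
  by move=> /rP[_ h _] ji; apply: lt_le_trans h _; rewrite ler_tau.
have hi j : j \in inner X -> (i <= j)%N -> tau i < rho j.
  by move=> jX /(iI j jX) ij; have [h _ _] := rP j jX; apply: lt_le_trans h; rewrite ltr_tau.
move=> /(_ lo hi).
have -> : [set j in inner X | (i <= j)%N] = [set j in inner X | (i < j)%N].
  apply/setP => j; rewrite !inE; case: (boolP (j \in inner X)) => [jX|].
    move: (jX); rewrite inE => -> /=; apply/idP/idP; [exact: iI|exact: ltnW].
  by rewrite inE => /negbTE ->.
set c := #|_|; rewrite -signr_odd => h1; have h2 := Es i li.
have : 0 < (-1) ^+ (s (+) odd c) * g.[tau i].
  by rewrite signr_addb gE mulrACA mulr_gt0.
case: (s (+) odd c); rewrite ?expr0 ?expr1 ?mul1r ?mulN1r ?oppr_gt0 => h.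
  by rewrite lt_eqF.
by rewrite gt_eqF // lt_gtF.
Qed.

End Shape.

(** * Signs of sums over stable sets *)

(* [lia] after dropping the hypotheses that are not about natural numbers, whose
   preprocessing is very slow. *)
Ltac nat_lia := repeat match goal with H : ?P |- _ =>
  lazymatch type of P with Prop =>
    lazymatch P with
    | is_true (leq _ _) => fail
    | is_true (_ && _) => fail
    | is_true (_ || _) => fail
    | is_true (~~ _) => fail
    | @eq ?T _ _ => tryif unify T nat then fail else clear H
    | _ => clear H
    end
  end end; lia.

Lemma card_ord_range (n a b : nat) : (b <= n)%N ->
  #|[set j : 'I_n | (a <= j < b)%N]| = (b - a)%N.
Proof.
elim: b => [|b IH] bn; first by rewrite eq_card0 // => j; rewrite inE andbF.
have [ab|ab] := leqP a b; last first.
  rewrite eq_card0 => [|j]; first nat_lia.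
  by rewrite inE; apply/negP => /andP[h1 h2]; nat_lia.
rewrite (cardsD1 (Ordinal bn)) inE /= ab ltnS leqnn /= subSn // add1n; congr _.+1.
rewrite -IH ?(ltnW bn) //; apply: eq_card => j; rewrite !inE -(inj_eq val_inj) /=.
by nat_lia.
Qed.

Lemma bernoulli (R : realFieldType) (x : R) (m : nat) : 0 <= x <= 1 ->
  1 - m%:R * x <= (1 - x) ^+ m.
Proof.
move=> /andP[x0 x1]; elim: m => [|m IH]; first by rewrite mul0r subr0 expr0.
rewrite exprS; have : (1 - x) * (1 - m%:R * x) <= (1 - x) * (1 - x) ^+ m.
  by rewrite ler_wpM2l // subr_ge0.
apply: le_trans; rewrite -natr1.
have : 0 <= m%:R * (x * x) by rewrite mulr_ge0 // mulr_ge0.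
lra.
Qed.

Lemma sgr_add (R : realDomainType) (x y : R) : x != 0 ->
  `|y| < `|x| \/ ((x < 0 -> y <= 0) /\ (0 < x -> 0 <= y)) -> Num.sg (x + y) = Num.sg x.
Proof.
move=> x0 h; case: (ltrgt0P x) x0 h => // x0 _ [h|[h1 h2]].
- by rewrite !gtr0_sg //; move: h; rewrite ltr_norml ?(gtr0_norm x0) => /andP[]; lra.
- by rewrite !gtr0_sg //; have := h2 isT; lra.
- by rewrite !ltr0_sg //; move: h; rewrite ltr_norml ?(ltr0_norm x0) => /andP[]; lra.
- by rewrite !ltr0_sg //; have := h1 isT; lra.
Qed.

Section Sum.
Variables (R : rcfType) (n k : nat).
Hypotheses (k_gt0 : (0 < k)%N) (kn : (2 * k < n)%N).
Variables (Z Tt : {set 'I_n}).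
Hypothesis ZT : [disjoint Z & Tt].
Let J := Z :|: Tt.
Hypothesis cJ : (#|J| = (2 * k).-1)%N.
Notation tau := (@tau R n).
Notation M := (ratio R n).
Implicit Types (g : {poly R}) (b u i j : 'I_n).

Let ltr_tau := @ltr_tau R n k k_gt0 kn.
Let ler_tau := @ler_tau R n k k_gt0 kn.
Let tau_gt0 := @tau_gt0 R n k k_gt0 kn.
Let ratio_ge100 := @ratio_ge100 R n k k_gt0 kn.

(** The test polynomials: they meet all constraints of [J], zeros on [Z] and linked pairs on [Tt],
    except the zero at [b], which is released and is not the end of a link. *)
Record adm b g : Prop := Adm {
  adm_b : b \in Z;
  adm_bS : forall j, j \in Tt -> ordS j != b;
  adm_neq0 : g != 0;
  adm_size : (size g <= (2 * k).-1)%N;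
  adm_Z : forall j, j \in Z -> j != b -> g.[tau j] = 0;
  adm_T : forall j, j \in Tt -> g.[tau j] = - g.[tau (ordS j)] }.

Lemma adm_constrained b g : adm b g -> constrained (J :\ b) g.
Proof.
move=> ad j; rewrite !inE => /andP[jb /orP[jZ|jT]].
  by left; exact: (adm_Z ad).
by right; exact: (adm_T ad).
Qed.

Lemma adm_card b g : adm b g -> (#|J :\ b| = (2 * k).-2)%N.
Proof.
move=> ad; have bJ : b \in J by rewrite inE (adm_b ad).
by have := cardsD1 b J; rewrite bJ cJ; move: #|_|; nat_lia.
Qed.

Lemma adm_shape b g : adm b g -> exists (rho : 'I_n -> R) (E : nat -> R),
  [/\ forall j, j \in inner (J :\ b) -> [/\ tau j <= rho j, rho j < tau j.+1 &
        g.[tau j] = 0 -> rho j = tau j],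
      forall i : nat, g.[tau i] = E i * \prod_(j in inner (J :\ b)) (tau i - rho j) &
      forall i i' : nat, (i < i')%N -> live (J :\ b) i' -> `|E i| <= 2 * `|E i'|].
Proof.
move=> ad; have [rho [E [s [h1 h2 _ h3]]]] := shape k_gt0 kn (adm_card ad) (adm_neq0 ad)
  (adm_size ad) (adm_constrained ad).
exists rho, E; split=> [|i|i i']; [exact: h1|exact: h2|exact: h3].
Qed.

Lemma adm_sign b g : adm b g -> exists s : bool, forall i, i \notin J :\ b ->
  g.[tau i] != 0 /\ (g.[tau i] < 0) = s (+) odd #|[set j in inner (J :\ b) | (i < j)%N]|.
Proof.
move=> ad; have [s sP] := constrained_sign k_gt0 kn (adm_card ad) (adm_neq0 ad)
  (adm_size ad) (adm_constrained ad).
exists s => i iX; exact: sP.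
Qed.

Definition tn (i : nat) := [exists j in Tt, val j == i].

Lemma tnE j : tn j = (j \in Tt).
Proof.
apply/exists_inP/idP => [[i iT /eqP/val_inj <-//]|jT]; by exists j.
Qed.

Lemma tnP (i : nat) (h : (i < n)%N) : tn i = (Ordinal h \in Tt).
Proof. by rewrite -tnE. Qed.

Lemma adm_tn b g (i : nat) : adm b g -> tn i -> (i.+1 < n)%N -> g.[tau i] = - g.[tau i.+1].
Proof.
move=> ad ti iN; move: ti; rewrite (tnP (ltnW iN)) => /(adm_T ad).
by rewrite ordSE.
Qed.

(* Parity of the position of [i] in its maximal run of links. *)
Fixpoint par (i : nat) : bool := if i is i'.+1 then tn i' && ~~ par i' else false.

Lemma big_ord_step (P : pred 'I_n) (F : 'I_n -> R) (m : nat) (mn : (m < n)%N) :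
  \sum_(i < n | (i < m.+1)%N && P i) F i =
  \sum_(i < n | (i < m)%N && P i) F i + (if P (Ordinal mn) then F (Ordinal mn) else 0).
Proof.
have e i : (i < m.+1)%N && P i && (i != Ordinal mn) = (i < m)%N && P i.
  by rewrite -(inj_eq val_inj) /=; case: (P i); rewrite ?andbF // !andbT; nat_lia.
case: (boolP (P (Ordinal mn))) => Po.
  rewrite (bigD1 (Ordinal mn)) /= ?ltnS ?leqnn // addrC; congr (_ + _).
  exact: eq_bigl.
rewrite addr0; apply: eq_bigl => i; rewrite -e.
by case: eqP => [->|]; rewrite ?andbT // (negbTE Po) andbF.
Qed.

(** Linked neighbours cancel when each run of links is paired off from its left end. The free nodes
    left without partner survive, together with the pair still open at the cut [m]. *)
Lemma partial_sum b g (m : nat) : adm b g -> (m <= n)%N ->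
  \sum_(i < n | (i < m)%N && (i != b)) g.[tau i] =
  \sum_(i < n | (i < m)%N && ((i \notin J) && ~~ par i)) g.[tau i] +
  (if par m then g.[tau m.-1] else 0).
Proof.
move=> ad; have bJ : b \in J by rewrite inE (adm_b ad).
elim: m => [_|m IH mn]; first by rewrite !big_pred0 ?addr0 // => i; rewrite ltn0.
rewrite !big_ord_step IH ?(ltnW mn) //= -!addrA; congr (_ + _).
set o := Ordinal mn.
case: (boolP (par m)) => pm /=.
  rewrite !andbF addr0.
  case: m mn @o pm {IH} => // m mn o /= /andP[tm _].
  have -> /= : o != b.
    have := tm; rewrite (tnP (ltnW mn)) => /(adm_bS ad).
    by apply: contra => /eqP <-; apply/eqP/val_inj; exact: modn_small.
  by rewrite (adm_tn ad tm mn) addNr.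
rewrite !andbT add0r tnP -/o.
case: (boolP (o \in J)) => oJ /=; last first.
  have -> : o != b by apply: contra oJ => /eqP ->.
  by move: oJ; rewrite inE negb_or => /andP[_ /negbTE ->]; rewrite addr0.
rewrite add0r; case: (boolP (o \in Tt)) => oT.
  have -> // : o != b.
  apply: contraTneq oT => ->; have := disjointFr ZT (adm_b ad); by move=> ->.
case: eqP => [//|/eqP ob] /=.
by apply: (@adm_Z _ _ ad o) => //; move: oJ; rewrite inE (negbTE oT) orbF.
Qed.

Lemma run_ex (u : nat) : exists f : nat, [/\ (f <= u)%N, forall j : nat, (f <= j < u)%N -> tn j,
  f = 0%N \/ ~~ tn f.-1 & par u = odd (u - f)].
Proof.
elim: u => [|u [f [fu ft f0 pu]]]; first by exists 0%N; split=> //; left.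
case: (boolP (tn u)) => tu.
  exists f; split=> //; first nat_lia.
    move=> j /andP[fj]; rewrite ltnS leq_eqVlt => /orP[/eqP -> //|ju].
    by apply: ft; rewrite fj.
  by rewrite /= tu pu subSn.
exists u.+1; split=> //=; first by move=> j; nat_lia.
  by right.
by rewrite (negbTE tu) subnn.
Qed.

Lemma run_val b g (f u : nat) : adm b g -> (u < n)%N -> (f <= u)%N ->
  (forall j : nat, (f <= j < u)%N -> tn j) -> g.[tau f] = (-1) ^+ (u - f) * g.[tau u].
Proof.
move=> ad un; have [m] := ubnP (u - f); elim: m f => // m IH f um fu ft.
move: fu; rewrite leq_eqVlt => /orP[/eqP ->|fu]; first by rewrite subnn mul1r.
have tf : tn f by apply: ft; rewrite leqnn.
rewrite (adm_tn ad tf (leq_ltn_trans fu un)) IH //; last first.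
- by move=> j h; apply: ft; nat_lia.
- by nat_lia.
by rewrite (_ : (u - f)%N = (u - f.+1).+1) ?exprS ?mulN1r ?mulNr //; nat_lia.
Qed.

(** The constant 24/25 is [1 - 4 / 100]: at most [n] factors lose [4 / M] each, [M] is [100 n], and
    Bernoulli's inequality adds up the losses. *)
Lemma prod_ratio (Y : {set 'I_n}) (p q : 'I_n -> R) :
  (forall j, j \in Y -> 0 <= p j) -> (forall j, j \in Y -> (1 - 4 / M) * p j <= q j) ->
  24 / 25 * \prod_(j in Y) p j <= \prod_(j in Y) q j.
Proof.
move=> p0 pq; have M100 := ratio_ge100; have Mn := ratio_ge R n.
have x1 : 0 <= 4 / M <= 1 by rewrite divr_ge0 ?ler_pdivrMr //=; lra.
have x2 : 0 <= 1 - 4 / M by lra.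
have : \prod_(j in Y) ((1 - 4 / M) * p j) <= \prod_(j in Y) q j.
  by apply: ler_prod => j jY; rewrite pq // mulr_ge0 // p0.
apply: le_trans; rewrite big_split /= prodr_const; apply: ler_wpM2r.
  exact: prodr_ge0.
apply: le_trans (bernoulli _ x1).
have : #|Y|%:R <= n%:R :> R by rewrite ler_nat -[X in (_ <= X)%N](card_ord n) max_card.
have -> : #|Y|%:R * (4 / M) = (4 * #|Y|%:R) / M by rewrite mulrCA mulrA.
move=> h; have : 4 * #|Y|%:R / M <= 1 / 25 by rewrite ler_pdivrMr; lra.
lra.
Qed.

Section Run.
Variables (b : 'I_n) (g : {poly R}) (u : 'I_n) (f : nat).
Hypotheses (ad : adm b g) (uJ : u \notin J) (fu : (f <= u)%N).
Hypothesis ft : forall j : nat, (f <= j < u)%N -> tn j.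
Variables (rho : 'I_n -> R) (E : nat -> R).
Let X := J :\ b.
Hypothesis rP : forall j, j \in inner X -> [/\ tau j <= rho j, rho j < tau j.+1 &
        g.[tau j] = 0 -> rho j = tau j].
Hypothesis gE : forall i : nat, g.[tau i] = E i * \prod_(j in inner X) (tau i - rho j).
Hypothesis EE : forall i i' : nat, (i < i')%N -> live X i' -> `|E i| <= 2 * `|E i'|.

Lemma live_run (i : nat) : (i <= u)%N -> live X i.
Proof.
move=> iu; have un := ltn_ord u; rewrite /live (leq_ltn_trans iu un) /=.
case: (ltnP i.+1 n) => //= iN; apply/exists_inPn => j jX; apply/eqP => jn.
have uj : u = j by apply: val_inj => /=; nat_lia.
by move: uJ; rewrite uj; move: jX; rewrite /X !inE => /andP[_ ->].
Qed.

Lemma gu_neq0 : g.[tau u] != 0.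
Proof.
have [s sP] := adm_sign ad; have uX : u \notin X by rewrite /X inE (negbTE uJ) andbF.
by have [] := sP u uX.
Qed.

Lemma run_neq0 (i : nat) : (f <= i <= u)%N -> g.[tau i] != 0.
Proof.
move=> /andP[fi iu]; rewrite (run_val ad (ltn_ord u) iu) ?mulf_neq0 ?signr_eq0 ?gu_neq0 //.
by move=> j h; apply: ft; nat_lia.
Qed.

Lemma far_factor (a b' : nat) (r : R) : (a <= b')%N -> M * tau b' <= 4 * r ->
  (1 - 4 / M) * `|tau a - r| <= `|tau b' - r|.
Proof.
move=> ab h; have M100 := ratio_ge100; have tb := tau_gt0 b'; have ta := tau_gt0 a.
have tab : tau a <= tau b' by rewrite ler_tau.
have rb : tau b' <= r.
  have : 4 * tau b' <= M * tau b' by rewrite ler_wpM2r ?ltW //; lra.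
  lra.
rewrite !ler0_norm ?subr_le0 // ?(le_trans tab) // !opprB.
have : (1 - 4 / M) * (r - tau a) <= (1 - 4 / M) * r.
  by rewrite ler_wpM2l ?subr_ge0 ?ler_pdivrMr; lra.
have : tau b' <= 4 / M * r by rewrite mulrAC ler_pdivlMr; lra.
lra.
Qed.

(** On a linked pair [g] has equal absolute values. A root below a quarter of [tau j.+1] would be at
    least three times nearer to [tau j] than to [tau j.+1]; with a factor 2 from the cofactor and
    25/24 from the other roots, the value at [j] would be at most 25/36 of that at [j.+1]. The
    induction starts at the right end of the run, so the roots further right are already known to be
    far. *)
Lemma link_root (j : 'I_n) : (f <= j < u)%N -> tau j.+1 <= 4 * rho j.
Proof.
have M100 := ratio_ge100.
have [m] := ubnP (u - j); elim: m j => // m IH j uj /andP[fj ju].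
have un := ltn_ord u.
have inX (l : 'I_n) : (f <= l < u)%N -> l \in inner X.
  move=> lr; have lT : l \in Tt by rewrite -tnE; exact: ft.
  rewrite !inE lT orbT andbT; apply/andP; split; last by nat_lia.
  by apply: contraTneq lT => ->; have -> := disjointFr ZT (adm_b ad).
have jX : j \in inner X by apply: inX; rewrite fj.
rewrite leNgt; apply/negP => hlt.
have tj := tau_gt0 j; have [r1 r2 _] := rP jX.
have far (l : 'I_n) : l \in inner X -> (j < l)%N -> M * tau j.+1 <= 4 * rho l.
  move=> lX jl; rewrite -tauS; case: (ltngtP l u) => lu.
  - apply: le_trans (IH l _ _); [by rewrite ler_tau; nat_lia|nat_lia|nat_lia].
  - have [r3 _ _] := rP lX.
    have : tau j.+2 <= tau l by rewrite ler_tau; nat_lia.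
    by have := tau_gt0 j.+2; lra.
  by move: lX; rewrite (val_inj lu) !inE; have := uJ; rewrite inE => /negbTE ->; rewrite andbF.
have ratio_p : 24 / 25 * \prod_(l in inner X :\ j) `|tau j - rho l| <=
    \prod_(l in inner X :\ j) `|tau j.+1 - rho l|.
  apply: prod_ratio => // l; rewrite in_setD1 => /andP[lj lX].
  have [jl|lj'] := ltnP j l; first by apply: far_factor; [nat_lia|exact: far].
  have lj2 : (l < j)%N by rewrite ltn_neqAle lj' andbT; apply: contra lj => /eqP/val_inj ->.
  have [_ r4 _] := rP lX; have : tau l.+1 <= tau j by rewrite ler_tau.
  have tjj : tau j < tau j.+1 by rewrite ltr_tau.
  move=> r5; rewrite !gtr0_norm ?subr_gt0; [|lra|lra].
  have : 0 <= 4 / M * (tau j - rho l) by rewrite mulr_ge0 ?divr_ge0; lra.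
  lra.
have gj : `|g.[tau j]| = `|g.[tau j.+1]|.
  by rewrite (adm_tn ad) ?normrN //; [apply: ft; rewrite fj|nat_lia].
have g0 : 0 < `|g.[tau j.+1]| by rewrite normr_gt0 run_neq0 //; nat_lia.
have e2 := EE (ltnSn j) (live_run ju).
move: gj; rewrite !gE !normrM !normr_prod (big_setD1 j jX) /= [X in _ = _ * X](big_setD1 j jX) /=.
move: g0; rewrite gE normrM normr_prod (big_setD1 j jX) /=.
set P := \prod_(l in _) _ in ratio_p *; set P' := \prod_(l in _) _ in ratio_p *.
have P0 : 0 <= P by apply: prodr_ge0.
have P'0 : 0 <= P' by apply: prodr_ge0.
rewrite [`|tau j - _|]ler0_norm ?subr_le0 // [`|tau j.+1 - _|]gtr0_norm ?subr_gt0 // opprB.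
have E0 := normr_ge0 (E j); have E1 := normr_ge0 (E j.+1).
set a := rho j - tau j; set d := tau j.+1 - rho j.
have a0 : 0 <= a by rewrite subr_ge0.
have ad3 : 3 * a <= d by rewrite /a /d; lra.
have d0 : 0 <= d by lra.
move=> g0 eq.
have s1 : `|E j| * (a * P) <= 2 * `|E j.+1| * (a * P) by rewrite ler_wpM2r // mulr_ge0.
have s2 : a * P <= (d / 3) * (25 / 24 * P').
  by apply: ler_pM => //; lra.
have s3 : 2 * `|E j.+1| * (a * P) <= 2 * `|E j.+1| * ((d / 3) * (25 / 24 * P')).
  by rewrite ler_wpM2l // mulr_ge0.
have s4 : 2 * `|E j.+1| * ((d / 3) * (25 / 24 * P')) = 25 / 36 * (`|E j.+1| * (d * P')) by field.
lra.
Qed.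

(** Since [f.-1] is not linked, the roots left of the run lie at or below [tau f.-1]. The factor of
    such a root grows from [tau i] to [tau f] at least by [M - 1 >= 99 n], while the cofactor and
    the other factors lose at most [2] and [25 / 24]. The links carry the value from [f] to [u]. The
    margin [4 n] leaves room for summing over all nodes. *)
Lemma dominate : (0 < f)%N -> ~~ tn f.-1 -> (exists2 j, j \in inner X & (j < f)%N) ->
  forall i : nat, (i < f)%N -> `|g.[tau i]| * (4 * n%:R) <= `|g.[tau u]|.
Proof.
move=> f0 tf [j0 j0X j0f] i iff.
have M100 := ratio_ge100; have Mn := ratio_ge R n; have un := ltn_ord u.
have near (l : 'I_n) : l \in inner X -> (l < f)%N -> 0 < rho l /\ rho l <= tau f.-1.
  move=> lX lf; have [r1 r2 r3] := rP lX; split; first exact: lt_le_trans r1.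
  move: lf; rewrite -{1}(prednK f0) ltnS leq_eqVlt => /orP[/eqP lf|lf]; last first.
    by apply/ltW/(lt_le_trans r2); rewrite ler_tau.
  rewrite -lf r3 //; apply: (adm_Z ad); move: lX; rewrite !inE => /andP[/andP[lb]] //.
  by rewrite -tnE lf (negbTE tf) orbF.
have tf1 : tau f = M * tau f.-1 by rewrite -tauS prednK.
have tp := tau_gt0 f.-1; have ti := tau_gt0 i.
have tif : tau i <= tau f.-1 by rewrite ler_tau; nat_lia.
have nearb (l : 'I_n) : l \in inner X -> (l < f)%N ->
    (M - 1) * `|tau i - rho l| <= `|tau f - rho l|.
  move=> lX lf; have [r1 r2] := near l lX lf.
  have : `|tau i - rho l| <= tau f.-1 by rewrite ler_norml; apply/andP; split; lra.
  move=> h; apply: (@le_trans _ _ ((M - 1) * tau f.-1)); first by rewrite ler_wpM2l //; lra.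
  by apply: le_trans (ler_norm _); rewrite tf1; lra.
have ratio_p : 24 / 25 * \prod_(l in inner X :\ j0) `|tau i - rho l| <=
    \prod_(l in inner X :\ j0) `|tau f - rho l|.
  apply: prod_ratio => // l; rewrite in_setD1 => /andP[lj lX].
  have [fl|lf] := leqP f l; last first.
    apply: le_trans (nearb l lX lf); apply: ler_wpM2r => //.
    by have : 0 <= 4 / M by [rewrite divr_ge0; lra]; lra.
  apply: far_factor; first nat_lia.
  rewrite -tauS; case: (ltngtP l u) => lu.
  - apply: le_trans (link_root _); [by rewrite ler_tau; nat_lia|nat_lia].
  - have [r3 _ _] := rP lX.
    have : tau f.+1 <= tau l by rewrite ler_tau; nat_lia.
    by have := tau_gt0 f.+1; lra.
  by move: lX; rewrite (val_inj lu) !inE; have := uJ; rewrite inE => /negbTE ->; rewrite andbF.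
have e2 := EE iff (live_run fu).
have -> : `|g.[tau u]| = `|g.[tau f]|.
  by rewrite (run_val ad un fu ft) normrM normr_sign mul1r.
rewrite !gE !normrM !normr_prod (big_setD1 j0 j0X) /= [X in _ <= _ * X](big_setD1 j0 j0X) /=.
set P := \prod_(l in _) _ in ratio_p *; set P' := \prod_(l in _) _ in ratio_p *.
have P0 : 0 <= P by apply: prodr_ge0.
have P'0 : 0 <= P' by apply: prodr_ge0.
have ad3 := nearb j0 j0X j0f; set a := `|tau i - _| in ad3 *; set d := `|tau f - _| in ad3 *.
have a0 : 0 <= a by exact: normr_ge0.
have d0 : 0 <= d by exact: normr_ge0.
have n1 : 1 <= n%:R :> R by rewrite ler1n; nat_lia.
have s0 : a * (4 * n%:R) <= 4 / 99 * d.
  have : 99 * n%:R * a <= (M - 1) * a by rewrite ler_wpM2r //; lra.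
  lra.
have s1 : `|E i| * (a * P) * (4 * n%:R) = `|E i| * (a * (4 * n%:R)) * P by ring.
rewrite s1.
have an0 : 0 <= a * (4 * n%:R) by rewrite mulr_ge0 // mulr_ge0 //; lra.
have s2 : `|E i| * (a * (4 * n%:R)) * P <= (2 * `|E f|) * (4 / 99 * d) * (25 / 24 * P').
  by apply: ler_pM => //; [rewrite mulr_ge0|apply: ler_pM|lra].
apply: le_trans s2 _.
have -> : 2 * `|E f| * (4 / 99 * d) * (25 / 24 * P') = 200 / 2376 * (`|E f| * (d * P')) by field.
have : 0 <= `|E f| * (d * P') by rewrite mulr_ge0 // mulr_ge0.
lra.
Qed.

(** With no root left of the run, the roots separating [i] from [u] are the [u - f] roots of the
    run, an even number. *)
Lemma same_sign : ~~ odd (u - f) -> ~ (exists2 j, j \in inner X & (j < f)%N) ->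
  forall i : 'I_n, (i < f)%N -> i \notin X /\ (g.[tau i] < 0) = (g.[tau u] < 0).
Proof.
move=> ouf none i iff; have un := ltn_ord u.
have iX : i \notin X.
  by apply/negP => iX; apply: none; exists i; rewrite // inE iX; nat_lia.
have uX : u \notin X by rewrite /X inE (negbTE uJ) andbF.
split=> //; have [s sP] := adm_sign ad.
rewrite (sP i iX).2 (sP u uX).2 -/X; congr (_ (+) _).
have -> : [set j in inner X | (i < j)%N] =
    [set j : 'I_n | (f <= j < u)%N] :|: [set j in inner X | (u < j)%N].
  apply/setP => j; rewrite !in_setU [in LHS]inE [X in _ = X || _]inE [X in _ = _ || X]inE.
  apply/andP/orP => [[jX ij]|[jr|/andP[jX uj]]].
  - case: (ltngtP j u) => ju; [left|by right; rewrite jX|].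
      by rewrite ?ju andbT leqNgt; apply/negP => jf; apply: none; exists j.
    by move: jX; rewrite (val_inj ju) !inE; have := uJ; rewrite inE => /negbTE ->; rewrite andbF.
  - split; last by nat_lia.
    have lT : j \in Tt by rewrite -tnE; exact: ft.
    rewrite !inE lT orbT andbT; apply/andP; split; last by nat_lia.
    by apply: contraTneq lT => ->; have -> := disjointFr ZT (adm_b ad).
  by split=> //; nat_lia.
rewrite cardsU (_ : _ :&: _ = set0) ?cards0 ?subn0 ?oddD.
  by rewrite card_ord_range ?(negbTE ouf) // ltnW.
apply/setP => j; rewrite in_setI in_set0 !in_set.
by apply/negP => /andP[h1 /andP[_ h2]]; nat_lia.
Qed.

End Run.

(** After cancellation the last surviving node [u] either dominates all other terms or shares its
    sign with them. That [u] and [z] are chosen before [b] and [g] is what makes different released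
    indices comparable. *)
Lemma sum_sign : exists (u : 'I_n) (z : R), u \notin J /\ forall b g, adm b g ->
  Num.sg (\sum_(i < n | i != b) g.[tau i]) = z * Num.sg g.[tau u].
Proof.
have n0 : (0 < n)%N by nat_lia.
have nS : n = n.-1.+1 by rewrite prednK.
have last_lt : (n.-1 < n)%N by rewrite {2}nS.
pose last := Ordinal last_lt.
have [v0 v0J] : exists v0, v0 \notin J.
  have /subsetPn[v _ vJ] : ~~ ([set: 'I_n] \subset J).
    by apply/negP => /subset_leq_card; rewrite cJ cardsT card_ord; nat_lia.
  by exists v.
have v0T : ~~ tn v0 by rewrite tnE; apply: contra v0J; rewrite inE orbC => ->.
have exl : exists i : nat, ~~ tn i by exists v0.
case: (ex_minnP exl) => l0' l0t l0min.
have l0n : (l0' < n)%N by exact: leq_ltn_trans (l0min _ v0T) (ltn_ord v0).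
pose l0 : 'I_n := Ordinal l0n.
have l0run (j : nat) : (j < l0)%N -> tn j.
  by move=> jl; apply: contraT => /l0min; rewrite leqNgt jl.
have l0par : par l0 = odd l0.
  have [f [fl _ f0 ->]] := run_ex l0.
  case: f0 => [->|]; first by rewrite subn0.
  case: f fl => [|f] fl /=; first by rewrite subn0.
  by rewrite l0run.
(* [O] holds the free nodes left unpaired. If the last node is linked to node 0, a run passes
   through the seam and the pairing started at 0 has to be corrected: [l0] ends the first run, its
   value is that at 0 up to sign, and [xi] gathers both contributions as a multiple of
   [g.[tau 0]]. *)
pose O := [set i : 'I_n | (i \notin J) && ~~ par i].
pose O' := if tn n.-1 then O :\ l0 else O.
pose xi : R := if tn n.-1 then (l0 \in O)%:R - (~~ par n.-1)%:R else 0.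
have O'O : O' \subset O by rewrite /O'; case: ifP => _; rewrite ?subD1set.
have g0E b g : adm b g -> g.[tau 0] = (-1) ^+ l0 * g.[tau l0].
  by move=> ad; rewrite (run_val (f := 0) ad (ltn_ord l0)) ?subn0.
have SE b g : adm b g -> \sum_(i < n | i != b) g.[tau i] =
    \sum_(i in O') g.[tau i] + xi * g.[tau 0].
  move=> ad; have := partial_sum ad (leqnn n).
  have -> : \sum_(i < n | (i < n)%N && (i != b)) g.[tau i] = \sum_(i < n | i != b) g.[tau i].
    by apply: eq_bigl => i; rewrite ltn_ord.
  have -> : \sum_(i < n | (i < n)%N && ((i \notin J) && ~~ par i)) g.[tau i] =
      \sum_(i in O) g.[tau i] by apply: eq_bigl => i; rewrite ltn_ord [RHS]in_set.
  move=> ->; have -> : par n = tn n.-1 && ~~ par n.-1 by rewrite {1}nS.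
  rewrite /O' /xi; case: (boolP (tn n.-1)) => tl /=; last by rewrite mul0r.
  have gl : g.[tau n.-1] = - g.[tau 0].
    have := tl; rewrite (tnP last_lt) => /(adm_T ad).
    by rewrite ordS_last //=.
  have -> : (if ~~ par n.-1 then g.[tau n.-1] else 0) = - (~~ par n.-1)%:R * g.[tau 0].
    by rewrite gl; case: (par _); rewrite /= ?oppr0 ?mul0r ?mulN1r.
  rewrite mulrBl mulNr addrA; congr (_ - _).
  case: (boolP (l0 \in O)) => lO; last first.
    rewrite mul0r addr0; apply: eq_bigl => i; rewrite in_setD1.
    by case: eqP => [->|//]; rewrite (negbTE lO).
  rewrite mul1r (big_setD1 l0 lO) /= addrC; congr (_ + _); rewrite (g0E _ _ ad).
  move: lO; rewrite inE l0par => /andP[_ /negbTE]; rewrite -signr_odd => ->.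
  by rewrite mul1r.
(* If only the correction is left, it is carried by [l0] when the seam is linked and [l0] is free;
   otherwise the sum vanishes and [z = 0]. *)
case: (set_0Vmem O') => [O0|[u0 u0O]].
  case: (boolP (tn n.-1 && (l0 \notin J))) => [/andP[tl lJ]|nl].
    exists l0, (Num.sg (xi * (-1) ^+ l0)); split=> // b g ad.
    by rewrite (SE _ _ ad) O0 big_set0 add0r (g0E _ _ ad) mulrA sgrM.
  exists v0, 0; split=> // b g ad; rewrite mul0r (SE _ _ ad) O0 big_set0 add0r.
  move: nl; rewrite negb_and negbK => /orP[tl|lJ].
    by rewrite /xi (negbTE tl) mul0r sgr0.
  case: (boolP (tn n.-1)) => tl; last by rewrite /xi (negbTE tl) mul0r sgr0.
  rewrite (g0E _ _ ad) (_ : g.[tau l0] = 0) ?mulr0 ?sgr0 //.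
  apply: (adm_Z ad).
    by move: lJ; rewrite inE -tnE (negbTE l0t) orbF.
  case: (posnP l0) => l00.
    have := tl; rewrite (tnP last_lt) => /(adm_bS ad); apply: contra => /eqP <-.
    by apply/eqP/val_inj; rewrite /= prednK // modnn; exact/esym/l00.
  have ln : (l0.-1 < n)%N by exact: leq_ltn_trans (leq_pred _) (ltn_ord l0).
  have : tn l0.-1 by apply: l0run; rewrite prednK.
  rewrite (tnP ln) => /(adm_bS ad); apply: contra => /eqP <-.
  by apply/eqP/val_inj; rewrite /= prednK // modn_small.
case: (@arg_maxnP _ u0 (mem O') (fun i : 'I_n => i : nat) u0O) => u /= uO umax.
have uO2 := subsetP O'O u uO; move: (uO2); rewrite inE => /andP[uJ pu].
exists u, 1; split=> // b g ad; rewrite mul1r (SE _ _ ad) (big_setD1 u uO) /= -addrA.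
have gu := gu_neq0 ad uJ.
have tu : ~~ tn u by rewrite tnE; apply: contra uJ; rewrite inE orbC => ->.
have [f [fu ft f0 pf]] := run_ex u; rewrite pf in pu.
have lt_u (i : 'I_n) : i \in O' :\ u -> (i < u)%N.
  rewrite in_setD1 => /andP[iu iO]; rewrite ltn_neqAle umax // andbT.
  by apply: contra iu => /eqP/val_inj ->.
have nt (i : 'I_n) : i \in O' -> ~~ tn i.
  move=> /(subsetP O'O); rewrite inE => /andP[iJ _]; rewrite tnE.
  by apply: contra iJ; rewrite inE orbC => ->.
case: (posnP f) => [f00|f_gt0].
  have nl : ~~ tn n.-1.
    apply/negP => tl; move: uO; rewrite /O' tl in_setD1 => /andP[/eqP ul _]; apply: ul.
    apply: val_inj => /=; apply/eqP; rewrite eqn_leq l0min // andbT leqNgt.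
    by apply/negP => lu; have := ft l0'; rewrite f00 lu (negbTE l0t) => /(_ isT).
  rewrite /xi (negbTE nl) mul0r addr0 big1 ?addr0 // => i iO.
  have := ft i; rewrite f00 lt_u //= => /(_ isT).
  by move: iO; rewrite in_setD1 => /andP[_ /nt/negbTE ->].
have tf : ~~ tn f.-1 by case: f0 => [e|//]; rewrite e in f_gt0.
have lt_f (i : 'I_n) : i \in O' :\ u -> (i < f)%N.
  move=> iO; rewrite ltnNge; apply/negP => fi; have := ft i; rewrite fi lt_u //= => /(_ isT).
  by move: iO; rewrite in_setD1 => /andP[_ /nt/negbTE ->].
have xi1 : `|xi| <= 1.
  rewrite /xi; case: ifP => _; rewrite ?normr0 //.
  by case: (_ \in _); case: (par _); rewrite /= ?subr0 ?sub0r ?subrr ?normrN ?normr0 ?normr1.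
have [rho [E [rP gE EE]]] := adm_shape ad.
apply: sgr_add => //.
case: (pselect (exists2 j, j \in inner (J :\ b) & (j < f)%N)) => [roots|none].
  left; have dom := dominate ad uJ fu ft rP gE EE f_gt0 tf roots.
  have n1 : 0 < n%:R :> R by rewrite ltr0n.
  have n2 : 1 <= n%:R :> R by rewrite ler1n.
  pose ep := `|g.[tau u]| / (4 * n%:R).
  have dom' (i : nat) : (i < f)%N -> `|g.[tau i]| <= ep.
    by move=> iff; rewrite /ep ler_pdivlMr ?dom // mulr_gt0.
  have ep0 : 0 < ep by rewrite /ep divr_gt0 ?normr_gt0 // mulr_gt0.
  apply: le_lt_trans (ler_normD _ _) _.
  have s1 : `|\sum_(i in O' :\ u) g.[tau i]| <= n%:R * ep.
    apply: le_trans (ler_norm_sum _ _ _) _.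
    apply: (@le_trans _ _ (\sum_(i in O' :\ u) ep)).
      by apply: ler_sum => i iO; apply: dom'; exact: lt_f.
    rewrite sumr_const -[X in X <= _]mulr_natl; apply: ler_wpM2r; first exact: ltW.
    by rewrite ler_nat -[X in (_ <= X)%N](card_ord n) max_card.
  have s2 : `|xi * g.[tau 0]| <= ep.
    rewrite normrM -[ep]mul1r; apply: ler_pM => //; exact: dom'.
  have -> : `|g.[tau u]| = 4 * n%:R * ep.
    by rewrite /ep mulrC divfK // gt_eqF // mulr_gt0.
  have : ep <= n%:R * ep by rewrite -[X in X <= _]mul1r ler_wpM2r // ltW.
  have : 0 < n%:R * ep by rewrite mulr_gt0.
  lra.
right; have ss := same_sign ad uJ fu ft pu none.
have zero_lt : (0 < n)%N by [].
(* When the seam is linked, node 0 is not [b], being the end of a link, and the absence of roots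
   keeps it out of [J]. So [l0 = 0] is free and unpaired, and the correction is not negative. *)
have xi_ge : 0 <= xi /\ (0 < xi -> tn n.-1).
  rewrite /xi; case: (boolP (tn n.-1)) => tl //; last by split=> //; rewrite ltxx.
  split=> //; suff -> : l0 \in O by case: (par _); rewrite /= ?subr0 ?subrr.
  have [zX _] := ss (Ordinal zero_lt) f_gt0.
  have z0 : l0 = 0%N :> nat.
    apply/eqP; rewrite -leqn0; apply: l0min; apply: contra zX => tz.
    rewrite in_setD1; have zT : Ordinal zero_lt \in Tt by rewrite -tnE.
    rewrite inE zT orbT andbT; apply: contraTneq zT => ->.
    by have -> := disjointFr ZT (adm_b ad).
  rewrite inE l0par z0 /= andbT; apply: contra zX => lJ.
  have lz : l0 = Ordinal zero_lt by apply: val_inj.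
  rewrite -lz in_setD1 lJ andbT.
  have := tl; rewrite (tnP last_lt) => /(adm_bS ad); apply: contra => /eqP <-.
  by apply/eqP/val_inj; rewrite /= prednK // modnn; exact/esym/z0.
have g0s : (g.[tau 0] < 0) = (g.[tau u] < 0) by have [_] := ss (Ordinal zero_lt) f_gt0.
split=> hu.
  have : \sum_(i in O' :\ u) g.[tau i] <= 0.
    by apply: sumr_le0 => i iO; have [_] := ss i (lt_f i iO); rewrite hu => /ltW.
  have : xi * g.[tau 0] <= 0.
    by apply: mulr_ge0_le0; [exact: xi_ge.1|rewrite ltW // g0s].
  lra.
have hu' : (g.[tau u] < 0) = false by rewrite lt_gtF.
have : 0 <= \sum_(i in O' :\ u) g.[tau i].
  by apply: sumr_ge0 => i iO; have [_] := ss i (lt_f i iO); rewrite hu' leNgt => ->.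
have : 0 <= xi * g.[tau 0].
  by apply: mulr_ge0; [exact: xi_ge.1|rewrite leNgt g0s hu'].
lra.
Qed.

End Sum.

(** * Nonpositive entries of a facet normal *)

(** Counting a constrained last node among the roots raises the count at every [i] outside [X] by
    one, which is absorbed into [s]. *)
Lemma constrained_parity (R : rcfType) (n k : nat) (X : {set 'I_n}) (g : {poly R}) :
  (0 < k)%N -> (2 * k < n)%N -> (#|X| = (2 * k).-2)%N -> g != 0 ->
  (size g <= (2 * k).-1)%N -> constrained X g ->
  exists s : bool, forall i : 'I_n, i \notin X -> g.[tau R n i] != 0 /\
  (g.[tau R n i] < 0) = s (+) odd #|[set j in X | (i < j)%N]|.
Proof.
move=> k0 kn cX g0 sg cg; have [s sP] := constrained_sign k0 kn cX g0 sg cg.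
exists (s (+) [exists j in X, j.+1 == n]) => i iX; have [h1 h2] := sP i iX; split=> //.
rewrite h2 -addbA; congr (_ (+) _).
case: (boolP [exists j in X, j.+1 == n]) => [/exists_inP[l lX /eqP ln]|/exists_inPn nx].
  have il : (i < l)%N.
    have : (i <= l)%N by have := ltn_ord i; nat_lia.
    rewrite leq_eqVlt => /orP[/eqP/val_inj il|//]; by rewrite il lX in iX.
  have -> : #|[set j in X | (i < j)%N]| = #|[set j in inner X | (i < j)%N]|.+1.
    rewrite (cardsD1 l) inE lX il add1n; congr _.+1.
    apply: eq_card => j; rewrite !inE -(inj_eq val_inj) /=.
    by have := ltn_ord j; case: (_ \in _); rewrite /= ?andbF //; nat_lia.
  by rewrite /= negbK.
congr odd; apply: eq_card => j; rewrite !inE.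
case: (boolP (j \in X)) => //= jX; have := nx j jX; have := ltn_ord j; nat_lia.
Qed.

Lemma card_same_parity (n : nat) (J B : {set 'I_n}) (q : bool) : B \subset J ->
  {in B, forall b : 'I_n, odd #|[set j in J | (b < j)%N]| = q} -> (#|B| <= uphalf #|J|)%N.
Proof.
move=> BJ par; pose r (b : 'I_n) := #|[set j in J | (b < j)%N]|.
have r_lt b : b \in J -> (r b < #|J|)%N.
  move=> bJ; rewrite /r; apply: proper_card; rewrite properE; apply/andP; split.
    by apply/subsetP => j; rewrite inE => /andP[].
  by apply/subsetPn; exists b => //; rewrite inE ltnn andbF.
have r_mono (b b' : 'I_n) : b' \in J -> (b < b')%N -> (r b' < r b)%N.
  move=> b'J bb'; apply: proper_card; rewrite properE; apply/andP; split.
    by apply/subsetP => j; rewrite !inE => /andP[-> h] /=; exact: ltn_trans h.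
  by apply/subsetPn; exists b'; rewrite !inE ?b'J ?bb' // ltnn andbF.
have r_inj : {in B &, injective r}.
  move=> b b' bB b'B e; apply: val_inj => /=.
  case: (ltngtP b b') => // h.
    by have := r_mono b b' (subsetP BJ _ b'B) h; rewrite e ltnn.
  by have := r_mono b' b (subsetP BJ _ bB) h; rewrite e ltnn.
rewrite cardE -(size_map (fun b => (r b)./2)) -[X in (_ <= X)%N](size_iota 0).
apply: uniq_leq_size.
  rewrite map_inj_in_uniq ?enum_uniq // => b b'; rewrite !mem_enum => bB b'B e.
  apply: r_inj => //; rewrite -(odd_double_half (r b)) -(odd_double_half (r b')) e.
  by have := par b bB; have := par b' b'B; rewrite /r => -> ->.
move=> x /mapP[b bB ->]; rewrite mem_iota add0n /=; rewrite mem_enum in bB.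
have := r_lt b (subsetP BJ _ bB); rewrite uphalf_half; move: (r b) #|J| => y z; nat_lia.
Qed.

(** The solutions of an integral system are spanned by rational ones, whose denominators can be
    cleared. This passes from integral perturbations, to which the decomposition into stable sets
    applies, to real ones. *)
Lemma integer_kernel (R : realFieldType) (n : nat) (I : finType) (L : I -> 'I_n -> int)
    (c : 'I_n -> R) :
  (forall g : 'I_n -> int, (forall l, \sum_i g i * L l i = 0) ->
     \sum_i c i * (g i)%:~R = 0) ->
  forall g : 'I_n -> R, (forall l, \sum_i g i * (L l i)%:~R = 0) -> \sum_i c i * g i = 0.
Proof.
move=> hint g hg.
pose B : 'M[rat]_(n, #|I|) := \matrix_(i, l) (L (enum_val l) i)%:~R.
pose gr : 'rV[R]_n := \row_i g i; pose cc : 'cV[R]_n := \col_i c i.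
have gB : gr *m map_mx ratr B = 0.
  apply/rowP => l; rewrite !mxE -[RHS](hg (enum_val l)); apply: eq_bigr => i _.
  by rewrite !mxE ratr_int.
have /submxP[w gw] : (gr <= map_mx ratr (kermx B))%MS by rewrite map_kermx; apply/sub_kermxP.
have KC : map_mx ratr (kermx B) *m cc = 0.
  apply/matrixP => m j; rewrite !mxE.
  pose q i : rat := kermx B m i; pose D : int := \prod_i denq (q i).
  pose z i : int := numq (q i) * \prod_(l | l != i) denq (q l).
  have zq i : (z i)%:~R = D%:~R * q i :> rat.
    rewrite /D (bigD1 i) //= /z !intrM numqE; ring.
  have D0 : D%:~R != 0 :> rat.
    by rewrite intr_eq0; apply/prodf_neq0 => i _; rewrite denq_eq0.
  have : \sum_i c i * (z i)%:~R = 0.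
    apply: hint => l; apply: (@intr_inj rat); rewrite rmorph_sum /=.
    have /matrixP/(_ m (enum_rank l)) := mulmx_ker B; rewrite !mxE => e.
    transitivity (D%:~R * \sum_j kermx B m j * B j (enum_rank l)); last by rewrite e mulr0.
    rewrite mulr_sumr; apply: eq_bigr => i _.
    by rewrite intrM zq [B _ _]mxE enum_rankK mulrA.
  have zR i : (z i)%:~R = ratr D%:~R * ratr (q i) :> R by rewrite -rmorphM /= -zq ratr_int.
  under eq_bigr => i _ do rewrite zR mulrCA.
  rewrite -mulr_sumr => /eqP; rewrite mulf_eq0 fmorph_eq0 (negbTE D0) /= => /eqP e.
  by rewrite -[RHS]e; apply: eq_bigr => i _; rewrite [_ m i]mxE [cc _ _]mxE mulrC.
have : (gr *m cc) 0 0 = 0 by rewrite gw -mulmxA KC mulmx0 mxE.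
by rewrite mxE => e; rewrite -[RHS]e; apply: eq_bigr => i _; rewrite !mxE mulrC.
Qed.

Lemma iter_ordS (n : nat) (i j : 'I_n) : exists m, iter m (@ordS n) i = j.
Proof.
exists (j + (n - i))%N; apply: val_inj.
have e m : iter m (@ordS n) i = ((i + m) %% n)%N :> nat.
  elim: m => [|m IH]; first by rewrite addn0 modn_small.
  by rewrite iterS /= IH -addn1 modnDml addn1 addnS.
have := ltn_ord i; have := ltn_ord j; rewrite /= e => jn ni.
by rewrite addnCA subnKC ?(ltnW ni) // modnDr modn_small.
Qed.

(** * Active inequalities at the barycentre of the sets of weight 1 *)

Section Rigid.
Variables (R : rcfType) (n k : nat).
Hypotheses (k_gt0 : (0 < k)%N) (kn : (2 * k < n)%N).
Variable c : 'I_n -> R.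
Implicit Types (A : {set 'I_n}) (i j : 'I_n).
Notation orth := (@orth R n k).
Notation tau := (@tau R n).
Hypotheses (oc : orth c) (c_neq0 : exists i, c i != 0).
Hypothesis cA : forall A, stable A -> #|A| = k -> weight c A <= 1.
Hypothesis rigid : forall d, orth d ->
  (forall A, stable A -> #|A| = k -> weight c A = 1 -> weight d A = 0) -> forall i, d i = 0.

Definition extremal := [set A | [&& stable A, #|A| == k & weight c A == 1]].
(** Divided by [T], this is the barycentre of the incidence vectors of the sets of weight 1. An
    inequality valid for stable sets is active there exactly if it is active at each of them. *)
Definition mult i := #|[set A in extremal | i \in A]|.
Notation T := #|extremal|.

Lemma extremalP A : A \in extremal -> [/\ stable A, #|A| = k & weight c A = 1].
Proof. by rewrite inE => /and3P[? /eqP ? /eqP ?]. Qed.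

Lemma extremal_gt0 : (0 < T)%N.
Proof.
rewrite card_gt0; apply/eqP => e; have [i /eqP[]] := c_neq0.
apply: rigid => // A sA kA wA; have := in_set0 A.
by rewrite -e inE sA kA wA !eqxx.
Qed.

Lemma mult_adj i : (mult i + mult (ordS i) <= T)%N.
Proof.
rewrite /mult -cardsUI (_ : _ :&: _ = set0) ?cards0 ?addn0.
  by apply: subset_leq_card; apply/subsetP => A; rewrite !in_setU !inE => /orP[]/andP[].
apply/setP => A; rewrite !inE; apply/negP => /andP[/andP[/and3P[sA _ _] iA] /andP[_ SA]].
by have /stableP/(_ i iA) := sA; rewrite SA.
Qed.

Lemma mult_leT i : (mult i <= T)%N.
Proof. by apply: leq_trans (mult_adj i); rewrite leq_addr. Qed.

Lemma mult_eqT i A : mult i = T -> A \in extremal -> i \in A.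
Proof.
move=> iT AE; have : [set A in extremal | i \in A] == extremal.
  rewrite eqEcard; apply/andP; split; last by rewrite -iT.
  by apply/subsetP => B; rewrite !inE => /andP[].
by move=> /eqP e; move: AE; rewrite -{1}e inE => /andP[].
Qed.

Lemma mult_eq0 i A : mult i = 0%N -> A \in extremal -> i \notin A.
Proof.
move=> /cards0_eq e AE; apply/negP => iA.
by have := in_set0 A; rewrite -e inE AE iA.
Qed.

Lemma mult_tight i A : (mult i + mult (ordS i) = T)%N -> A \in extremal ->
  ((i \in A) + (ordS i \in A) = 1)%N.
Proof.
move=> e AE; have [sA _ _] := extremalP AE.
case: (boolP (i \in A)) => iA; first by rewrite (negbTE (stableP _ sA i iA)).
case: (boolP (ordS i \in A)) => //= SA; move: e; rewrite /mult -cardsUI.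
rewrite (_ : _ :&: _ = set0) ?cards0 ?addn0; last first.
  apply/setP => B; rewrite !inE; apply/negP => /andP[/andP[/and3P[sB _ _] iB] /andP[_ SB]].
  by have /stableP/(_ i iB) := sB; rewrite SB.
move=> e; have : #|extremal :\ A| = T.
  apply/eqP; rewrite eqn_leq subset_leq_card ?subD1set //= -{1}e subset_leq_card //.
  apply/subsetP => B; rewrite in_setU in_setD1 !in_set => /orP[]/andP[-> h]; rewrite andbT;
    by apply: contraTneq h => ->.
by have := cardsD1 A extremal; rewrite AE => ->; move: #|_ :\ _| => x; nat_lia.
Qed.

Lemma sum_mult : (\sum_i mult i = k * T)%N.
Proof.
rewrite /mult; under eq_bigr => i _ do rewrite -sum1_card big_mkcond.
rewrite exchange_big /= (bigID (mem extremal)) /= addnC big1 ?add0n.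
  rewrite mulnC -sum_nat_const; apply: eq_bigr => A AE.
  have [_ <- _] := extremalP AE; rewrite -sum1_card [RHS]big_mkcond /=; apply: eq_bigr => i _.
  by rewrite inE AE.
move=> A AE; apply: big1 => i _; by rewrite inE (negbTE AE).
Qed.

Lemma weight_mult : \sum_i c i * (mult i)%:R = T%:R.
Proof.
have -> : \sum_i c i * (mult i)%:R = \sum_(A in extremal) weight c A.
  rewrite /mult; under eq_bigr => i _ do rewrite -sum1_card natr_sum mulr_sumr big_mkcond.
  rewrite exchange_big /= [RHS]big_mkcond /=; apply: eq_bigr => A _.
  case: (boolP (A \in extremal)) => AE; last first.
    by apply: big1 => i _; rewrite inE (negbTE AE).
  rewrite /weight [RHS]big_mkcond /=; apply: eq_bigr => i _; rewrite inE AE /=.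
  by rewrite mulr1.
rewrite -sumr_const; apply: eq_bigr => A AE; by have [_ _ ->] := extremalP AE.
Qed.

Lemma mult_pos i : (0 < mult i)%N -> 0 < c i.
Proof.
rewrite card_gt0 => /set0Pn[A]; rewrite in_set => /andP[AE iA].
have [sA kA wA] := extremalP AE.
apply: (max_pos sA kA _ _ iA); first exact: card_starts.
by move=> B sB kB; rewrite wA; exact: cA.
Qed.

Definition fixset := [set i | (mult i == 0%N) || (mult i == T)].
(** Edge inequalities active at the barycentre. Those joining [mult] 0 to [mult] [T] are left out,
    as the bounds recorded in [fixset] already imply them. *)
Definition links := [set i | [&& (0 < mult i)%N, (mult i < T)%N & (mult i + mult (ordS i) == T)%N]].
Definition tightset := fixset :|: links.

Lemma links_fix i : i \in links -> i \notin fixset.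
Proof. by rewrite !inE => /and3P[h1 h2 _]; rewrite negb_or; move: h1 h2; nat_lia. Qed.

Lemma links_succ i : i \in links -> ordS i \notin fixset.
Proof.
rewrite !inE => /and3P[h1 h2 /eqP h3]; rewrite negb_or.
by move: (mult i) (mult (ordS i)) T h1 h2 h3 => x y z; nat_lia.
Qed.

Lemma nonpos_fix i : c i <= 0 -> i \in fixset.
Proof.
by move=> ci; rewrite inE; case: (posnP (mult i)) => [//|/mult_pos]; rewrite ltNge ci.
Qed.

(** The linear form of the active inequality attached to [i]; [comb] is the transpose of this
    map. *)
Definition kap (S : zmodType) (g : 'I_n -> S) i : S :=
  if i \in links then g i + g (ordS i) else g i.
Definition comb (y : 'I_n -> R) i : R :=
  y i + (if ord_pred i \in links then y (ord_pred i) else 0).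

Lemma comb_kap (y g : 'I_n -> R) : \sum_i comb y i * g i = \sum_i y i * kap g i.
Proof.
rewrite /comb /kap; under eq_bigr => i _ do rewrite mulrDl.
rewrite big_split /= [X in _ + X = _](reindex_inj (@ordS_inj n)) /= -big_split /=.
apply: eq_bigr => i _; rewrite ordSK; case: ifP => _; first by rewrite mulrDr.
by rewrite mul0r addr0.
Qed.

(** A large multiple of the barycentre can be moved by [g] and remain a fractional stable set,
    because [g] is tangent to all active inequalities. The moved point obeys [fractional_weight],
    while the barycentre already attains that bound. *)
Lemma integral_balance (g : 'I_n -> int) : (forall j, j \in tightset -> kap g j = 0) ->
  \sum_i g i = 0 -> \sum_i c i * (g i)%:~R <= 0.
Proof.
(* [Q] exceeds twice every absolute value of [g], so the slack of at least [Q] in an inactive edge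
   inequality absorbs two entries of [g]. *)
move=> gk gs; pose Q := ((\sum_i absz (g i)) * 2).+1.
have gQ i : (absz (g i) * 2 < Q)%N by rewrite ltnS leq_mul2r (bigD1 i) //= leq_addr.
have g0 i : mult i = 0%N -> g i = 0.
  move=> m0; have iF : i \in fixset by rewrite inE m0.
  have := gk i; rewrite in_setU iF /kap => /(_ isT).
  by case: ifP => // /links_fix; rewrite iF.
have gT i : mult i = T -> g i = 0.
  move=> mT; have iF : i \in fixset by rewrite inE mT eqxx orbT.
  have := gk i; rewrite in_setU iF /kap => /(_ isT).
  by case: ifP => // /links_fix; rewrite iF.
have Q0 : (0 < Q)%N by [].
clearbody Q; pose h i := absz (Q%:Z * (mult i)%:Z + g i).
have hE i : (h i)%:Z = Q%:Z * (mult i)%:Z + g i.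
  rewrite /h gez0_abs //; have [m0|m0] := posnP (mult i); first by rewrite m0 g0 // mulr0.
  have : (Q <= Q * mult i)%N by rewrite leq_pmulr.
  by have := gQ i; rewrite -PoszM; move: (Q * mult i)%N (g i) => x y; nat_lia.
have hadj i : (h i + h (ordS i) <= Q * T)%N.
  rewrite -lez_nat !PoszD !hE addrACA -mulrDr -PoszD.
  have := mult_adj i; rewrite leq_eqVlt => /orP[/eqP e|lt].
    rewrite e -PoszM gerDl.
    have [m0|m0] := posnP (mult i).
      by rewrite g0 // gT ?addr0 // -e m0.
    have [m1|m1] := ltnP (mult i) T; last first.
      have mT : mult i = T by apply/eqP; rewrite eqn_leq mult_leT.
      rewrite gT // add0r g0 //; move: e; rewrite mT; move: (mult (ordS i)) T => x y; nat_lia.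
    have iL : i \in links by rewrite inE m0 m1 e eqxx.
    by have := gk i; rewrite in_setU iL orbT /kap iL => -> //.
  have := gQ i; have := gQ (ordS i).
  have : (Q * (mult i + mult (ordS i)).+1 <= Q * T)%N by rewrite leq_mul2l lt orbT.
  rewrite mulnS -!PoszM; move: (Q * T)%N (Q * (mult i + mult (ordS i)))%N (g i) (g (ordS i)).
  by move=> x1 x2 x3 x4 h1 h2 h3; nat_lia.
have hsum : (\sum_i h i = k * (Q * T))%N.
  apply/eqP; rewrite -eqz_nat; apply/eqP.
  have -> : Posz (\sum_i h i) = \sum_i (h i)%:Z by rewrite (big_morph Posz PoszD (erefl (Posz 0))).
  under eq_bigr => i _ do rewrite hE.
  rewrite big_split /= gs addr0 -mulr_sumr.
  have -> : \sum_i (mult i)%:Z = Posz (\sum_i mult i) by rewrite (big_morph Posz PoszD (erefl (Posz 0))).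
  by rewrite sum_mult -PoszM mulnCA.
have QT : (0 < Q * T)%N by rewrite muln_gt0 Q0 extremal_gt0.
have := fractional_weight k_gt0 kn QT hadj hsum cA.
have -> : \sum_i c i * (h i)%:R = Q%:R * (\sum_i c i * (mult i)%:R) + \sum_i c i * (g i)%:~R.
  rewrite mulr_sumr -big_split /=; apply: eq_bigr => i _.
  have -> : (h i)%:R = ((h i)%:Z)%:~R :> R by rewrite pmulrn.
  by rewrite hE rmorphD rmorphM /= -!pmulrn mulrDr mulrCA.
by rewrite weight_mult -natrM gerDl.
Qed.

Lemma balance (g : 'I_n -> R) : (forall j, j \in tightset -> kap g j = 0) ->
  \sum_i g i = 0 -> \sum_i c i * g i = 0.
Proof.
pose L (l : option 'I_n) (i : 'I_n) : int :=
  if l is Some j then (if j \in tightset then (i == j)%:R + (if j \in links then (i == ordS j)%:R else 0) else 0)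
  else 1.
have LE (S : comNzRingType) (g' : 'I_n -> S) l : \sum_i g' i * (L l i)%:~R =
    if l is Some j then (if j \in tightset then kap g' j else 0) else \sum_i g' i.
  have sel j : \sum_i g' i * ((i == j)%:R : int)%:~R = g' j.
    rewrite (bigD1 j) //= eqxx mulr1 big1 ?addr0 // => i /negbTE ->.
    by rewrite mulr0.
  case: l => [j|] /=; last by apply: eq_bigr => i _; rewrite mulr1.
  case: ifP => _; last by rewrite big1 // => i _; rewrite mulr0.
  rewrite /kap; under eq_bigr => i _ do rewrite rmorphD mulrDr.
  rewrite big_split /= sel; case: ifP => _; first by rewrite sel.
  by rewrite big1 ?addr0 // => i _; rewrite mulr0.
move=> gk gs; apply: (@integer_kernel R n _ L); last first.
  by move=> l; rewrite LE; case: l => [j|//]; case: ifP => // /gk.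
move=> z hz; have zk j : j \in tightset -> kap z j = 0.
  move=> jT; have := LE _ z (Some j); rewrite jT => <-; rewrite -[RHS](hz (Some j)).
  by apply: eq_bigr => i _; rewrite intz.
have zs : \sum_i z i = 0.
  rewrite -(LE _ z None) -[RHS](hz None).
  by apply: eq_bigr => i _; rewrite intz.
apply/eqP; rewrite eq_le integral_balance //=.
have := @integral_balance (fun i => - z i); rewrite sumrN zs oppr0.
have -> : \sum_i c i * (- z i)%:~R = - \sum_i c i * (z i)%:~R.
  by rewrite -sumrN; apply: eq_bigr => i _; rewrite rmorphN mulrN.
rewrite oppr_le0 => -> // j /zk; rewrite /kap; case: ifP => _ e; last by rewrite e oppr0.
by rewrite -opprD e oppr0.
Qed.

(** The Lagrange multiplier of the cardinality constraint: modulo the active forms, [c] is a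
    multiple of the all-ones vector. *)
Lemma multiplier : exists lam, forall g : 'I_n -> R,
  (forall j, j \in tightset -> kap g j = 0) -> \sum_i c i * g i = lam * \sum_i g i.
Proof.
case: (pselect (exists2 g1 : 'I_n -> R, (forall j, j \in tightset -> kap g1 j = 0) &
    \sum_i g1 i != 0)) => [[g1 k1 s1]|none]; last first.
  exists 0 => g gk; rewrite mul0r; apply: balance => //; apply/eqP; apply: contraT => s.
  by case: none; exists g.
exists ((\sum_i c i * g1 i) / \sum_i g1 i) => g gk.
pose t := (\sum_i g i) / \sum_i g1 i.
have : \sum_i c i * (g i - t * g1 i) = 0.
  apply: balance.
    move=> j jT; have := gk j jT; have := k1 j jT; rewrite /kap; case: ifP => _ e1 e2.
      have -> : g j - t * g1 j + (g (ordS j) - t * g1 (ordS j)) =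
        (g j + g (ordS j)) - t * (g1 j + g1 (ordS j)) by ring.
      by rewrite e1 e2 mulr0 subr0.
    by rewrite e1 e2 mulr0 subr0.
  by rewrite sumrB -mulr_sumr /t divfK // subrr.
have -> : \sum_i c i * (g i - t * g1 i) = \sum_i c i * g i - t * \sum_i c i * g1 i.
  rewrite mulr_sumr -sumrB; apply: eq_bigr => i _; ring.
by move=> /eqP; rewrite subr_eq0 => /eqP ->; rewrite /t mulrAC [RHS]mulrAC [X in X / _]mulrC.
Qed.

(** If every index were a link, summing round the cycle would give [2 * k * T = n * T]. *)
Lemma nonlink_ex : exists i, i \notin links.
Proof.
case: (pselect (exists i, i \notin links)) => // none.
have all i : (mult i + mult (ordS i) = T)%N.
  have : i \in links by apply: contraT => h; case: none; exists i.
  by rewrite inE => /and3P[_ _ /eqP].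
have : (\sum_i (mult i + mult (ordS i)) = n * T)%N.
  by under eq_bigr => i _ do rewrite all; rewrite sum_nat_const card_ord.
have eS : (\sum_i mult (ordS i) = \sum_i mult i)%N by rewrite [RHS](reindex_inj (@ordS_inj n)).
rewrite big_split /= eS sum_mult => e.
have : (2 * k * T = n * T)%N by rewrite -e addnn -mul2n mulnA.
move/eqP; rewrite eqn_pmul2r ?extremal_gt0 // => /eqP; nat_lia.
Qed.

(** A nonzero coefficient can only be cancelled by the next one along a link, so nonvanishing would
    spread round the whole cycle, which [nonlink_ex] interrupts. *)
Lemma comb_eq0 (y : 'I_n -> R) : (forall j, j \notin tightset -> y j = 0) ->
  (forall i, comb y i = 0) -> forall i, y i = 0.
Proof.
move=> yJ y0 i; apply/eqP; apply: contraT => yi.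
have step j : y j != 0 -> (j \in links) && (y (ordS j) != 0).
  move=> yj; have jJ : j \in tightset by apply: contraT => /yJ e; rewrite e eqxx in yj.
  have jL : j \in links.
    apply: contraT => jL; have jF : j \in fixset.
      by move: jJ; rewrite in_setU (negbTE jL) orbF.
    have := y0 j; rewrite /comb; case: ifP => [/links_succ|_]; first by rewrite ord_predK jF.
    by rewrite addr0 => e; rewrite e eqxx in yj.
  rewrite jL /=; have := y0 (ordS j); rewrite /comb ordSK jL => e.
  by apply: contra yj => /eqP e'; move: e; rewrite e' add0r => ->.
have [i0 i0L] := nonlink_ex; have [m e] := iter_ordS i i0.
have all p : y (iter p (@ordS n) i) != 0.
  by elim: p => [//|p IH]; rewrite iterS; have /andP[] := step _ IH.
by have /andP[] := step _ (all m); rewrite e (negbTE i0L).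
Qed.

(** Orthogonality costs [2k - 1] equations and vanishing on the sets of weight 1 only one more,
    because each active form, like [c], is constant on these sets. A combination satisfying all [2k]
    equations is zero by rigidity. [None] stands for [c]. *)
Lemma tight_dependency (A : {set option 'I_n}) : (2 * k < #|A|)%N ->
  (forall j, Some j \in A -> j \in tightset) ->
  exists al : option 'I_n -> R, [/\ exists2 v, v \in A & al v != 0,
    forall v, v \notin A -> al v = 0 &
    forall i, comb (fun j => al (Some j)) i + al None * c i = 0].
Proof.
move=> cardA AJ.
pose w (v : option 'I_n) (m : nat) : R :=
  if (m < (2 * k).-1)%N then
    (if v is Some j then kap (fun i => tau i ^+ m) j else 0)
  else if v is Some j then (mult j != 0%N)%:R else 1.
have [al [al1 al2 al3]] := dependency_ex w cardA; exists al; split=> //.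
pose y j := al (Some j).
have yJ j : j \notin tightset -> y j = 0.
  by move=> jT; apply: al2; apply: contra jT; exact: AJ.
have opt (F : option 'I_n -> R) : \sum_v F v = F None + \sum_j F (Some j).
  rewrite (bigD1 None) //=; congr (_ + _).
  rewrite (reindex_omap Some id) /=; last by case.
  by apply: eq_bigl => j; rewrite eqxx.
have al3' m : (m < 2 * k)%N -> al None * w None m + \sum_j y j * w (Some j) m = 0.
  by move=> mk; rewrite -[RHS](al3 m mk) opt.
apply: rigid.
  move=> p sp; under eq_bigr => i _ do rewrite mulrDl -mulrA.
  rewrite big_split /= -mulr_sumr oc // mulr0 addr0 comb_kap.
  have -> : \sum_j y j * kap (fun i => p.[tau i]) j =
      \sum_(m < (2 * k).-1) p`_m * \sum_j y j * w (Some j) m.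
    under [RHS]eq_bigr => m _ do rewrite mulr_sumr.
    rewrite exchange_big /=; apply: eq_bigr => j _.
    have ps i : p.[tau i] = \sum_(m < (2 * k).-1) p`_m * tau i ^+ m.
      exact: horner_coef_wide.
    rewrite /kap; case: ifP => jL.
      rewrite !ps -big_split /= mulr_sumr; apply: eq_bigr => m _.
      by rewrite /w ltn_ord /kap jL; ring.
    rewrite ps mulr_sumr; apply: eq_bigr => m _; rewrite /w ltn_ord /kap jL; ring.
  apply: big1 => m _; have := al3' m; rewrite {1}/w ltn_ord mulr0 add0r => ->; rewrite ?mulr0 //.
  by have := ltn_ord m; nat_lia.
move=> B sB kB wB; have BE : B \in extremal by rewrite inE sB kB wB !eqxx.
have -> : weight (fun i => comb y i + al None * c i) B =
    \sum_i comb y i * (i \in B)%:R + al None * weight c B.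
  rewrite /weight big_split /= -mulr_sumr; congr (_ + _).
  rewrite big_mkcond /=; apply: eq_bigr => i _; case: (i \in B); rewrite ?mulr1 ?mulr0 //.
rewrite wB mulr1 comb_kap addrC.
have k1 : ((2 * k).-1 < 2 * k)%N by nat_lia.
rewrite -[RHS](al3' _ k1) /w ltnn mulr1; congr (_ + _); apply: eq_bigr => j _.
case: (boolP (j \in tightset)) => [jT|/yJ ->]; last by rewrite !mul0r.
congr (_ * _); move: jT; rewrite in_setU /kap; case: (boolP (j \in links)) => jL.
  move=> _; move: jL; rewrite inE => /and3P[m0 _ /eqP e].
  by rewrite -natrD (mult_tight e BE) -lt0n m0.
rewrite orbF inE => /orP[]/eqP e; first by rewrite e eqxx (negbTE (mult_eq0 e BE)).
by rewrite (mult_eqT e BE) e -lt0n extremal_gt0.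
Qed.

Lemma card_Some (J : {set 'I_n}) : #|[set Some j | j in J]| = #|J|.
Proof. by apply: card_imset; exact: Some_inj. Qed.

Lemma card_tightset : (#|tightset| <= 2 * k)%N.
Proof.
rewrite leqNgt; apply/negP => big; pose A := [set Some j | j in tightset].
have [||al [[v vA alv] al0 e]] := @tight_dependency A; first by rewrite card_Some.
  by move=> j; rewrite (mem_imset _ _ Some_inj).
have aN : al None = 0 by apply: al0; apply/imsetP => -[].
have y0 := @comb_eq0 (fun j => al (Some j)).
case/eqP: alv; case: v vA => [j _|]; last by move=> _; exact: aN.
apply: (y0 _ _ j).
  by move=> l lT; apply: al0; rewrite (mem_imset _ _ Some_inj).
by move=> i; have := e i; rewrite aN mul0r addr0.
Qed.

Lemma comb_rep : #|tightset| = (2 * k)%N ->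
  exists y, (forall j, j \notin tightset -> y j = 0) /\ forall i, c i = comb y i.
Proof.
move=> cJ; pose A := None |: [set Some j | j in tightset].
have [||al [[v vA alv] al0 e]] := @tight_dependency A.
- by rewrite cardsU1 card_Some cJ; case: imsetP => // -[].
- by move=> j; rewrite in_setU1 /= (mem_imset _ _ Some_inj).
have alJ l : l \notin tightset -> al (Some l) = 0.
  by move=> lT; apply: al0; rewrite in_setU1 /= (mem_imset _ _ Some_inj).
have aN : al None != 0.
  apply/eqP => aN; case/eqP: alv; case: v vA => [j _|//].
  apply: (@comb_eq0 (fun j => al (Some j))) => //.
  by move=> i; have := e i; rewrite aN mul0r addr0.
exists (fun j => - al (Some j) / al None); split=> [j /alJ ->|i]; first by rewrite oppr0 mul0r.
have := e i; rewrite /comb; case: ifP => _ h; apply: (mulfI aN); rewrite mulrDr ?mulr0 ?addr0.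
  by rewrite ![_ * (_ / _)]mulrC !divfK //; lra.
by rewrite ![_ * (_ / _)]mulrC !divfK //; lra.
Qed.

Lemma kap_poly (X : {set 'I_n}) : (#|X| <= (2 * k).-2)%N -> exists p : {poly R},
  [/\ p != 0, (size p <= (2 * k).-1)%N & forall j, j \in X -> kap (fun i => p.[tau i]) j = 0].
Proof.
move=> cX; pose d := (2 * k).-1.
pose s := [seq \row_(m < d) kap (fun i => tau i ^+ m) j | j <- enum X].
have [|x x0 xs] := @annihilator_ex R d s; first by rewrite size_map -cardE /d; move: #|X| cX => y; nat_lia.
exists (rVpoly x); split.
- by apply: contra x0 => /eqP e; rewrite -(rVpolyK x) e linear0.
- exact: size_poly.
move=> j jX; have ps i : (rVpoly x).[tau i] = \sum_(m < d) x 0 m * tau i ^+ m.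
  rewrite (@horner_coef_wide _ d) ?size_poly //; apply: eq_bigr => m _.
  by rewrite coef_rVpoly_ord.
have := xs (\row_(m < d) kap (fun i => tau i ^+ m) j).
rewrite map_f ?mem_enum // => /(_ isT) e; rewrite -[RHS]e /dot /kap.
by case: ifP => _; rewrite !ps -?big_split /=; apply: eq_bigr => m _; rewrite mxE ?mulrDr.
Qed.

Lemma neg_ex : exists b, c b < 0.
Proof.
case: (pselect (exists b, c b < 0)) => // none.
have c0 i : 0 <= c i by rewrite leNgt; apply/negP => h; apply: none; exists i.
have [i /eqP[]] := c_neq0; apply/eqP; move: (sum_orth k_gt0 kn oc) => /eqP.
by rewrite psumr_eq0 // => /allP/(_ i); rewrite mem_index_enum => /(_ isT).
Qed.

Let nonpos := [set i | c i <= 0].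

(** Here [c] is a combination of active forms alone. A test polynomial killing all of them except
    those at [b] and [b0] must have opposite signs at [b] and [b0], since [c] is negative there. By
    [constrained_parity] the ranks of [b] and [b0] have equal parity, and at most [k] of [2k]
    indices share a parity. *)
Lemma card_nonpos_full : #|tightset| = (2 * k)%N -> (#|nonpos| <= k)%N.
Proof.
move=> cJ; have [y [yJ cy]] := comb_rep cJ; have [b0 cb0] := neg_ex.
have fixJ i : i \in fixset -> i \in tightset by rewrite in_setU => ->.
have npJ i : i \in nonpos -> i \in fixset by rewrite inE; exact: nonpos_fix.
have b0N : b0 \in nonpos by rewrite inE ltW.
have NJ : nonpos \subset tightset by apply/subsetP => i /npJ /fixJ.
have yc i : i \in fixset -> y i = c i.
  by move=> iF; rewrite cy /comb; case: ifP => [/links_succ|_]; rewrite ?addr0 // ord_predK iF.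
suff par : {in nonpos, forall b : 'I_n, odd #|[set j in tightset | (b < j)%N]| =
    odd #|[set j in tightset | (b0 < j)%N]|}.
  by have := card_same_parity NJ par; rewrite cJ uphalf_half mul2n odd_double doubleK.
move=> b bN; have [->//|bb0] := eqVneq b b0.
pose X := tightset :\ b0 :\ b.
have cX : (#|X| = (2 * k).-2)%N.
  have h1 := cardsD1 b0 tightset; have h2 := cardsD1 b (tightset :\ b0).
  move: h1 h2; rewrite /X in_setD1 bb0 !(fixJ _ (npJ _ _)) //= cJ.
  by move: #|_ :\ b0| #|_ :\ b| => u v; nat_lia.
have [p [p0 sp pk]] := @kap_poly X (eq_leq cX).
have cp : constrained X p.
  move=> j /pk; rewrite /kap; case: ifP => _ e; [right|by left].
  by apply/eqP; rewrite -addr_eq0 e.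
have [s sP] := constrained_parity k_gt0 kn cX p0 sp cp.
have bX : b \notin X by rewrite !in_setD1 eqxx.
have b0X : b0 \notin X by rewrite !in_setD1 eqxx andbF.
have [pb sb] := sP b bX; have [pb0 sb0] := sP b0 b0X.
have e : c b * p.[tau b] + c b0 * p.[tau b0] = 0.
  have := oc sp; under eq_bigr => i _ do rewrite cy.
  rewrite comb_kap (bigD1 b) //= (bigD1 b0) 1?eq_sym //= big1 ?addr0 => [|i /andP[ib ib0]].
    have nl i : i \in fixset -> (i \in links) = false.
      by move=> iF; apply/negP => /links_fix; rewrite iF.
    by rewrite /kap !nl ?npJ // !yc ?npJ.
  case: (boolP (i \in tightset)) => [iT|/yJ ->]; last by rewrite mul0r.
  by rewrite pk ?mulr0 // !in_setD1 ib ib0.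
have cb : c b < 0.
  rewrite lt_neqAle; apply/andP; split; last by move: bN; rewrite inE.
  apply/eqP => cb; move: e; rewrite cb mul0r add0r => /eqP.
  by rewrite mulf_eq0 (negbTE pb0) (lt_eqF cb0).
have opp_sg : (p.[tau b] < 0) != (p.[tau b0] < 0).
  have [h1|h1] : p.[tau b] < 0 \/ 0 < p.[tau b] by apply/orP; exact: lt_total.
    rewrite h1; apply/eqP => h2; have h3 : 0 < c b * p.[tau b] by rewrite nmulr_rgt0.
    have h4 : 0 < c b0 * p.[tau b0] by rewrite nmulr_rgt0.
    by have := addr_gt0 h3 h4; rewrite e ltxx.
  rewrite (lt_gtF h1) eq_sym eqbF_neg negbK ltNge; apply/negP => h2.
  have h3 : c b * p.[tau b] < 0 by rewrite nmulr_rlt0.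
  have h4 : c b0 * p.[tau b0] <= 0 by rewrite nmulr_rle0.
  by have := ltr_leD h3 h4; rewrite e addr0 ltxx.
have up (a a' : 'I_n) : a' \in tightset -> a != a' -> #|[set j in tightset | (a < j)%N]| =
    ((a < a')%N + #|[set j in tightset :\ a' :\ a | (a < j)%N]|)%N.
  move=> a'T aa'; rewrite (cardsD1 a') inE a'T /=; congr (_ + _)%N.
  apply: eq_card => j; rewrite !inE -!(inj_eq val_inj) /=.
  by case: (_ || _); rewrite ?andbF ?andbT //=; nat_lia.
rewrite (up b b0) ?fixJ ?npJ // (up b0 b) ?fixJ ?npJ 1?eq_sym // !oddD !oddb.
have -> : tightset :\ b :\ b0 = X by rewrite /X; apply/setP => j; rewrite !in_setD1 andbCA.
move: opp_sg; rewrite sb sb0 -/X.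
have -> : (b < b0)%N = ~~ (b0 < b)%N.
  apply/idP/idP; first by rewrite -leqNgt => /ltnW.
  rewrite -leqNgt leq_eqVlt => /orP[/eqP/val_inj e'|//].
  by rewrite e' eqxx in bb0.
by case: s sP sb sb0 => ? ? ?; case: (odd _); case: (odd _); case: (_ < _)%N.
Qed.

(** With fewer active forms the multiplier remains. They are padded to [2k - 1] indices [J];
    releasing only [b] leaves [c b] times the value at [b] plus [lam] times the sum over the other
    nodes. By [sum_sign] the signs at [b] and [u] are related in the same way for all [b], which
    fixes a rank parity on each side of [u]. *)
Lemma card_nonpos_pad : (#|tightset| < 2 * k)%N -> (#|nonpos| <= k)%N.
Proof.
move=> cJ; have [b0 cb0] := neg_ex; have [lam lamP] := multiplier.
have npF i : i \in nonpos -> i \in fixset by rewrite inE; exact: nonpos_fix.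
have [pad padC cpad] : exists2 B : {set 'I_n}, B \subset ~: tightset &
    #|B| = ((2 * k).-1 - #|tightset|)%N.
  apply: subset_card; have := cardsC tightset; rewrite card_ord.
  by move: #|tightset| #|~: tightset| cJ => x y; nat_lia.
pose Z := fixset :|: pad; pose J := Z :|: links.
have padN i : i \in pad -> i \notin tightset by move=> /(subsetP padC); rewrite inE.
have ZL : [disjoint Z & links].
  rewrite disjoints_subset; apply/subsetP => i; rewrite in_setU in_setC => /orP[iF|/padN].
    by apply/negP => /links_fix; rewrite iF.
  by rewrite in_setU negb_or => /andP[].
have JE : J = tightset :|: pad by rewrite /J /Z -setUA (setUC pad) setUA.
have cardJ : (#|J| = (2 * k).-1)%N.
  rewrite JE cardsU (_ : _ :&: _ = set0); last first.
    by apply/setP => i; rewrite in_setI in_set0; apply/negP => /andP[h /padN]; rewrite h.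
  by rewrite cards0 cpad; move: #|tightset| cJ => x; nat_lia.
have [u [z [uJ uz]]] := sum_sign R k_gt0 kn ZL cardJ.
have FZ i : i \in fixset -> i \in Z by rewrite in_setU => ->.
have FJ i : i \in fixset -> i \in J by move=> /FZ iZ; rewrite in_setU iZ.
have main b : b \in nonpos -> exists p : {poly R}, exists s : bool,
  [/\ p.[tau b] != 0, p.[tau u] != 0,
      c b * p.[tau b] + lam * (\sum_(i < n | i != b) p.[tau i]) = 0,
      Num.sg (\sum_(i < n | i != b) p.[tau i]) = z * Num.sg p.[tau u] &
      (p.[tau b] < 0) (+) (p.[tau u] < 0) = odd #|[set j in J :\ b | (b < j)%N]| (+)
         odd #|[set j in J :\ b | (u < j)%N]|].
  move=> bN; have bF := npF b bN.
  have cX : (#|J :\ b| = (2 * k).-2)%N.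
    by have := cardsD1 b J; rewrite FJ // cardJ; move: #|_ :\ _| => x; nat_lia.
  have [p [p0 sp pk]] := @kap_poly (J :\ b) (eq_leq cX).
  have bL : b \notin links by apply: contraL bF; exact: links_fix.
  have adp : adm k Z links b p.
    split=> //; first exact: FZ.
    - by move=> j /links_succ; apply: contraNneq => ->.
    - move=> j jZ jb; have := pk j; rewrite in_setD1 jb in_setU jZ /kap => /(_ isT).
      by have /negbT/negbTE -> := disjointFr ZL jZ.
    move=> j jL; have := pk j; rewrite in_setD1 in_setU jL orbT andbT /kap jL.
    have -> : j != b by apply: contraTneq jL => ->.
    by move=> /(_ isT)/eqP; rewrite addr_eq0 => /eqP.
  have cp : constrained (J :\ b) p.
    move=> j /pk; rewrite /kap; case: ifP => _ e; [right|by left].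
    by apply/eqP; rewrite -addr_eq0 e.
  have [s sP] := constrained_parity k_gt0 kn cX p0 sp cp.
  have bX : b \notin J :\ b by rewrite in_setD1 eqxx.
  have uX : u \notin J :\ b by apply: contra uJ; rewrite in_setD1 => /andP[_].
  have [pb sb] := sP b bX; have [pu su] := sP u uX.
  exists p, s; split=> //; [|exact: uz|by rewrite sb su; case: s {sP sb su}; case: (odd _); case: (odd _)].
  pose g i := if i == b then 0 else p.[tau i].
  have : \sum_i c i * g i = lam * \sum_i g i.
    apply: lamP => j jT; have := pk j; rewrite in_setD1 JE in_setU jT /= andbT /kap /g.
    have [->|jb] := eqVneq j b; first by rewrite (negbTE bL).
    case: ifP => jL; last by move=> ->.
    have -> : (ordS j == b) = false by apply/negP => /eqP e; have := links_succ jL; rewrite e bF.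
    by move=> ->.
  have := oc sp; rewrite (bigD1 b) //= => e1.
  have -> : \sum_i g i = \sum_(i < n | i != b) p.[tau i].
    rewrite (bigD1 b) //= /g eqxx add0r; apply: eq_bigr => i /negbTE -> //.
  have -> : \sum_i c i * g i = \sum_(i < n | i != b) c i * p.[tau i].
    rewrite (bigD1 b) //= /g eqxx mulr0 add0r; apply: eq_bigr => i /negbTE -> //.
  by move=> <-.
(* The strictly negative entry at [b0] shows that [lam] and [z] do not vanish; conversely this rules
   out entries equal to 0 below. *)
have lamz : Num.sg lam * z != 0.
  have b0N : b0 \in nonpos by rewrite inE ltW.
  have [p [s [pb pu e sS _]]] := main b0 b0N.
  have : lam * (\sum_(i < n | i != b0) p.[tau i]) != 0.
    have h : c b0 * p.[tau b0] != 0 by rewrite mulf_neq0 // lt_eqF.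
    by apply: contra h => /eqP h; move: e; rewrite h addr0 => ->.
  rewrite mulf_eq0 negb_or => /andP[l0]; rewrite -sgr_eq0 sS mulf_eq0 negb_or => /andP[z0 _].
  by rewrite mulf_neq0 ?sgr_eq0.
pose w := Num.sg lam * z.
have par b : b \in nonpos -> odd #|[set j in J :\ b | (b < j)%N]| (+)
         odd #|[set j in J :\ b | (u < j)%N]| = (w < 0).
  move=> bN; have [p [s [pb pu e sS <-]]] := main b bN.
  have S0 : \sum_(i < n | i != b) p.[tau i] != 0.
    rewrite -sgr_eq0 sS mulf_neq0 ?sgr_eq0 //.
    by apply: contra lamz => /eqP ->; rewrite mulr0.
  have l0 : lam != 0 by apply: contra lamz => /eqP ->; rewrite sgr0 mul0r.
  have cb0' : c b != 0.
    apply/eqP => cb; move: e; rewrite cb mul0r add0r => /eqP.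
    by rewrite mulf_eq0 (negbTE l0) (negbTE S0).
  have cb : c b < 0 by rewrite lt_neqAle cb0'; move: bN; rewrite inE.
  have : Num.sg p.[tau b] = w * Num.sg p.[tau u].
    have : Num.sg (c b * p.[tau b]) = - (w * Num.sg p.[tau u]).
      have -> : c b * p.[tau b] = - (lam * \sum_(i < n | i != b) p.[tau i]).
        by apply/eqP; rewrite -addr_eq0 e.
      by rewrite sgrN sgrM sS /w mulrA.
    by rewrite sgrM (ltr0_sg cb) mulN1r => /oppr_inj.
  have [h1|h1] : p.[tau b] < 0 \/ 0 < p.[tau b] by apply/orP; exact: lt_total.
    rewrite h1 (ltr0_sg h1).
    have [h2|h2] : p.[tau u] < 0 \/ 0 < p.[tau u] by apply/orP; exact: lt_total.
      by rewrite h2 (ltr0_sg h2) mulrN1 => /oppr_inj <-; rewrite ltr10.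
    by rewrite (lt_gtF h2) (gtr0_sg h2) mulr1 => <-; rewrite ltrN10.
  rewrite (lt_gtF h1) (gtr0_sg h1).
  have [h2|h2] : p.[tau u] < 0 \/ 0 < p.[tau u] by apply/orP; exact: lt_total.
    by rewrite h2 (ltr0_sg h2) mulrN1 => e'; rewrite -oppr_gt0 -e' ltr01.
  by rewrite (lt_gtF h2) (gtr0_sg h2) mulr1 => <-; rewrite ltr10.
pose J1 := [set j in J | (j < u)%N]; pose J2 := [set j in J | (u < j)%N].
pose B1 := [set b in nonpos | (b < u)%N]; pose B2 := [set b in nonpos | (u < b)%N].
have neu (i : 'I_n) : i \in J -> (i < u)%N || (u < i)%N.
  move=> iJ; case: (ltngtP i u) => // /val_inj e; by rewrite e (negbTE uJ) in iJ.
have cJ12 : (#|J1| + #|J2| = (2 * k).-1)%N.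
  rewrite -cardJ -cardsUI (_ : J1 :&: J2 = set0) ?cards0 ?addn0.
    apply: eq_card => j; rewrite in_setU [j \in J1]in_set [j \in J2]in_set -andb_orr.
    by apply/andb_idr; exact: neu.
  by apply/setP => j; rewrite in_setI in_set0 !in_set; apply/negP => /andP[/andP[_ h1] /andP[_ h2]]; nat_lia.
have cN : (#|nonpos| <= #|B1| + #|B2|)%N.
  rewrite -cardsUI; apply: leq_trans (leq_addr _ _); apply: subset_leq_card.
  apply/subsetP => b bN; have := neu b (FJ b (npF b bN)).
  by rewrite in_setU !in_set; move: bN; rewrite inE => ->.
have B1J : B1 \subset J1.
  apply/subsetP => b; rewrite in_set => /andP[bN bu]; rewrite in_set bu andbT.
  exact: FJ (npF _ bN).
have B2J : B2 \subset J2.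
  apply/subsetP => b; rewrite in_set => /andP[bN bu]; rewrite in_set bu andbT.
  exact: FJ (npF _ bN).
have p1 : {in B1, forall b : 'I_n, odd #|[set j in J1 | (b < j)%N]| = (w < 0)}.
  move=> b; rewrite inE => /andP[bN bu]; rewrite -(par b bN).
  have -> : #|[set j in J :\ b | (b < j)%N]| =
      (#|[set j in J1 | (b < j)%N]| + #|[set j in J :\ b | (u < j)%N]|)%N.
    rewrite -cardsUI (_ : _ :&: _ = set0) ?cards0 ?addn0.
      apply: eq_card => j; rewrite in_setU in_set [j \in [set _ in J1 | _]]in_set.
      rewrite [j \in J1]in_set [j \in [set _ in _ | (u < _)%N]]in_set in_setD1.
      case: (boolP (j \in J)) => jJ; rewrite ?andbF //= andbT.
      have := neu j jJ; rewrite -(inj_eq val_inj) /=; nat_lia.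
    apply/setP => j; rewrite in_setI in_set0 !in_set.
    by apply/negP => /andP[/andP[/andP[_ h1] _] /andP[_ h2]]; nat_lia.
  by rewrite oddD addbK.
have p2 : {in B2, forall b : 'I_n, odd #|[set j in J2 | (b < j)%N]| =
    (w < 0) (+) ~~ odd #|J2|}.
  move=> b; rewrite inE => /andP[bN ub]; rewrite -(par b bN).
  have -> : #|[set j in J :\ b | (b < j)%N]| = #|[set j in J2 | (b < j)%N]|.
    apply: eq_card => j; rewrite in_set [j \in [set _ in J2 | _]]in_set.
    rewrite [j \in J2]in_set in_setD1 -(inj_eq val_inj) /=.
    by case: (_ \in J); rewrite ?andbF //=; nat_lia.
  have -> : #|J2| = #|[set j in J :\ b | (u < j)%N]|.+1.
    rewrite (cardsD1 b) inE (FJ b (npF b bN)) ub add1n; congr _.+1.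
    by apply: eq_card => j; rewrite in_setD1 [j \in J2]in_set [RHS]in_set in_setD1 andbA.
  by rewrite /= negbK addbK.
(* The two sides of [u] contain [2k - 1] indices together, so exactly one of the two halves is
   rounded up and the total is [k]. *)
have h1 := card_same_parity B1J p1; have h2 := card_same_parity B2J p2.
move: cN h1 h2 cJ12; rewrite !uphalf_half.
by move: #|nonpos| #|B1| #|B2| #|J1| #|J2| => x1 x2 x3 x4 x5; nat_lia.
Qed.

Lemma card_nonpos : (#|nonpos| <= k)%N.
Proof.
have := card_tightset; rewrite leq_eqVlt => /orP[/eqP|]; first exact: card_nonpos_full.
exact: card_nonpos_pad.
Qed.

End Rigid.

(** * The fan of the Schrijver graph *)

Section Thresholds.
Variable R : realFieldType.

Lemma avoid_roots (D : {poly R}) (e : R) : D != 0 -> 0 < e ->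
  exists s, [/\ 0 < s, s < e & D.[s] != 0].
Proof.
move=> D0 e0; pose rs := [seq e / i.+2%:R | i <- iota 0 (size D)].
have urs : uniq rs.
  rewrite map_inj_uniq ?iota_uniq // => i j /(mulfI (lt0r_neq0 e0)) /invr_inj /eqP.
  by rewrite eqr_nat => /eqP[].
case: (boolP (all (root D) rs)) => [ar|/allPn[x /mapP[i _ ->] nr]].
  by have := max_poly_roots D0 ar urs; rewrite size_map size_iota ltnn.
exists (e / i.+2%:R); split; last by move: nr; rewrite rootE.
  by rewrite divr_gt0 // ltr0n.
by rewrite ltr_pdivrMr ?ltr0n // ltr_pMr // ltr1n.
Qed.

Lemma finite_threshold (I : finType) (P : I -> R -> Prop) :
  (forall i, exists e, 0 < e /\ forall s, 0 < s -> s < e -> P i s) ->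
  exists e, 0 < e /\ forall i s, 0 < s -> s < e -> P i s.
Proof.
move=> hP; have [e eP] := choice hP.
pose S := \sum_i (e i)^-1 + 1.
have e0 i : 0 < (e i)^-1 by rewrite invr_gt0; have [] := eP i.
have S0 : 0 < S by apply: ltr_wpDl => //; apply: sumr_ge0 => i _; exact: ltW.
exists S^-1; rewrite invr_gt0; split=> // i s s0 sS; apply: (eP i).2 => //.
apply: lt_le_trans sS _; rewrite -[e i]invrK lef_pV2 ?posrE //.
rewrite /S (bigD1 i) //= -addrA lerDl addr_ge0 //.
by apply: sumr_ge0 => j _; exact: ltW.
Qed.

Lemma linear_threshold (p q : R) : 0 < p \/ (p = 0 /\ 0 < q) ->
  exists e, 0 < e /\ forall s, 0 < s -> s < e -> 0 < p + s * q.
Proof.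
case=> [p0|[-> q0]]; last first.
  by exists 1; split=> // s s0 _; rewrite add0r mulr_gt0.
have q1 : 0 < `|q| + 1 by apply: ltr_wpDl.
exists (p / (`|q| + 1)); split=> [|s s0]; first exact: divr_gt0.
rewrite ltr_pdivlMr // => h.
have h2 : - q <= `|q| by rewrite -normrN ler_norm.
have : s * - q <= s * `|q| by apply: ler_wpM2l => //; exact: ltW.
by rewrite mulrN; lra.
Qed.

End Thresholds.

(** * Generic heights and their limit *)

Section Heights.
Variables (R : realFieldType) (T : finType) (N : nat) (u : T -> 'rV[R]_N).
Notation vertex := (T * bool)%type.
Implicit Types (v w : vertex) (s : R).

(** Distinct powers of one parameter: a linear relation among heights becomes a polynomial equation
    in [s], and all heights tend to 1 with [s]. *)
Definition height s (a : T) : R := 1 + s ^+ (enum_rank a).+1.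

Definition generic (h : T -> R) := forall (j : nat) (x : 'rV[R]_N) (al : vertex -> R),
  inV j x -> (forall v, v \notin tight u h x -> al v = 0) ->
  (forall i : 'I_N, (i < j)%N -> \sum_v al v * sv u v 0 i = 0) -> forall v, al v = 0.

Lemma height_gt0 s a : 0 < s -> 0 < height s a.
Proof. by move=> s0; rewrite addr_gt0 // exprn_gt0. Qed.

Lemma height_ge1 s a : 0 < s -> 1 <= height s a.
Proof. by move=> s0; rewrite lerDl ltW // exprn_gt0. Qed.

Lemma height_le s a : 0 < s -> s <= 1 -> height s a <= 1 + s.
Proof.
move=> s0 s1; rewrite lerD2l exprS; apply: ler_piMr; first exact: ltW.
by apply: exprn_ile1 => //; exact: ltW.
Qed.

(* A dependency among tight vectors is a linear relation among the heights,
   that is, a root of one of finitely many nonzero polynomials in [s]. *)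
Lemma generic_heights : exists2 D : {poly R}, D != 0 &
  forall s, 0 < s -> D.[s] != 0 -> generic (height s).
Proof.
pose dep (k : 'I_N.+1 * {set vertex}) (al : vertex -> R) :=
  [/\ exists v, al v != 0, forall v, v \notin k.2 -> al v = 0 &
      forall i : 'I_N, (i < k.1)%N -> \sum_v al v * sv u v 0 i = 0].
have ex k : exists al, (exists al', dep k al') -> dep k al.
  by case: (pselect (exists al, dep k al)) => [[al d]|n]; [exists al|exists (fun=> 0)].
have [al alP] := choice ex.
pose P k : {poly R} := \sum_v (al k v)%:P * (1 + 'X^((enum_rank v.1).+1)).
pose D := \prod_(k | P k != 0) P k.
exists D; first by apply/prodf_neq0.
move=> s s0 Ds j x be xj be0 bes v; apply/eqP; apply: contraT => bv.
pose t := tight u (height s) x.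
have jN : (minn j N < N.+1)%N by rewrite ltnS geq_minr.
pose k := (Ordinal jN, t).
have [[w aw] a0 as0] : dep k (al k).
  apply: alP; exists be; split=> [||i /=]; [by exists v|exact: be0|].
  by rewrite leq_min => /andP[ij _]; exact: bes.
have wt : w \in t by apply: contraT => /a0 e; rewrite e eqxx in aw.
have Ps : (P k).[s] = 0.
  have -> : (P k).[s] = \sum_v al k v * height s v.1.
    rewrite horner_sum; apply: eq_bigr => v' _.
    by rewrite hornerM hornerC hornerD hornerXn hornerC.
  have -> : \sum_v al k v * height s v.1 = \sum_v al k v * dot x (sv u v).
    apply: eq_bigr => v' _; case: (boolP (v' \in t)) => [|/a0 ->]; last by rewrite !mul0r.
    by rewrite inE => /eqP ->.
  have -> : \sum_v al k v * dot x (sv u v) = \sum_i x 0 i * \sum_v al k v * sv u v 0 i.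
    under eq_bigr => v' _ do rewrite mulr_sumr.
    rewrite exchange_big /=; apply: eq_bigr => i _; rewrite mulr_sumr.
    by apply: eq_bigr => v' _; rewrite mulrCA.
  apply: big1 => i _; case: (ltnP i j) => ij; last by rewrite xj // mul0r.
  by rewrite as0 ?mulr0 //= leq_min ij ltn_ord.
have Pk : P k != 0.
  apply/eqP => P0; have : (P k)`_(enum_rank w.1).+1 = 0 by rewrite P0 coef0.
  rewrite coef_sum.
  have -> : \sum_v ((al k v)%:P * (1 + 'X^((enum_rank v.1).+1)))`_((enum_rank w.1).+1) =
      \sum_v (if v.1 == w.1 then al k v else 0).
    apply: eq_bigr => v' _; rewrite coefCM coefD coef1 coefXn /= add0r eqSS.
    rewrite (inj_eq val_inj) (inj_eq enum_rank_inj) eq_sym.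
    by case: (_ == _); rewrite ?mulr1 ?mulr0.
  rewrite (bigD1 w) //= eqxx big1 ?addr0 => [e|v' v'w]; first by rewrite e eqxx in aw.
  (* The only other vertex with the same power of [s] is the opposite one, which is never tight
     together with [w]; hence the coefficient of this power is [al k w]. *)
  case: eqP => // e; apply: a0; have -> : v' = opp w.
    case: v' w e v'w {wt aw} => [a b] [a' b'] /= ->; rewrite /opp /=.
    by case: b; case: b'; rewrite ?eqxx.
  exact: (tight_opp (fun a => height_gt0 a s0) wt).
case/eqP: Ds; rewrite /D horner_prod (bigD1 k) //= Ps mul0r //.
Qed.

(* In the limit [s -> 0] the solution of the tight equations of a facet stays
   feasible for the constant height 1. *)
Lemma limit_facet : (forall x, (forall a, dot x (u a) = 0) -> x = 0) ->
  exists e : R, 0 < e /\ forall s, 0 < s -> s < e -> generic (height s) ->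
  forall x, feas u (height s) x -> #|tight u (height s) x| = N ->
  exists x0, [/\ feas u (fun=> 1) x0,
    forall v, v \in tight u (height s) x -> dot x0 (sv u v) = 1 &
    forall z, (forall v, v \in tight u (height s) x -> dot z (sv u v) = 0) -> z = 0].
Proof.
move=> span.
pose dual (t : {set vertex}) (y : vertex -> 'rV[R]_N) :=
  (forall v w, v \in t -> w \in t -> dot (y w) (sv u v) = (v == w)%:R) /\
  (forall z, (forall v, v \in t -> dot z (sv u v) = 0) -> z = 0).
have ex t : exists y, (exists y', dual t y') -> dual t y.
  by case: (pselect (exists y, dual t y)) => [[y d]|n]; [exists y|exists (fun=> 0)].
have [Y YP] := choice ex.
(* A constraint violated by the solution for height 1 stays violated for small [s]. As there are
   finitely many pairs of a set and a vertex, one threshold serves all of them. *)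
pose P (k : {set vertex} * vertex) s :=
  dot (\sum_(w in k.1) height s w.1 *: Y k.1 w) (sv u k.2) <= height s k.2.1 ->
  dot (\sum_(w in k.1) Y k.1 w) (sv u k.2) <= 1.
have dotS (t : {set vertex}) (f : vertex -> R) z :
    dot (\sum_(w in t) f w *: Y t w) z = \sum_(w in t) f w * dot (Y t w) z.
  by rewrite dotC dot_sumr; apply: eq_bigr => w _; rewrite dotZr dotC.
have [|e [e0 eP]] := @finite_threshold R _ P.
  move=> [t v]; rewrite /P /=; pose a w := dot (Y t w) (sv u v).
  have -> : dot (\sum_(w in t) Y t w) (sv u v) = \sum_(w in t) a w.
    by rewrite dotC dot_sumr; apply: eq_bigr => w _; rewrite dotC.
  have [le1|gt1] := leP (\sum_(w in t) a w) 1; first by exists 1.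
  pose C := \sum_(w in t) `|a w| + 1.
  have C1 : 1 <= C by rewrite lerDr sumr_ge0.
  pose dl := \sum_(w in t) a w - 1; have dl0 : 0 < dl by rewrite subr_gt0.
  exists (dl / (dl + C)); split=> [|s s0]; first by apply: divr_gt0 => //; lra.
  rewrite ltr_pdivlMr; last by lra.
  move=> hs; have s1 : s <= 1.
    rewrite leNgt; apply/negP => s1; have : dl + C < s * (dl + C) by rewrite ltr_pMl //; lra.
    lra.
  have sC : s * C < dl by have : 0 < s * dl by [rewrite mulr_gt0]; lra.
  rewrite dotS; have -> : \sum_(w in t) height s w.1 * a w =
      \sum_(w in t) a w + \sum_(w in t) s ^+ (enum_rank w.1).+1 * a w.
    by rewrite -big_split /=; apply: eq_bigr => w _; rewrite mulrDl mul1r.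
  have : - (s * \sum_(w in t) `|a w|) <= \sum_(w in t) s ^+ (enum_rank w.1).+1 * a w.
    rewrite mulr_sumr -sumrN; apply: ler_sum => w _.
    have sp : 0 < s ^+ (enum_rank w.1).+1 by exact: exprn_gt0.
    have sl : s ^+ (enum_rank w.1).+1 <= s by have := height_le w.1 s0 s1; rewrite /height; lra.
    apply: (@le_trans _ _ (- (s ^+ (enum_rank w.1).+1 * `|a w|))).
      by rewrite lerN2 ler_wpM2r.
    rewrite -mulrN; apply: ler_wpM2l; first exact: ltW.
    by rewrite lerNl -normrN ler_norm.
  by have := height_le v.1 s0 s1; rewrite /C /dl in sC *; lra.
exists e; split=> // s s0 se gs x fx cx; set t := tight u (height s) x.
have ann z : (forall v, v \in t -> dot z (sv u v) = 0) -> z = 0.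
  exact: (annihilator_tight span gs (@inVN _ _ x) (leqnn N) (@inVN _ _ z) (subxx _) cx).
have exy w : exists y, w \in t -> forall v, v \in t -> dot y (sv u v) = (v == w)%:R.
  case: (boolP (w \in t)) => wt; last by exists 0.
  have [|d [d0 _ ds]] := @annihilator_inV _ _ _ u N (t :\ w) (leqnn N).
    by have := cardsD1 w t; rewrite wt cx add1n => e1; rewrite [X in (_ < X)%N]e1.
  have dw : dot d (sv u w) != 0.
    apply: contra d0 => /eqP e1; apply/eqP; apply: ann => v vt.
    by have [->//|vw] := eqVneq v w; apply: ds; rewrite in_setD1 vw.
  exists ((dot d (sv u w))^-1 *: d) => _ v vt; rewrite dotZl.
  have [->|vw] := eqVneq v w; first by rewrite mulVf.
  by rewrite (ds v) ?in_setD1 ?vw // mulr0.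
have [y yP] := choice exy.
have [dY annY] : dual t (Y t).
  by apply: YP; exists y; split; [move=> v w vt wt; exact: (yP w wt v vt)|exact: ann].
exists (\sum_(w in t) Y t w); split; [|move=> v vt|exact: ann]; last first.
  rewrite dotC dot_sumr (bigD1 v) //= dotC dY // eqxx big1 ?addr0 // => w.
  by move=> /andP[wt wv]; rewrite dotC dY // eq_sym (negbTE wv).
apply/feasP => v; apply: (eP (t, v) s s0 se) => /=.
have <- : x = \sum_(w in t) height s w.1 *: Y t w; last exact: (feasP _ _ x).1.
apply/eqP; rewrite -subr_eq0; apply/eqP/ann => v' v't; rewrite dotDl dotNl dotS.
rewrite (bigD1 v') //= dY // eqxx mulr1 big1 ?addr0 => [|w /andP[wt wv]].
  by move: v't; rewrite inE => /eqP ->; rewrite subrr.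
by rewrite dY // eq_sym (negbTE wv) mulr0.
Qed.

End Heights.

(** * Orthogonal vectors with prescribed signs *)

Section Alternating2.
Variables (R : rcfType) (n k : nat).
Hypotheses (k_gt0 : (0 < k)%N) (kn : (2 * k < n)%N).
Notation orth := (@orth R n k).
Notation tau := (@tau R n).
Implicit Types (A S : {set 'I_n}) (i j : 'I_n).

Lemma orthP (c : 'I_n -> R) :
  (forall m, (m < (2 * k).-1)%N -> \sum_i c i * tau i ^+ m = 0) -> orth c.
Proof.
move=> h p sp; have e i : c i * p.[tau i] = \sum_(m < (2 * k).-1) p`_m * (c i * tau i ^+ m).
  by rewrite (horner_coef_wide _ sp) mulr_sumr; apply: eq_bigr => m _; rewrite mulrCA.
under eq_bigr => i _ do rewrite e.
rewrite exchange_big /=; apply: big1 => m _; by rewrite -mulr_sumr h ?mulr0.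
Qed.

(** The linear dependency among [2k] points of the moment curve in dimension [2k - 1]. Pairing it
    with the polynomial that vanishes at all but two of the points compares the signs of these two
    entries. *)
Lemma alternating_vector S : (#|S| = 2 * k)%N -> exists c, [/\ orth c,
  forall i, i \notin S -> c i = 0 & exists q : bool, forall i, i \in S ->
  c i != 0 /\ (c i < 0) = q (+) odd #|[set j in S | (i < j)%N]|].
Proof.
move=> cS; have [|c [[v vS cv] c0 cs]] :=
  @dependency_ex R _ (fun (i : 'I_n) m => tau i ^+ m) (2 * k).-1 S; first by rewrite cS; lia.
have oc : orth c by apply: orthP => m mk; exact: cs.
exists c; split=> //; exists ((c v < 0) (+) odd #|[set j in S | (v < j)%N]|) => i iS.
have [->|iv] := eqVneq i v; first by rewrite cv addbK.
pose X := S :\ v :\ i.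
have cX : (#|X| = (2 * k).-2)%N.
  have h1 := cardsD1 v S; have h2 := cardsD1 i (S :\ v).
  by move: h1 h2; rewrite /X in_setD1 iv vS iS cS /=; move: #|_ :\ v| #|_ :\ i| => x y; lia.
pose g : {poly R} := \prod_(j in X) ('X - (tau j)%:P).
have g0 : g != 0 by rewrite monic_neq0 // monic_prod_XsubC.
have sg : (size g <= (2 * k).-1)%N by rewrite /g -big_enum /= size_prod_XsubC -cardE cX; lia.
have gX j : j \in X -> g.[tau j] = 0.
  by move=> jX; rewrite /g horner_prod (bigD1 j) //= hornerXsubC subrr mul0r.
have [s sP] := constrained_parity k_gt0 kn cX g0 sg (fun j jX => or_introl (gX j jX)).
have iX : i \notin X by rewrite !in_setD1 eqxx.
have vX : v \notin X by rewrite !in_setD1 eqxx andbF.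
have [gi si] := sP i iX; have [gv sv_] := sP v vX.
have e : c i * g.[tau i] + c v * g.[tau v] = 0.
  have := oc g sg; rewrite (bigD1 i) //= (bigD1 v) 1?eq_sym //= big1 ?addr0 => [//|j /andP[ji jv]].
  case: (boolP (j \in S)) => [jS|/c0 ->]; last by rewrite mul0r.
  by rewrite gX ?mulr0 // !in_setD1 ji jv.
have cgv : c v * g.[tau v] != 0 by rewrite mulf_neq0.
have ci : c i != 0.
  by apply: contra cgv => /eqP c00; move: e; rewrite c00 mul0r add0r => ->.
split=> //.
have key : (c i < 0) (+) (g.[tau i] < 0) = ~~ ((c v < 0) (+) (g.[tau v] < 0)).
  have h1 := mulr_lt0 (c i) g.[tau i]; have h2 := mulr_lt0 (c v) g.[tau v].
  rewrite ci gi /= in h1; rewrite cv gv /= in h2; rewrite -h1 -h2.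
  have -> : c i * g.[tau i] = - (c v * g.[tau v]) by apply/eqP; rewrite -addr_eq0 e.
  rewrite oppr_lt0 -leNgt le_eqVlt [0 == _]eq_sym (negbTE cgv) //.
have up (a a' : 'I_n) : a' \in S -> a != a' -> #|[set j in S | (a < j)%N]| =
    ((a < a')%N + #|[set j in S :\ a' :\ a | (a < j)%N]|)%N.
  move=> a'S aa'; rewrite (cardsD1 a') inE a'S /=; congr (_ + _)%N.
  apply: eq_card => j; rewrite !inE; have [->|ja] := eqVneq j a; rewrite ?ltnn ?andbF //=.
  by rewrite andbA.
rewrite (up i v) // (up v i) 1?eq_sym // !oddD !oddb.
have -> : S :\ i :\ v = X by apply/setP => j; rewrite !in_setD1 andbCA.
move: key; rewrite si sv_ -/X.
have -> : (v < i)%N = ~~ (i < v)%N.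
  apply/idP/idP; first by rewrite -leqNgt => /ltnW.
  by rewrite -leqNgt leq_eqVlt => /orP[/eqP/val_inj e'|//]; rewrite e' eqxx in iv.
by case: (c i < 0); case: (c v < 0); case: (s); case: (odd _); case: (odd _); case: (_ < _)%N.
Qed.

Lemma weight_lt (f : 'I_n -> R) A A' : (forall i, i \in A -> 0 < f i) ->
  (forall i, i \notin A -> f i <= 0) -> #|A'| = #|A| -> A' != A -> weight f A' < weight f A.
Proof.
move=> fA fA' cA AA'.
have wE (B C : {set 'I_n}) : weight f B = weight f (B :&: C) + weight f (B :\: C).
  exact: big_setID.
rewrite (wE A' A) (wE A A') setIC ltrD2l.
have /set0Pn[i iD] : A :\: A' != set0.
  by apply: contra AA'; rewrite setD_eq0 => s; rewrite eq_sym eqEcard s cA leqnn.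
apply: (@le_lt_trans _ _ 0).
  by apply: sumr_le0 => j; rewrite inE => /andP[jA _]; exact: fA'.
rewrite /weight (bigD1 i) //= ltr_pwDl //.
  by apply: fA; move: iD; rewrite inE => /andP[].
by apply: sumr_ge0 => j /andP[]; rewrite inE => /andP[_ jA] _; exact/ltW/fA.
Qed.

Lemma shift_stable A : stable A -> stable [set ordS a | a in A].
Proof.
move=> sA; apply/stableP => _ /imsetP[a aA ->]; rewrite (mem_imset _ _ (@ordS_inj n)).
exact: (stableP _ sA).
Qed.

(** A stable set and its cyclic shift are disjoint and alternate round the cycle, so the alternating
    signs on their union are constant on each of the two. [L] records whether an element of [A] is
    shifted across the seam. *)
Lemma interlacing A : stable A -> #|A| = k -> exists c, [/\ orth c,
  forall i, i \in A -> 0 < c i, forall i, i \in [set ordS a | a in A] -> c i < 0 &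
  forall i, i \notin A -> i \notin [set ordS a | a in A] -> c i = 0].
Proof.
move=> sA cA; pose B := [set ordS a | a in A]; pose S := A :|: B.
have AB : A :&: B = set0.
  apply/setP => i; rewrite in_setI in_set0; apply/negP => /andP[iA /imsetP[a aA e]].
  by have := stableP _ sA a aA; rewrite -e iA.
have cB : #|B| = k by rewrite card_imset //; exact: ordS_inj.
have cS : (#|S| = 2 * k)%N by rewrite cardsU AB cards0 cA cB subn0 mul2n addnn.
pose r i := #|[set j in S | (i < j)%N]|.
pose L := [exists a in A, a.+1 == n].
have rA a : a \in A -> odd (r a) = ~~ L.
  move=> aA; pose up := [set j in A | (a < j)%N].
  have e1 : r a = (#|up| + #|[set j in B | (a < j)%N]|)%N.
    rewrite -cardsUI (_ : _ :&: _ = set0) ?cards0 ?addn0.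
      by apply: eq_card => j; rewrite in_setU !in_set andb_orl.
    apply/setP => j; have := in_set0 j; rewrite -{1}AB !inE.
    by case: (j \in A); case: (j \in B); case: (a < j)%N.
  have e2 : #|[set j in B | (a < j)%N]| = #|[set j in A | (a <= j)%N && (j.+1 < n)%N]|.
    rewrite -[RHS](card_imset _ (@ordS_inj n)); apply: eq_card => j; rewrite inE.
    apply/andP/imsetP => [[/imsetP[a' a'A ->] h]|[a']].
      exists a' => //; rewrite inE a'A /=; have [h'|h'] := ltnP a'.+1 n.
        by move: h; rewrite ordSE // ltnS => ->.
      by move: h; rewrite ordS_last //; have := ltn_ord a'; lia.
    rewrite inE => /and3P[a'A h1 h2] ->; rewrite (mem_imset _ _ (@ordS_inj n)) a'A.
    by rewrite ordSE // ltnS.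
  have e3 : (#|[set j in A | (a <= j)%N && (j.+1 < n)%N]| + L = #|up|.+1)%N.
    have -> : #|up|.+1 = #|[set j in A | (a <= j)%N]|.
      rewrite (cardsD1 a [set j in A | (a <= j)%N]) inE aA leqnn add1n; congr _.+1.
      apply: eq_card => j; rewrite !inE -(inj_eq val_inj) /=.
      by case: (j \in A); rewrite ?andbF //=; lia.
    rewrite /L; case: (boolP [exists a in A, a.+1 == n]) => [/exists_inP[l lA /eqP ln]|/exists_inPn nl].
      rewrite (cardsD1 l [set j in A | (a <= j)%N]) inE lA addnC.
      have -> : (a <= l)%N by have := ltn_ord a; lia.
      congr (_ + _)%N; apply: eq_card => j; rewrite !inE -(inj_eq val_inj) /=.
      by have := ltn_ord j; case: (j \in A); rewrite ?andbF //=; lia.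
    rewrite addn0; apply: eq_card => j; rewrite !inE; case: (boolP (j \in A)) => //= jA.
    by have := nl j jA; have := ltn_ord j; lia.
  have : (r a + L = (#|up|).*2.+1)%N by rewrite e1 e2 -addnA e3 addnS addnn.
  move=> /(congr1 odd); rewrite oddD /= odd_double oddb.
  by case: (odd _); case: (L).
have rB a : a \in A -> odd (r (ordS a)) = L.
  move=> aA; have := rA a aA; have [h|h] := ltnP a.+1 n.
    rewrite /r (cardsD1 (ordS a)) inE in_setU mem_imset; last exact: ordS_inj.
    rewrite aA orbT ordSE // ltnSn add1n /=.
    rewrite (_ : _ :\ _ = [set j in S | (a.+1 < j)%N]); first by move/negb_inj.
    apply/setP => j; rewrite !inE -(inj_eq val_inj) /= modn_small //.
    by case: (_ || _); rewrite ?andbF //=; lia.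
  have an : a.+1 = n by have := ltn_ord a; lia.
  have -> : L by apply/exists_inP; exists a => //; apply/eqP.
  move=> _; have -> : r (ordS a) = (2 * k).-1.
    have := cardsD1 (ordS a) S; rewrite in_setU mem_imset; last exact: ordS_inj.
    rewrite aA orbT cS add1n => ->; apply: eq_card => j.
    by rewrite !inE ordS_last // -(inj_eq val_inj) /= an modnn lt0n andbC.
  by case: (k) k_gt0 => // m _; rewrite mulnS /= mul2n odd_double.
have [c [oc c0 [q qP]]] := alternating_vector cS.
have cAs a : a \in A -> c a != 0 /\ (c a < 0) = q (+) ~~ L.
  by move=> aA; have [] := qP a; rewrite ?in_setU ?aA // => h ->; rewrite -/(r a) rA.
have cBs b : b \in B -> c b != 0 /\ (c b < 0) = q (+) L.
  move=> /imsetP[a aA ->]; have [] := qP (ordS a).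
    by rewrite in_setU mem_imset ?aA ?orbT //; exact: ordS_inj.
  by move=> h ->; rewrite -/(r (ordS a)) rB.
have out i : i \notin A -> i \notin B -> c i = 0.
  by move=> iA iB; apply: c0; rewrite in_setU negb_or iA.
case E : (q (+) L); last first.
  exists (fun i => - c i); split.
  - by move=> p sp; under eq_bigr do rewrite mulNr; rewrite sumrN oc // oppr0.
  - by move=> i /cAs[_]; rewrite addbN E oppr_gt0 => ->.
  - by move=> i /cBs[h1 h2]; rewrite oppr_lt0 lt_neqAle eq_sym h1 /= leNgt h2 E.
  by move=> i iA iB; rewrite out // oppr0.
exists c; split=> //.
  by move=> i /cAs[h1 h2]; rewrite lt_neqAle eq_sym h1 /= leNgt h2 addbN E.
by move=> i /cBs[_]; rewrite E => ->.
Qed.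

(** For the interlacing vector [A] is the unique maximum and its shift [B] the unique minimum; their
    weights are opposite, so [B] is the only tie in absolute value. A small multiple of a vector [w]
    with positive weight on the union breaks it. *)
Lemma strict_maximiser A : stable A -> #|A| = k -> exists c, orth c /\
  forall A', stable A' -> #|A'| = k -> A' != A -> `|weight c A'| < weight c A.
Proof.
move=> sA cA; pose B := [set ordS a | a in A].
have [c [oc cp cn c0]] := interlacing sA cA.
have AB : A :&: B = set0.
  apply/setP => i; rewrite in_setI in_set0; apply/negP => /andP[iA /imsetP[a aA e]].
  by have := stableP _ sA a aA; rewrite -e iA.
have cB : #|B| = k by rewrite card_imset //; exact: ordS_inj.
have cS : (#|A :|: B| = 2 * k)%N by rewrite cardsU AB cards0 cA cB subn0 mul2n addnn.
have [a0 a0A] : exists a0, a0 \in A by apply/set0Pn; rewrite -card_gt0 cA.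
have [j jS] : exists j, j \notin A :|: B.
  have /subsetPn[j _ jS] : ~~ ([set: 'I_n] \subset A :|: B).
    by apply/negP => /subset_leq_card; rewrite cS cardsT card_ord; lia.
  by exists j.
have [w' [ow' w'0 [q w'S]]] : exists c, [/\ orth c,
    forall i, i \notin j |: ((A :|: B) :\ a0) -> c i = 0 &
    exists q : bool, forall i, i \in j |: ((A :|: B) :\ a0) ->
    c i != 0 /\ (c i < 0) = q (+) odd #|[set l in j |: ((A :|: B) :\ a0) | (i < l)%N]|].
  apply: alternating_vector; rewrite cardsU1 in_setD1 (negbTE jS) andbF /=.
  by have := cardsD1 a0 (A :|: B); rewrite in_setU a0A cS /= => ->.
have [w'j _] := w'S j (setU11 _ _).
(* Normalised to [-1] at the node [j] outside the union; as the entries sum to zero, the weight of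
   [w] on the union is 1. *)
pose w i := - (w' j)^-1 * w' i.
have ow : orth w.
  move=> p sp; under eq_bigr do rewrite -mulrA.
  by rewrite -mulr_sumr ow' // mulr0.
have sumAB (f : 'I_n -> R) : (forall i, i \notin j |: (A :|: B) -> f i = 0) ->
    \sum_i f i = f j + (weight f A + weight f B).
  move=> f0; rewrite (bigID (mem (j |: (A :|: B)))) /= [X in _ + X]big1 ?addr0 //.
  rewrite big_setU1 //=; congr (_ + _); rewrite -bigU /=; last first.
    by rewrite -setI_eq0 AB.
  by apply: eq_bigl => i; rewrite in_setU.
have wAB : weight w A + weight w B = 1.
  have := sum_orth k_gt0 kn ow; rewrite sumAB => [e|i iS]; last first.
    rewrite /w (w'0 i) ?mulr0 //; apply: contra iS; rewrite !in_setU1 in_setD1.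
    by case/orP => [->//|/andP[_ ->]]; rewrite orbT.
  by move: e; rewrite {1}/w mulNr mulVf //; lra.
have cAB : weight c A + weight c B = 0.
  have := sum_orth k_gt0 kn oc; rewrite sumAB => [|i iS]; last first.
    by move: iS; rewrite !in_setU1 in_setU !negb_or => /and3P[_ h1 h2]; exact: c0.
  by move: jS; rewrite in_setU negb_or => /andP[h1 h2]; rewrite c0 // add0r.
have cA' A' : stable A' -> #|A'| = k -> A' != A -> weight c A' < weight c A.
  move=> _ kA' AA'; apply: weight_lt => //; last by rewrite kA'.
  by move=> i iA; case: (boolP (i \in B)) => [/cn/ltW//|iB]; rewrite c0.
have cB' A' : stable A' -> #|A'| = k -> A' != B -> weight c B < weight c A'.
  move=> _ kA' AB'; have wN (C : {set 'I_n}) : weight (fun i => - c i) C = - weight c C.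
    exact: sumrN.
  rewrite -ltrN2 -!wN; apply: weight_lt => //; last by rewrite kA' cB.
    by move=> i iB; rewrite oppr_gt0; exact: cn.
  by move=> i iB; rewrite oppr_le0; case: (boolP (i \in A)) => [/cp/ltW//|iA]; rewrite c0.
have AneB : B != A.
  by apply: contraTneq a0A => e; have := in_set0 a0; rewrite -AB e setIid => ->.
pose P (A' : {set 'I_n}) (ep : R) := stable A' -> #|A'| = k -> A' != A ->
  `|weight (fun i => c i + ep * w i) A'| < weight (fun i => c i + ep * w i) A.
have wE ep C : weight (fun i => c i + ep * w i) C = weight c C + ep * weight w C.
  by rewrite /weight big_split /= mulr_sumr.
have [|e [e0 eP]] := @finite_threshold R _ P.
  move=> A'; case: (boolP [&& stable A', #|A'| == k & A' != A]); last first.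
    by move=> h; exists 1; split=> // s _ _ h1 /eqP h2 h3; rewrite h1 h2 h3 in h.
  move=> /and3P[sA' /eqP kA' AA'].
  have [|e1 [e10 e1P]] := @linear_threshold R (weight c A - weight c A') (weight w A - weight w A').
    by left; rewrite subr_gt0 cA'.
  have [|e2 [e20 e2P]] := @linear_threshold R (weight c A + weight c A') (weight w A + weight w A').
    have [->|A'B] := eqVneq A' B; first by right; rewrite cAB wAB.
    by left; have := cB' A' sA' kA' A'B; lra.
  exists (Num.min e1 e2); split=> [|s s0]; first by rewrite lt_min e10.
  rewrite lt_min => /andP[/(e1P s s0) h1 /(e2P s s0) h2] _ _ _; rewrite !wE ltr_norml.
  by apply/andP; split; lra.
exists (fun i => c i + (e / 2) * w i); split.
  move=> p sp; have -> : \sum_i (c i + e / 2 * w i) * p.[tau i] =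
      \sum_i c i * p.[tau i] + e / 2 * \sum_i w i * p.[tau i].
    by rewrite mulr_sumr -big_split /=; apply: eq_bigr => i _; ring.
  by rewrite oc // ow // mulr0 addr0.
by move=> A' h1 h2 h3; apply: eP => //; lra.
Qed.

Lemma basis_ex : exists B : 'M[R]_((n - 2 * k).+1, n),
  [/\ forall x : 'rV_((n - 2 * k).+1), orth (fun i => (x *m B) 0 i),
      forall c, orth c -> exists x : 'rV_((n - 2 * k).+1), forall i, c i = (x *m B) 0 i &
      forall x : 'rV_((n - 2 * k).+1), x *m B = 0 -> x = 0].
Proof.
pose W : 'M[R]_(n, (2 * k).-1) := \matrix_(i, j) tau i ^+ j.
have fW : row_free W^T.
  rewrite -kermx_eq0; apply/rowV0P => v /sub_kermxP vW.
  pose p := rVpoly v; apply/eqP; apply: contraT => v0.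
  have p0 : p != 0 by apply: contra v0 => /eqP e; rewrite -(rVpolyK v) -/p e linear0.
  pose rs := [seq tau m | m <- iota 0 n].
  have urs : uniq rs.
    rewrite map_inj_uniq ?iota_uniq // => i j /eqP; rewrite eq_le !(ler_tau R k_gt0 kn).
    by rewrite -eqn_leq => /eqP.
  have ar : all (root p) rs.
    apply/allP => x /mapP[i]; rewrite mem_iota add0n /= => ni ->.
    apply/rootP; rewrite (@horner_coef_wide _ (2 * k).-1) ?size_poly //.
    have /rowP/(_ (Ordinal ni)) := vW; rewrite !mxE => e; rewrite -[RHS]e.
    by apply: eq_bigr => m _; rewrite coef_rVpoly_ord !mxE.
  have := max_poly_roots p0 ar urs; rewrite size_map size_iota => h.
  by have : (size p <= (2 * k).-1)%N by [exact: size_poly]; move: (size p) h; lia.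
have rW : \rank W = (2 * k).-1 by rewrite -mxrank_tr; exact/eqP.
have rK : \rank (kermx W) = (n - 2 * k).+1 by rewrite mxrank_ker rW; lia.
have [B eB fB] : exists2 B : 'M[R]_((n - 2 * k).+1, n), (B :=: kermx W)%MS & row_free B.
  move: (row_base (kermx W)) (eq_row_base (kermx W)) (row_base_free (kermx W)).
  by rewrite rK => B eB fB; exists B.
exists B; split.
- move=> x; apply: orthP => m mk.
  have /sub_kermxP/rowP/(_ (Ordinal mk)) : (x *m B <= kermx W)%MS by rewrite -eB submxMl.
  by rewrite !mxE => e; rewrite -[RHS]e; apply: eq_bigr => i _; rewrite [W _ _]mxE.
- move=> c oc; have : (\row_i c i <= B)%MS.
    rewrite eB; apply/sub_kermxP/rowP => m; rewrite !mxE.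
    have := oc 'X^m; rewrite size_polyXn => /(_ (ltn_ord m)) e; rewrite -[RHS]e.
    by apply: eq_bigr => i _; rewrite !mxE hornerXn.
  by move=> /submxP[x e]; exists x => i; rewrite -e mxE.
by move=> x e; apply/eqP; rewrite -(mulmx_free_eq0 x fB) e.
Qed.

(** * The functionals of stable sets as vectors *)

Section Vectors.
Variable B : 'M[R]_((n - 2 * k).+1, n).
Notation N := (n - 2 * k).+1.
Hypothesis B_orth : forall x : 'rV_N, orth (fun i => (x *m B) 0 i).
Hypothesis B_full : forall c, orth c -> exists x : 'rV_N, forall i, c i = (x *m B) 0 i.
Hypothesis B_inj : forall x : 'rV_N, x *m B = 0 -> x = 0.
Notation T := (schrijver_vertex n k).

Definition uvec (a : T) : 'rV[R]_N := \row_l \sum_(i in sval a) B l i.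
Notation cf x := (fun i => (x *m B) 0 i).

Lemma dot_uvec (x : 'rV[R]_N) (a : T) : dot x (uvec a) = weight (cf x) (sval a).
Proof.
rewrite /dot; under eq_bigr => l _ do rewrite mxE mulr_sumr.
by rewrite exchange_big /=; apply: eq_bigr => i _; rewrite mxE.
Qed.

Lemma vertexP (a : T) : stable (sval a) /\ #|sval a| = k.
Proof. by have /andP[/eqP h1 h2] := valP a. Qed.

Lemma vertex_ex (A : {set 'I_n}) : stable A -> #|A| = k -> exists a : T, sval a = A.
Proof.
by move=> sA kA; have h : (#|A| == k) && stable A by [rewrite kA eqxx]; exists (exist _ A h).
Qed.

Lemma cf_neq0 (x : 'rV[R]_N) : x != 0 -> exists i, cf x i != 0.
Proof.
move=> x0; case: (pselect (exists i, cf x i != 0)) => // none.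
case/eqP: x0; apply: B_inj; apply/rowP => i; rewrite [RHS]mxE; apply/eqP; apply: contraT => h.
by case: none; exists i.
Qed.

(** A nonzero vector has at least [k] starts, and any [k] of them form a stable set of positive
    weight. *)
Lemma uvec_span (x : 'rV[R]_N) : (forall a, dot x (uvec a) = 0) -> x = 0.
Proof.
move=> hx; apply/eqP; apply: contraT => /cf_neq0 /(card_starts k_gt0 kn (B_orth x)).
move=> /subset_card[P0 P0S cP0]; have sP := stable_sub P0S (starts_stable (cf x)).
have [a aP] := vertex_ex sP cP0; have := hx a; rewrite dot_uvec aP => w0.
have [p pP] : exists p, p \in P0 by apply/set0Pn; rewrite -card_gt0 cP0.
have : 0 < weight (cf x) P0.
  rewrite /weight (bigD1 p) //= ltr_pwDl //; first exact/(@starts_pos _ _ (cf x))/(subsetP P0S).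
  by apply: sumr_ge0 => i /andP[iP _]; apply/ltW/(@starts_pos _ _ (cf x))/(subsetP P0S).
by rewrite w0 ltxx.
Qed.

Lemma feas1_weight (x : 'rV[R]_N) (A : {set 'I_n}) : feas uvec (fun=> 1) x -> stable A -> #|A| = k ->
  `|weight (cf x) A| <= 1.
Proof. by move=> fx sA kA; have [a <-] := vertex_ex sA kA; rewrite -dot_uvec; exact: fx. Qed.

Lemma feas1_pos (x : 'rV[R]_N) (a : T) : feas uvec (fun=> 1) x -> dot x (uvec a) = 1 ->
  forall i, i \in sval a -> 0 < cf x i.
Proof.
move=> fx; rewrite dot_uvec => wa i ia; have [sa ka] := vertexP a.
have x0 : x != 0.
  apply/eqP => e; move: wa; rewrite e mul0mx /weight big1 => [|l _]; last by rewrite mxE.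
  by move/eqP; rewrite eq_sym oner_eq0.
apply: (max_pos sa ka (card_starts k_gt0 kn (B_orth x) (cf_neq0 x0)) _ ia) => A sA kA.
by rewrite wa; apply: le_trans (ler_norm _) _; exact: feas1_weight.
Qed.

(** There are at most [k] nonpositive entries, and they include the predecessors of at least [k]
    starts; hence they form a stable [k]-set [D]. Its complement properly contains a set of weight 1
    and is positive elsewhere. As all entries sum to zero, [D] has weight below [-1], against
    feasibility. *)
Lemma not_monochromatic (x : 'rV[R]_N) (t : {set T}) : feas uvec (fun=> 1) x ->
  (forall a, a \in t -> dot x (uvec a) = 1) -> t != set0 ->
  (forall z, (forall a, a \in t -> dot z (uvec a) = 0) -> z = 0) -> False.
Proof.
move=> fx tx /set0Pn[a at_] ann; pose c := cf x.
have oc : orth c := B_orth x.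
have x0 : x != 0.
  by apply/eqP => e; have := tx a at_; rewrite e dot0l => /eqP; rewrite eq_sym oner_eq0.
have cn := cf_neq0 x0.
have c1 A : stable A -> #|A| = k -> weight c A <= 1.
  by move=> sA kA; apply: le_trans (ler_norm _) _; exact: feas1_weight.
have rigid d : orth d -> (forall A, stable A -> #|A| = k -> weight c A = 1 -> weight d A = 0) ->
    forall i, d i = 0.
  move=> od hd i; have [z zd] := B_full od.
  suff z0 : z = 0 by rewrite zd z0 mul0mx mxE.
  apply: ann => b bt; rewrite dot_uvec; have [sb kb] := vertexP b.
  have := hd _ sb kb; rewrite -[weight c _]dot_uvec tx // => /(_ erefl) <-.
  by apply: eq_bigr => l _; rewrite zd.
have small := card_nonpos k_gt0 kn oc cn c1 rigid.
have many := card_starts k_gt0 kn oc cn.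
set D := [set i | c i <= 0] in small.
have DE : D = [set ord_pred i | i in starts c].
  have pinj : injective (@ord_pred n) by exact: can_inj (@ord_predK n).
  apply/esym/eqP; rewrite eqEcard (card_imset _ pinj) (leq_trans small many) andbT.
  by apply/subsetP => _ /imsetP[i iS ->]; rewrite inE; move: iS; rewrite inE => /andP[].
have sD : stable D.
  apply/stableP => i; rewrite {1}DE => /imsetP[s sS ->]; rewrite ord_predK inE -ltNge.
  exact: starts_pos sS.
have cD : #|D| = k.
  apply/eqP; rewrite eqn_leq small DE card_imset //; exact: can_inj (@ord_predK n).
have pos := feas1_pos fx (tx a at_); have [sa ka] := vertexP a.
have sum0 := sum_orth k_gt0 kn oc.
have wD : weight c (~: D) = - weight c D.
  apply/eqP; rewrite -addr_eq0 -sum0; apply/eqP.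
  rewrite [RHS](bigID (mem D)) /= addrC; congr (_ + _); apply: eq_bigl => i.
  by rewrite in_setC.
have aD : sval a \subset ~: D.
  by apply/subsetP => i /pos ci; rewrite in_setC inE -ltNge.
have /subsetPn[j jD ja] : ~~ (~: D \subset sval a).
  apply/negP => /subset_leq_card; have := cardsC D; rewrite card_ord cD ka.
  by move: #|~: D| => y; lia.
have wC : weight c (~: D) = weight c (sval a) + weight c (~: D :\: sval a).
  by rewrite {1}/weight (big_setID (sval a)) /= (setIidPr aD).
have wj : 0 < weight c (~: D :\: sval a).
  have pC i : i \in ~: D -> 0 < c i by rewrite in_setC inE -ltNge.
  rewrite /weight (bigD1 j) /=; last by rewrite inE ja.
  rewrite ltr_pwDl ?pC //; apply: sumr_ge0 => i /andP[]; rewrite inE => /andP[_ iD] _.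
  exact/ltW/pC.
have := feas1_weight fx sD cD; rewrite ler_norml => /andP[h _].
have := tx a at_; rewrite dot_uvec -/c => wa; move: h; rewrite -/c; lra.
Qed.

(** The strict maximiser of [a], scaled to be tight at [a], still satisfies all other constraints
    once the heights are close enough to 1. *)
Lemma vertex_faces : exists e, 0 < e /\ forall s, 0 < s -> s < e -> s <= 1 ->
  forall a, face uvec (height s) [set (a, false)].
Proof.
have ex (a : T) : exists x, forall b, b != a -> `|dot x (uvec b)| < dot x (uvec a).
  have [sa ka] := vertexP a; have [c [oc cP]] := strict_maximiser sa ka.
  have [x xc] := B_full oc; exists x => b ba; have [sb kb] := vertexP b.
  have we (d : T) : dot x (uvec d) = weight c (sval d).
    by rewrite dot_uvec; apply: eq_bigr => i _; rewrite xc.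
  by rewrite !we; apply: cP => //; apply: contra ba => /eqP/val_inj ->.
have [X XP] := choice ex.
have pos a : 0 < dot (X a) (uvec a).
  have [sa ka] := vertexP a.
  have [b bE] := vertex_ex (shift_stable sa) (etrans (card_imset _ (@ordS_inj n)) ka).
  apply: le_lt_trans (XP a b _); first exact: normr_ge0.
  apply/eqP => e; have [i ia] : exists i, i \in sval a by apply/set0Pn; rewrite -card_gt0 ka.
  have : ordS i \in sval b by rewrite bE mem_imset //; exact: ordS_inj.
  by rewrite e; apply/negP; exact: (stableP _ sa).
pose P (k : T * T) (s : R) := k.2 != k.1 -> s <= 1 ->
  height s k.1 * `|dot (X k.1) (uvec k.2)| <= dot (X k.1) (uvec k.1).
have [|e [e0 eP]] := @finite_threshold R _ P.
  move=> [a b]; rewrite /P /=; have [->|ba] := eqVneq b a; first by exists 1.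
  have lt := XP a b ba; pose m := dot (X a) (uvec a); pose p := `|dot (X a) (uvec b)|.
  have p0 : 0 <= p by exact: normr_ge0.
  have p1 : 0 < p + 1 by lra.
  exists ((m - p) / (p + 1)); split=> [|s s0]; first by rewrite divr_gt0 // subr_gt0.
  rewrite ltr_pdivlMr // => hs _ s1.
  apply: (@le_trans _ _ ((1 + s) * p)); first by rewrite ler_wpM2r // height_le.
  rewrite -/m; lra.
exists e; split=> // s s0 se s1 a.
pose m := dot (X a) (uvec a); have m0 : 0 < m := pos a.
have h0 := height_gt0 a s0.
exists ((height s a / m) *: X a).
  move=> b; rewrite dotZl normrM gtr0_norm ?divr_gt0 //.
  have [->|ba] := eqVneq b a; first by rewrite gtr0_norm ?pos // divfK // gt_eqF.
  have := eP (a, b) s s0 se ba s1 => /= h.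
  rewrite mulrAC ler_pdivrMr //; apply: le_trans h _.
  by rewrite -[X in X <= _]mul1r ler_wpM2r ?height_ge1 // ltW.
apply/subsetP => v; rewrite !inE => /eqP ->.
by rewrite /sv /= expr0 scale1r dotZl divfK // gt_eqF.
Qed.

End Vectors.

Theorem schrijver_fan : exists (u : schrijver_vertex n k -> 'rV[R]_((n - 2 * k).+1))
    (h : schrijver_vertex n k -> R),
  [/\ forall a, 0 < h a, forall x, (forall a, dot x (u a) = 0) -> x = 0, generic u h &
  [/\ forall a, face u h [set (a, false)],
      forall a b, face u h [set (a, false); (b, true)] -> [disjoint sval a & sval b] &
      forall x b, feas u h x -> #|tight u h x| = (n - 2 * k).+1 ->
        ~ {in tight u h x, forall v, v.2 = b}]].
Proof.
have [B [Bo Bf Bi]] := basis_ex; pose u := uvec B.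
have span x : (forall a, dot x (u a) = 0) -> x = 0 by exact: uvec_span.
have [D D0 DP] := generic_heights u.
have [e1 [e10 e1P]] := limit_facet span.
have [e2 [e20 e2P]] := vertex_faces Bf.
have e0 : 0 < Num.min 1 (Num.min e1 e2) by rewrite !lt_min ltr01 e10.
have [s [s0 se Ds]] := avoid_roots D0 e0.
move: se; rewrite !lt_min => /and3P[s1 se1 se2].
have gs := DP s s0 Ds.
have hgt a := height_gt0 a s0.
exists u, (height s); split=> //; split.
- by apply: e2P => //; exact: ltW.
- move=> a b /(face_full span gs)[x [fx sx cx]].
  have [x0 [f0 t0 _]] := e1P s s0 se1 gs x fx cx.
  have da : dot x0 (u a) = 1.
    have := t0 (a, false); rewrite /sv /= expr0 scale1r; apply.
    by apply: (subsetP sx); rewrite !inE eqxx.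
  have db : dot (- x0) (u b) = 1.
    have := t0 (b, true); rewrite /sv /= expr1 dotZr mulN1r dotNl; apply.
    by apply: (subsetP sx); rewrite !inE eqxx orbT.
  have pa := feas1_pos Bo Bi f0 da; have pb := feas1_pos Bo Bi (feasN f0) db.
  apply/pred0P => i /=; apply/negP => /andP[/pa h1 /pb]; rewrite mulNmx mxE oppr_gt0.
  by move=> /ltW; rewrite leNgt h1.
move=> x b fx cx mono; have [x0 [f0 t0 ann]] := e1P s s0 se1 gs x fx cx.
pose y := (-1) ^+ b *: x0; pose t := [set v.1 | v in tight u (height s) x].
have dy v : v \in tight u (height s) x -> forall z, dot ((-1) ^+ b *: z) (u v.1) = dot z (sv u v).
  by move=> vt z; rewrite /sv dotZl dotZr (mono v vt).
apply: (@not_monochromatic B Bo Bf Bi y t).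
- by move=> a; rewrite dotZl normrM normr_sign mul1r; exact: f0.
- by move=> _ /imsetP[v vt ->]; rewrite dy // t0.
- have /set0Pn[v vt] : tight u (height s) x != set0 by rewrite -card_gt0 cx.
  by apply/set0Pn; exists v.1; apply/imsetP; exists v.
move=> z hz; apply: ann => v vt; have := dy v vt z; rewrite dotZl => <-.
by rewrite hz ?mulr0 //; apply/imsetP; exists v.
Qed.

End Alternating2.

(** * The complex of the fan modulo the antipodal map *)

Section Complex.
Variables (R : realType) (T : finType) (d : nat).
Notation N := d.+1.
Variables (u : T -> 'rV[R]_N) (h : T -> R).
Notation vertex := (T * bool)%type.
Implicit Types (v w : vertex) (s t : {set vertex}).
Hypothesis h_gt0 : forall a, 0 < h a.
Hypothesis span : forall x, (forall a, dot x (u a) = 0) -> x = 0.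
Hypothesis gp : generic u h.
Hypothesis vert : forall a, face u h [set (a, false)].

Local Notation under s := [set v.1 | v in s].
Local Notation opps s := [set opp v | v in s].

Lemma oppsK s : opps (opps s) = s.
Proof. by rewrite -imset_comp (eq_imset _ (@oppK T)) imset_id. Qed.

Lemma opps_inj : injective (fun s => opps s).
Proof. exact: inv_inj oppsK. Qed.

Lemma under_opps s : under (opps s) = under s.
Proof. by rewrite -imset_comp; apply: eq_imset. Qed.

Lemma face_opps s : face u h s -> face u h (opps s).
Proof. by move=> [x fx sx]; exists (- x); [exact: feasN|rewrite tightN imsetS]. Qed.

Lemma face_fst_inj s : face u h s -> {in s &, injective fst}.
Proof.
move=> [x fx sx] [a b] [a' b'] vs ws /= e; rewrite -{a'}e in ws *.
case: (eqVneq b b') => [->//|bb'].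
have := tight_opp h_gt0 (subsetP sx _ vs).
suff -> : opp (a, b) = (a, b') by rewrite (subsetP sx _ ws).
by rewrite /opp /=; case: b b' bb' {vs ws} => -[].
Qed.

(** An arbitrary choice between a face and its antipode, which lets the simplices of the quotient be
    a subtype of the signed vertex sets. *)
Definition nrm s := (enum_rank s <= enum_rank (opps s))%N.
Definition simplexb s := [&& s != set0, `[< face u h s >] & nrm s].
Definition simp : finType := {s | simplexb s}.
Implicit Types (p q r : simp).

Lemma simpP p : (val p != set0) /\ face u h (val p).
Proof. by have /and3P[h1 /asboolP h2 _] := valP p. Qed.

Lemma simp_ex s : (s != set0) -> face u h s ->
  exists p : simp, val p = s \/ val p = opps s.
Proof.
move=> s0 fs; case: (boolP (nrm s)) => ns.
  have hs : simplexb s by rewrite /simplexb s0 ns andbT; exact/asboolP.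
  by exists (Sub s hs); left; rewrite SubK.
have hs : simplexb (opps s).
  apply/and3P; split.
  - by case/set0Pn: s0 => v vs; apply/set0Pn; exists (opp v); exact: imset_f.
  - by apply/asboolP; exact: face_opps.
  by move: ns; rewrite /nrm oppsK -ltnNge => /ltnW.
by exists (Sub (opps s) hs); right; rewrite SubK.
Qed.

Lemma simp_opp p q : val p = opps (val q) -> p = q.
Proof.
move=> e; apply: val_inj; apply: enum_rank_inj; apply: val_inj; apply/eqP.
have /and3P[_ _ np] := valP p; have /and3P[_ _ nq] := valP q.
by rewrite eqn_leq; move: np nq; rewrite /nrm {2}e oppsK -e => -> ->.
Qed.

Definition svset p : {set T} := under (val p).
Definition sface q p := (val q \subset val p) || (opps (val q) \subset val p).

Lemma sface_refl : reflexive sface.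
Proof. by move=> p; rewrite /sface subxx. Qed.

Lemma sface_trans : transitive sface.
Proof.
move=> q p r /orP[pq|pq] /orP[qr|qr]; apply/orP.
- by left; exact: subset_trans qr.
- by right; apply: subset_trans qr; exact: imsetS.
- by right; exact: subset_trans qr.
by left; rewrite -[val p]oppsK; apply: subset_trans qr; exact: imsetS.
Qed.

Lemma svset_neq0 p : (svset p != set0).
Proof.
have [/set0Pn[v vp] _] := simpP p; apply/set0Pn; exists v.1; exact: imset_f.
Qed.

Lemma sface_sub q p : sface q p -> svset q \subset svset p.
Proof.
case/orP => qp; rewrite /svset; first exact: imsetS.
by rewrite -(under_opps (val q)); exact: imsetS.
Qed.

Lemma sface_ex p (A : {set T}) : (A != set0) -> A \subset svset p ->
  exists2 q, sface q p & svset q = A.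
Proof.
move=> A0 Ap; pose s := [set v in val p | v.1 \in A].
have sp : s \subset val p by apply/subsetP => v; rewrite inE => /andP[].
have us : under s = A.
  apply/setP => a; apply/imsetP/idP => [[v]|aA]; first by rewrite inE => /andP[_ ?] ->.
  have /imsetP[v vp e] := subsetP Ap a aA; exists v => //.
  by rewrite inE vp -e.
have s0 : (s != set0).
  by apply: contra A0 => /eqP e; rewrite -us e imset0.
have [q [qs|qs]] := simp_ex s0 (face_sub sp (simpP p).2); exists q;
  rewrite /sface /svset qs ?oppsK ?sp ?orbT ?under_opps //.
Qed.

Lemma face_eq_under s t t' : face u h s -> t \subset s -> t' \subset s ->
  under t = under t' -> t = t'.
Proof.
move=> fs; wlog suff sub : t t' / t \subset s -> t' \subset s -> under t = under t' -> t \subset t'.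
  move=> ts t's e; apply/eqP; rewrite eqEsubset; apply/andP.
  by split; [exact: sub|apply: sub => //; exact: esym].
move=> ts t's e; apply/subsetP => v vt.
have : v.1 \in under t' by rewrite -e; exact: imset_f.
case/imsetP => w wt' vw; suff -> : v = w by [].
by apply: (face_fst_inj fs) => //; [exact: (subsetP ts)|exact: (subsetP t's)].
Qed.

Lemma sface_uniq p q q' : sface q p -> sface q' p -> svset q = svset q' -> q = q'.
Proof.
rewrite /svset => h1 h2 e; have fp := (simpP p).2.
case/orP: h1 => h1; case/orP: h2 => h2.
- by apply: val_inj; exact: face_eq_under fp h1 h2 e.
- by apply: simp_opp; apply: (face_eq_under fp h1 h2); rewrite under_opps.
- by apply/esym/simp_opp; apply: (face_eq_under fp h2 h1); rewrite under_opps.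
by apply: val_inj; apply: opps_inj; apply: (face_eq_under fp h1 h2); rewrite !under_opps.
Qed.

Lemma svert_ex a : exists p, svset p = [set a].
Proof.
have a0 : ([set (a, false)] != set0) by apply/set0Pn; exists (a, false); rewrite set11.
have [p [e|e]] := simp_ex a0 (vert a); exists p; rewrite /svset e ?under_opps imset_set1 //.
Qed.

Lemma svert_uniq a p q : svset p = [set a] -> svset q = [set a] -> p = q.
Proof.
have single r : svset r = [set a] -> val r = [set (a, false)] \/ val r = [set (a, true)].
  move=> e; have [/set0Pn[v vr] fr] := simpP r.
  have va : v.1 = a by apply/set1P; rewrite -e; exact: imset_f.
  have rE : val r = [set v].
    apply/setP => w; rewrite inE; apply/idP/eqP => [wr|->//].
    apply: (face_fst_inj fr) => //; rewrite va; apply/set1P; rewrite -e; exact: imset_f.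
  by rewrite rE; case: v va {vr rE} => b [] /= ->; [right|left].
move=> /single[]e1 /single[]e2.
- by apply: val_inj; rewrite e1 e2.
- by apply: simp_opp; rewrite e1 e2 imset_set1.
- by apply: simp_opp; rewrite e1 e2 imset_set1.
by apply: val_inj; rewrite e1 e2.
Qed.

Definition fan_gsc : gsc := GSC sface_refl sface_trans svset_neq0 sface_sub sface_ex
  sface_uniq svert_ex svert_uniq.

(** Barycentric coordinates belong to unsigned vertices and the signs to the representative [s], so
    the antipodal representative gives the opposite point. *)
Definition pt s (c : T -> R) : 'rV[R]_N := \sum_(v in s) c v.1 *: sv u v.

Lemma pt_opps s c : pt (opps s) c = - pt s c.
Proof.
rewrite /pt big_imset /=; last by move=> v w _ _; exact: opp_inj.
by rewrite -sumrN; apply: eq_bigr => v _; rewrite sv_opp scalerN.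
Qed.

Lemma pt_sub s t c : face u h s -> t \subset s -> (forall a, a \notin under t -> c a = 0) ->
  pt s c = pt t c.
Proof.
move=> fs ts c0; rewrite /pt (big_setID t) /= (setIidPr ts) [X in _ + X]big1 ?addr0 // => v.
rewrite inE => /andP[vt vs]; rewrite c0 ?scale0r //; apply: contra vt => /imsetP[w wt e].
by have -> : v = w by apply: (face_fst_inj fs) => //; exact: (subsetP ts).
Qed.

Definition bary (S : {set T}) (c : T -> R) :=
  [/\ forall a, 0 <= c a, \sum_a c a = 1 & forall a, a \notin S -> c a = 0].

Lemma sum_under s (c : T -> R) : face u h s -> (forall a, a \notin under s -> c a = 0) ->
  \sum_(v in s) c v.1 = \sum_a c a.
Proof.
move=> fs c0; rewrite -(big_imset _ (face_fst_inj fs)) /= [RHS](bigID (mem (under s))) /=.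
by rewrite [X in _ = _ + X]big1 ?addr0 // => a /c0.
Qed.

Lemma pt_neq0 s c : face u h s -> bary (under s) c -> pt s c != 0.
Proof.
move=> fs [c0 c1 cs]; apply/eqP => e; have [x fx sx] := fs.
have : \sum_(v in s) c v.1 * h v.1 = 0.
  have e0 : dot x (pt s c) = 0 by rewrite e dotC dot0l.
  rewrite -[RHS]e0 /pt dot_sumr.
  by apply: eq_bigr => v vs; rewrite dotZr; have := subsetP sx v vs; rewrite inE => /eqP ->.
move=> /eqP; rewrite psumr_eq0 => [/allP z|v _]; last by rewrite mulr_ge0 // ltW.
have : \sum_(v in s) c v.1 = 0.
  apply: big1 => v vs; have := z v (mem_index_enum _); rewrite vs /= mulf_eq0.
  by rewrite (gt_eqF (h_gt0 _)) orbF => /eqP.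
by rewrite sum_under // c1 => /eqP; rewrite oner_eq0.
Qed.

Lemma pt_sum s c : pt s c = \sum_v (if v \in s then c v.1 else 0) *: sv u v.
Proof.
rewrite /pt big_mkcond /=; apply: eq_bigr => v _; case: ifP => //; by rewrite scale0r.
Qed.

(** Uniqueness of decompositions in the fan; both coordinate sums being 1 forces [l = 1]. *)
Lemma pt_inj s s' c c' (l : R) : face u h s -> face u h s' -> bary (under s) c ->
  bary (under s') c' -> 0 < l -> pt s c = l *: pt s' c' ->
  [/\ forall a, c a = c' a & [set v in s | c v.1 != 0] = [set v in s' | c' v.1 != 0]].
Proof.
move=> fs fs' [c0 c1 cs] [c0' c1' cs'] l0 e; have [x fx sx] := fs; have [x' fx' sx'] := fs'.
pose f v := if v \in s then c v.1 else 0; pose f' v := if v \in s' then c' v.1 else 0.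
have fl : forall v, f v = l * f' v.
  apply: (decomposition_uniq (t := f) (t' := fun v => l * f' v) gp fx fx').
  - by move=> v; rewrite /f; case: ifP.
  - by move=> v; rewrite /f'; case: ifP => _; rewrite ?mulr0 // mulr_ge0 // ltW.
  - by move=> v vx; rewrite /f; case: ifP => // vs; rewrite (subsetP sx v vs) in vx.
  - move=> v vx; rewrite /f'; case: ifP => [vs|_]; last by rewrite mulr0.
    by rewrite (subsetP sx' v vs) in vx.
  rewrite -pt_sum e pt_sum scaler_sumr; apply: eq_bigr => v _; by rewrite scalerA.
have fs1 : \sum_v f v = 1 by rewrite -big_mkcond sum_under.
have fs1' : \sum_v f' v = 1 by rewrite -big_mkcond sum_under.
have l1 : l = 1.
  by have : \sum_v f v = l * \sum_v f' v by [rewrite mulr_sumr; apply: eq_bigr => v _; exact: fl];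
     rewrite fs1 fs1' mulr1.
have ff v : f v = f' v by rewrite fl l1 mul1r.
have val_ (g : vertex -> R) t (k : T -> R) : (forall v, g v = if v \in t then k v.1 else 0) ->
    face u h t -> (forall a, a \notin under t -> k a = 0) -> forall a, k a = g (a, false) + g (a, true).
  move=> gE ft k0 a; rewrite !gE /=; case: (boolP ((a, false) \in t)) => h1;
    case: (boolP ((a, true) \in t)) => h2; rewrite ?addr0 ?add0r //.
    by have := face_fst_inj ft h1 h2 erefl.
  apply: k0; apply/imsetP => -[[b []] vt /= ab]; first by rewrite ab vt in h2.
  by rewrite ab vt in h1.
split=> [a|].
  by rewrite (val_ f s c) // (val_ f' s' c') // !ff.
apply/setP => v; rewrite !inE; have := ff v; rewrite /f /f'.
case: (v \in s) => /=; case: (v \in s') => //= ->; rewrite ?eqxx //.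
Qed.

(** Points on a common ray have the same coordinates and the same signed support, and this support
    spans the face along which the cells are glued. *)
Lemma glue_face (p q : simp) (t : {set vertex}) (c c' : T -> R) (l : R) :
  t = val q \/ t = opps (val q) -> bary (svset p) c -> bary (svset q) c' -> 0 < l ->
  pt (val p) c = l *: pt t c' ->
  (forall a, c a = c' a) /\ exists r : simp, [/\ sface r p, sface r q & bary (svset r) c].
Proof.
move=> tq bp bq l0 te; have fp := (simpP p).2; have fq := (simpP q).2.
have ft : face u h t by case: tq => ->; rewrite //; exact: face_opps.
have bt : bary (under t) c' by case: tq => ->; rewrite ?under_opps.
have [ec es] := pt_inj fp ft bp bt l0 te; split=> //.
pose s := [set v in val p | c v.1 != 0].
have sp : s \subset val p by apply/subsetP => v; rewrite inE => /andP[].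
have st : s \subset t by rewrite /s es; apply/subsetP => v; rewrite inE => /andP[].
have cs a : a \notin under s -> c a = 0.
  move=> as_; apply/eqP; apply: contraT => ca; case/negP: as_.
  have ap : a \in under (val p).
    by apply: contraT => h1; case: bp => _ _ /(_ a h1) e'; rewrite e' eqxx in ca.
  by case/imsetP: ap => v vp av; apply/imsetP; exists v => //; rewrite inE vp -av.
have s0 : s != set0.
  apply/eqP => s0; case: bp => _ c1 _; move: c1; rewrite big1 => [/eqP|a _].
    by rewrite eq_sym oner_eq0.
  by apply: cs; rewrite s0 imset0 inE.
have [r rs] := simp_ex s0 (face_sub sp fp); exists r; split.
- by rewrite /sface; case: rs => ->; rewrite ?oppsK ?sp ?orbT.
- have qs : (s \subset val q) || (opps s \subset val q).
    case: tq st => -> st; first by rewrite st.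
    by have := imsetS (@opp T) st; rewrite oppsK => ->; rewrite orbT.
  by rewrite /sface; case: rs => ->; rewrite ?oppsK // orbC.
have -> : svset r = under s by rewrite /svset; case: rs => ->; rewrite ?under_opps.
by case: bp => h1 h2 _; split.
Qed.

Lemma sface_pt (r z : simp) (c : T -> R) : sface r z -> (forall a, a \notin svset r -> c a = 0) ->
  pt (val z) c = pt (val r) c \/ pt (val z) c = - pt (val r) c.
Proof.
move=> rz c0; have fz := (simpP z).2; case/orP: rz => rz; first by left; exact: pt_sub.
by right; rewrite -pt_opps; apply: pt_sub => // a; rewrite under_opps; exact: c0.
Qed.

Lemma pt_surj (z : 'rV[R]_N) : z != 0 -> exists (p : simp) (c : T -> R) (S : R),
  [/\ 0 < S, bary (svset p) c & pt (val p) c = S *: z \/ pt (val p) c = - (S *: z)].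
Proof.
move=> z0; have [x [t [fx t0 tx zt]]] := decomposition h_gt0 span gp z.
pose S := \sum_v t v.
have S0 : 0 < S.
  rewrite lt_def sumr_ge0 ?andbT //; apply: contra z0; rewrite psumr_eq0 // => /allP tz.
  apply/eqP; rewrite zt big1 // => v _.
  by have := tz v (mem_index_enum _) => /= /eqP ->; rewrite scale0r.
pose s := tight u h x; have fs : face u h s by exists x.
pose c a := (t (a, false) + t (a, true)) / S.
have ts v : v \in s -> c v.1 = t v / S.
  move=> vs; have := tx (opp v) (tight_opp h_gt0 vs); rewrite /c; case: v vs => a [] /= vs ->.
    by rewrite add0r.
  by rewrite addr0.
have cs a : a \notin under s -> c a = 0.
  move=> as_; rewrite /c (tx (a, false)) ?(tx (a, true)) ?addr0 ?mul0r //; apply: contra as_ => vs;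
    by apply/imsetP; eexists; first exact: vs.
have c0 a : 0 <= c a by rewrite divr_ge0 ?addr_ge0 // ltW.
have tS : \sum_(v in s) t v = S.
  by rewrite /S [RHS](bigID (mem s)) /= [X in _ = _ + X]big1 ?addr0 // => v /tx.
have c1 : \sum_a c a = 1.
  rewrite -(sum_under fs cs); transitivity (\sum_(v in s) t v / S).
    by apply: eq_bigr => v /ts.
  by rewrite -mulr_suml tS divff // gt_eqF.
have s0 : s != set0.
  by apply/eqP => e; move: tS S0; rewrite e big_set0 => <-; rewrite ltxx.
have ptz : pt s c = S^-1 *: z.
  rewrite zt scaler_sumr [RHS](bigID (mem s)) /= [X in _ = _ + X]big1 ?addr0.
    by rewrite /pt; apply: eq_bigr => v vs; rewrite (scalerA S^-1) (ts v vs) (mulrC S^-1).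
  by move=> v /tx ->; rewrite scale0r scaler0.
have [p ps] := simp_ex s0 fs; exists p, c, S^-1; rewrite invr_gt0; split=> //.
  by split=> // a; rewrite /svset; case: ps => ->; rewrite ?under_opps; exact: cs.
by case: ps => ->; rewrite ?pt_opps ptz; [left|right].
Qed.

End Complex.

(** * Edges joining opposite signs *)

Section Quadrangulation.
Variables (R : realType) (T : finType) (d : nat).
Notation N := d.+1.
Variables (u : T -> 'rV[R]_N) (h : T -> R).
Notation vertex := (T * bool)%type.
Implicit Types (v w : vertex) (s t : {set vertex}) (x y a b : T).
Hypothesis h_gt0 : forall a, 0 < h a.
Hypothesis span : forall z, (forall a, dot z (u a) = 0) -> z = 0.
Hypothesis gp : generic u h.
Hypothesis vert : forall a, face u h [set (a, false)].
Hypothesis bichromatic : forall z (e : bool), feas u h z -> #|tight u h z| = N ->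
  ~ {in tight u h z, forall v, v.2 = e}.
Notation K := (fan_gsc h_gt0 vert).
Local Notation under s := [set v.1 | v in s].
Local Notation opps s := [set opp v | v in s].

Definition edge x y : {set vertex} := [set (x, false); (y, true)].

Lemma opps_edge x y : opps (edge x y) = edge y x.
Proof. by rewrite /edge imsetU1 imset_set1 setUC. Qed.

Lemma under_edge x y : under (edge x y) = [set x; y].
Proof. by rewrite /edge imsetU1 imset_set1. Qed.

Lemma face_edge_sym x y : face u h (edge x y) -> face u h (edge y x).
Proof. by rewrite -(opps_edge x y); exact: face_opps. Qed.

Lemma face_edge_neq x y : face u h (edge x y) -> x != y.
Proof.
move=> f; apply/eqP => e.
have := face_fst_inj h_gt0 f (set21 _ _) (set22 _ _); rewrite /= => /(_ e); by case.
Qed.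

Definition quad_adj : rel T := [rel x y | `[< face u h (edge x y) >]].

Lemma quad_sym : symmetric quad_adj.
Proof. by move=> x y; apply/asboolP/asboolP; exact: face_edge_sym. Qed.

Lemma quad_irr : irreflexive quad_adj.
Proof. by move=> x; apply/asboolP => /face_edge_neq; rewrite eqxx. Qed.

Definition quad_graph : sgraph T := SGraph quad_sym quad_irr.

Definition quad_edges : {set gsimplex K} :=
  [set e | [exists x, exists y, val e == edge x y]].

Lemma quad_edgesP (e : gsimplex K) :
  reflect (exists x y, val e = edge x y) (e \in quad_edges).
Proof.
rewrite inE; apply: (iffP existsP) => [[x /existsP[y /eqP]]|[x [y exy]]].
  by exists x, y.
by exists x; apply/existsP; exists y; apply/eqP.
Qed.

Lemma edge_face (e : gsimplex K) x y : val e = edge x y -> face u h (edge x y).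
Proof. by move=> <-; exact: (simpP e).2. Qed.

Lemma edge_simp x y : face u h (edge x y) -> exists2 e : gsimplex K, e \in quad_edges &
  val e = edge x y \/ val e = edge y x.
Proof.
move=> f; have e0 : edge x y != set0 by apply/set0Pn; exists (x, false); exact: set21.
have [e ee] := simp_ex e0 f; exists e; last by rewrite -(opps_edge x y).
by apply/quad_edgesP; case: ee => ->; [exists x, y|exists y, x; exact: opps_edge].
Qed.

Lemma set2_eq a b x y : a != b -> [set a; b] = [set x; y] -> (a = x /\ b = y) \/ (a = y /\ b = x).
Proof.
move=> ab e; have : a \in [set x; y] by rewrite -e set21.
have : b \in [set x; y] by rewrite -e set22.
rewrite !inE => /orP[]/eqP eb /orP[]/eqP ea; subst a b; rewrite ?eqxx // in ab; by [left|right].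
Qed.

Lemma quad_skeleton : skeleton_subgraph quad_edges.
Proof.
move=> e /quad_edgesP[x [y exy]]; rewrite /vset /= /svset exy under_edge cards2.
by rewrite (face_edge_neq (edge_face exy)).
Qed.

Lemma edge_vset (e : gsimplex K) x y : e \in quad_edges -> vset e = [set x; y] ->
  val e = edge x y \/ val e = edge y x.
Proof.
move=> /quad_edgesP[a [b eab]]; rewrite /vset /= /svset eab under_edge.
by move=> /(set2_eq (face_edge_neq (edge_face eab)))[[<- <-]|[<- <-]]; [left|right]; exact: eab.
Qed.

(** The only two signed pairs of opposite signs over [x] and [y] are antipodal, hence a single
    simplex of the quotient. A pair of equal signs may span a parallel 1-simplex, but that is not in
    [quad_edges]. *)
Lemma quad_isomorphic : isomorphic_to_skeleton_subgraph quad_graph quad_edges.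
Proof.
exists id; split; first by exists id.
move=> x y; rewrite /=; case: (boolP (quad_adj x y)) => [/asboolP f|nf].
  have [e eE ee] := edge_simp f.
  rewrite (_ : [set _ in _ | _] = [set e]) ?cards1 //; apply/setP => e'; rewrite inE in_set1.
  apply/andP/eqP => [[e'E /eqP/(edge_vset e'E) e'e]|->].
    case: ee => ee; case: e'e => e'e; try by apply: val_inj; rewrite ee e'e.
      by apply: simp_opp; rewrite ee e'e opps_edge.
    by apply: simp_opp; rewrite ee e'e opps_edge.
  split=> //; apply/eqP; rewrite /vset /= /svset.
  by case: ee => ->; rewrite under_edge // setUC.
rewrite (_ : [set _ in _ | _] = set0) ?cards0 //; apply/setP => e; rewrite inE in_set0.
apply/negP => /andP[eE /eqP/(edge_vset eE) ee]; case/negP: nf; apply/asboolP.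
by case: ee => /edge_face //; exact: face_edge_sym.
Qed.

Lemma adj_in_simplexP (s : gsimplex K) x y : reflect
  (exists v w, [/\ v \in val s, w \in val s, v.2 != w.2, v.1 = x & w.1 = y])
  (adj_in_simplex quad_edges s x y).
Proof.
apply: (iffP exists_inP) => [[e eE /andP[es /eqP ve]]|[v [w [vs ws vw vx wy]]]].
  have ed : edge x y \subset val s \/ edge y x \subset val s.
    have ee := edge_vset eE ve; move: es; rewrite /gface /= /sface.
    by case: ee => ->; rewrite opps_edge => /orP[]; by [left|right].
  case: ed => /subsetP sub.
    by exists (x, false), (y, true); split=> //; apply: sub; [exact: set21|exact: set22].
  by exists (x, true), (y, false); split=> //; apply: sub; [exact: set22|exact: set21].
have sub : edge x y \subset val s \/ edge y x \subset val s.
  case: v w vs ws vw vx wy => [a []] [b []] vs ws //= _ ax bY; subst a b; [right|left];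
    by apply/subsetP => z; rewrite !inE => /orP[]/eqP ->.
have fs := (simpP s).2.
have [e eE ee] : exists2 e : gsimplex K, e \in quad_edges & val e = edge x y \/ val e = edge y x.
  apply: edge_simp; case: sub => sub; first exact: face_sub sub fs.
  by apply: face_edge_sym; exact: face_sub sub fs.
exists e => //; apply/andP; split.
  by rewrite /gface /= /sface; case: ee => ->; rewrite opps_edge; case: sub => ->; rewrite ?orbT.
by apply/eqP; rewrite /vset /= /svset; case: ee => ->; rewrite under_edge // setUC.
Qed.

(** Every face lies in the tight set of some vertex of the polytope, so a maximal simplex is such a
    set up to the antipode, and both signs occur there. *)
Lemma maximal_signs (s : gsimplex K) : maximal_simplex s ->
  forall e : bool, exists2 v, v \in val s & v.2 = e.
Proof.
move=> smax; have [s0 fs] := simpP s; have [z [fz sz cz]] := face_full span gp fs.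
have t0 : tight u h z != set0.
  by case/set0Pn: s0 => v vs; apply/set0Pn; exists v; exact: (subsetP sz).
have [p pe] := simp_ex t0 (ex_intro2 _ _ z fz (subxx _)).
have ps : p = s.
  apply: smax; rewrite /gface /= /sface; case: pe => ->; first by rewrite sz.
  by rewrite (imsetS (@opp T) sz) orbT.
have signs e : exists2 v, v \in tight u h z & v.2 = e.
  apply: contrapT => none; apply: (@bichromatic z (~~ e) fz cz) => v vt.
  by case: (eqVneq v.2 e) => [ve|]; [case: none; exists v|case: (v.2); case: (e)].
move=> e; rewrite -ps; case: pe => ->; first exact: signs.
have [v vt ve] := signs (~~ e); exists (opp v); first exact: imset_f.
by rewrite /= ve negbK.
Qed.

Lemma quad_quadrangulation : quadrangulation quad_edges.
Proof.
split; first exact: quad_skeleton.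
move=> s smax; have fs := (simpP s).2; split; last first.
  have [v vs ve] := maximal_signs smax false; have [w ws we] := maximal_signs smax true.
  exists v.1, w.1; split; [exact: imset_f|exact: imset_f|].
  by apply/adj_in_simplexP; exists v, w; rewrite ve we.
exists [set v.1 | v in [set v in val s | ~~ v.2]], [set v.1 | v in [set v in val s | v.2]].
have inA x (e : bool) : (x \in [set v.1 | v in [set v in val s | v.2 == e]]) = ((x, e) \in val s).
  apply/imsetP/idP => [[[a b]]|xs]; first by rewrite inE /= => /andP[ab /eqP <-] ->.
  by exists (x, e); rewrite // inE xs eqxx.
have -> : [set v in val s | ~~ v.2] = [set v in val s | v.2 == false].
  by apply/setP => v; rewrite !inE; case: (v.2).
have -> : [set v in val s | v.2] = [set v in val s | v.2 == true].
  by apply/setP => v; rewrite !inE; case: (v.2).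
split.
- apply/setP => x; rewrite in_setU !inA; apply/orP/imsetP => [[]xs|[[a []] xs ->]].
  + by exists (x, false).
  + by exists (x, true).
  + by right.
  by left.
- rewrite -setI_eq0; apply/eqP/setP => x; rewrite in_setI in_set0 !inA.
  apply/negP => /andP[h1 h2]; by have := face_fst_inj h_gt0 fs h1 h2 erefl.
move=> x y _ _; rewrite !inA; apply/adj_in_simplexP/orP.
  case=> -[a []] [[b []] [vs ws vw /= ax bY]]; subst a b; rewrite // ?vs ?ws; by [left|right].
case=> /andP[h1 h2]; first by exists (x, false), (y, true).
by exists (x, true), (y, false).
Qed.

Lemma quad_not_colorable m : colorable quad_graph m -> (N < m)%N.
Proof.
move=> /existsP[c /forallP cP]; rewrite ltnNge; apply/negP => mN.
pose col a : 'I_N := widen_ord mN (c a).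
have prop x y : face u h (edge x y) -> c x != c y.
  by move=> f; have /forallP/(_ y)/implyP := cP x; apply; apply/asboolP.
have colP v w : face u h [set v; w] -> v.2 != w.2 -> col v.1 != col w.1.
  move=> f vw; suff : c v.1 != c w.1 by rewrite -!(inj_eq val_inj).
  case: v w vw f => [a []] [b []] //= _ f; last exact: prop.
  by rewrite eq_sym; apply: prop; rewrite /edge setUC.
have [z [e [fz cz mono]]] := monochromatic_facet h_gt0 span gp colP (ltn0Sn d).
exact: (@bichromatic z e fz cz).
Qed.

End Quadrangulation.

Lemma schrijver_colorable (n k : nat) (G : sgraph (schrijver_vertex n k)) :
  (0 < k)%N -> (2 * k < n)%N ->
  (forall a b, G a b -> [disjoint sval a & sval b]) -> colorable G (n - 2 * k + 2).
Proof.
move=> k0 kn GP.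
have ex (a : schrijver_vertex n k) : exists i, i \in sval a /\ forall j, j \in sval a -> (i <= j)%N.
  have /andP[/eqP ka _] := valP a.
  have [i0 i0a] : exists i, i \in sval a by apply/set0Pn; rewrite -card_gt0 ka.
  by case: (@arg_minnP _ i0 (mem (sval a)) (fun i : 'I_n => i : nat) i0a) => i ia imin; exists i.
have [m mP] := choice ex.
have lt a : (minn (m a) (n - 2 * k).+1 < n - 2 * k + 2)%N by rewrite addn2 ltnS geq_minr.
apply/existsP; exists [ffun a => Ordinal (lt a)].
apply/forallP => a; apply/forallP => b; apply/implyP => /GP dis; rewrite !ffunE.
apply/eqP => /(congr1 val) /= e; have [ma mamin] := mP a; have [mb mbmin] := mP b.
have [h|h] := leqP (m a) (n - 2 * k).
  have e' : m a = m b :> nat by move: e; rewrite /minn; case: ifP; case: ifP; lia.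
  by have := disjointFr dis ma; rewrite (val_inj e') mb.
have hb : (n - 2 * k < m b)%N by move: e; rewrite /minn; case: ifP; case: ifP; lia.
(* Two sets with the truncated colour lie in the last [2k - 1] positions, too few for disjoint
   [k]-sets; positions are counted from 0. *)
have sub : sval a :|: sval b \subset [set j : 'I_n | ((n - 2 * k).+1 <= j < n)%N].
  apply/subsetP => j; rewrite in_setU inE ltn_ord andbT => /orP[/mamin|/mbmin] hj.
    exact: leq_trans h hj.
  exact: leq_trans hb hj.
have := subset_leq_card sub; rewrite card_ord_range // cardsU.
have /andP[/eqP -> _] := valP a; have /andP[/eqP -> _] := valP b.
have -> : sval a :&: sval b = set0 by apply/eqP; rewrite setI_eq0.
by rewrite cards0; lia.
Qed.

(* These libraries shadow names of [finset], hence their late import. *)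
From mathcomp Require Import all_classical all_reals.
From mathcomp Require Import topology normedtype realfun.

Import numFieldNormedType.Exports.

(** * Triangulation of the projective space *)

Section Topology.
Local Open Scope classical_set_scope.

Lemma separated_hausdorff (R : realType) (X : topologicalType) :
  (forall p q : X, p <> q -> exists phi : X -> R, continuous phi /\ phi p <> phi q) ->
  hausdorff_space X.
Proof.
move=> sep p q cl; apply: contrapT => pq; have [phi [cphi ne]] := sep p q pq.
apply: ne; apply: (@Rhausdorff R) => A B nA nB.
by have [z [zA zB]] := cl _ _ (cphi p A nA) (cphi q B nB); exists (phi z).
Qed.

Lemma continuous_rV (R : realType) (X : topologicalType) (m : nat) (f : X -> 'rV[R]_m.+1) :
  (forall j, continuous (fun x => f x 0 j)) -> continuous f.
Proof.
move=> cf x U /nbhs_ballP[e e0 eU].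
have : \forall y \near x, forall j, ball (f x 0 j) e (f y 0 j).
  by apply: filter_forall => j; apply: (cf j x); exact: nbhsx_ballx.
by apply: filterS => y hy; apply: eU; split=> // i j; rewrite !ord1; exact: hy.
Qed.

Lemma continuous_sumR (R : realType) (X : topologicalType) (I : finType) (P : pred I)
    (f : I -> X -> R) : (forall i, continuous (f i)) ->
  continuous (fun x => \sum_(i | P i) f i x).
Proof.
move=> cf x; apply: cvg_big => [|i _]; first exact: add_continuous.
exact: cf.
Qed.

Lemma compact_set_type (X : topologicalType) (A : set X) :
  compact A -> compact [set: set_type A].
Proof.
move=> cA F PF _.
have [|x [Ax clx]] := cA (set_val @ F) _.
  by apply: (@filterS _ F _ setT) => [a _|]; [exact: set_valP|exact: filterT].
exists (SigSub (mem_set Ax)); split=> // B U FB; rewrite nbhsE => -[O [oO Ox] OU].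
have [V oV VO] := oO.
have nV : nbhs x V by apply: open_nbhs_nbhs; split=> //; move: Ox; rewrite -VO.
have [] := clx (set_val @` B) V _ nV; first by apply: (@filterS _ F _ B _ _ FB) => b Bb; exists b.
move=> y [[b Bb <-] Vb]; exists b; split=> //; apply: OU; by rewrite -VO.
Qed.

Lemma compact_std_simplex (R : realType) (V : finType) (S : {set V}) :
  compact (@std_simplex R V S).
Proof.
have cI : compact [set f : prod_topology (fun _ : V => R) | forall v, `[0, 1]%classic (f v)].
  exact: (@tychonoff V (fun _ => R) (fun _ => `[0, 1]%classic) (fun _ => @segment_compact R 0 1)).
apply: subclosed_compact cI _.
  have -> : @std_simplex R V S =
      \bigcap_(v in setT) ((fun x : prod_topology (fun _ : V => R) => x v) @^-1` [set y | 0 <= y]) `&`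
      ((fun x : prod_topology (fun _ : V => R) => \sum_v x v) @^-1` [set y | y = 1]) `&`
      \bigcap_(v in [set v | v \notin S])
        ((fun x : prod_topology (fun _ : V => R) => x v) @^-1` [set y | y = 0]).
    apply/seteqP; split=> x.
      by case=> h1 h2 h3; split; [split; [move=> v _; exact: h1|exact: h2]|move=> v vS; exact: h3].
    case=> -[h1 h2] h3; split; [move=> v; exact: (h1 v I)|exact: h2|].
    by move=> v vS; exact: (h3 v vS).
  have pc v : continuous (fun x : prod_topology (fun _ : V => R) => x v).
    exact: proj_continuous.
  apply: closedI; first apply: closedI.
  - by apply: closed_bigI => v _; apply: preimage_closed; [move=> x _; exact: pc|exact: closed_ge].
  - apply: preimage_closed; last exact: closed_eq.
    by move=> x _; exact: (@continuous_sumR R (prod_topology (fun _ : V => R)) V predT (fun v x => x v) pc).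
  by apply: closed_bigI => v _; apply: preimage_closed; [move=> x _; exact: pc|exact: closed_eq].
move=> x [x0 x1 _] v /=; rewrite in_itv /= x0 -x1 (bigD1 v) //= lerDl.
exact: sumr_ge0.
Qed.

Lemma compact_hausdorff_homeomorphic (X Y : topologicalType) (f : X -> Y) (g : Y -> X) :
  compact [set: X] -> hausdorff_space Y -> continuous f -> cancel f g -> cancel g f ->
  homeomorphic X Y.
Proof.
move=> cX hY cf fg gf; exists f, g; split=> //; apply/continuous_closedP => A cA.
have -> : g @^-1` A = f @` A.
  apply/seteqP; split=> y /=; first by move=> Agy; exists (g y).
  by move=> [x Ax <-]; rewrite fg.
apply: compact_closed => //; apply: continuous_compact; first exact: continuous_subspaceT.
exact: subclosed_compact cX _.
Qed.

End Topology.

(** * Separation of points in projective space *)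

Section Projective.
Local Open Scope classical_set_scope.
Variables (R : realType) (d : nat).
Notation RP := (real_projective_space R d).

Lemma sphere_coord_continuous (i : 'I_d.+1) :
  continuous (fun x : set_type (@sphere R d) => set_val x 0 i).
Proof.
move=> x; apply: (@continuous_comp _ _ _ set_val (fun y : 'rV[R]_d.+1 => y 0 i)).
  exact: initial_continuous.
exact: coord_continuous.
Qed.

Lemma rp_eqP (x y : set_type (@sphere R d)) :
  \pi_RP%qT x = \pi_RP%qT y <-> set_val x = set_val y \/ set_val x = - set_val y.
Proof.
split.
  move=> /(eqmodP (antipodal_equiv_rel R d)) /orP[]/eqP; by [left|right].
move=> h; apply/(eqmodP (antipodal_equiv_rel R d)).
by apply/orP; case: h => ->; [left|right].
Qed.

(** Products of two coordinates are even, so they descend to the quotient, and together they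
    determine a point of the sphere up to sign. *)
Lemma rp_hausdorff : hausdorff_space RP.
Proof.
apply: (@separated_hausdorff R) => p q pq.
pose phi (i j : 'I_d.+1) (x : set_type (@sphere R d)) : R := set_val x 0 i * set_val x 0 j.
have cphi i j : continuous (phi i j).
  by move=> x; exact: (cvgM (@sphere_coord_continuous i x) (@sphere_coord_continuous j x)).
have hphi i j : continuous (phi i j \o repr : RP -> R).
  apply: repr_comp_continuous; first exact: cphi.
  move=> a b /eqP/rp_eqP h; apply/eqP; rewrite /phi; case: h => -> //.
  by rewrite !mxE mulrNN.
apply: contrapT => none; apply: pq.
pose x := repr p; pose y := repr q.
have e i j : phi i j x = phi i j y.
  by apply: contrapT => ne; apply: none; exists (phi i j \o repr).
rewrite -[p]reprK -[q]reprK; apply/rp_eqP; rewrite -/x -/y.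
have sx : sphere (set_val x) := set_valP x.
have [i xi] : exists i, set_val x 0 i != 0.
  apply: contrapT => n0; have : \sum_i set_val x 0 i ^+ 2 = 0.
    apply: big1 => i _; apply/eqP; rewrite sqrf_eq0; apply: contraT => h.
    by case: n0; exists i.
  by rewrite (sx : _ = 1) => /eqP; rewrite oner_eq0.
have /eqP := e i i; rewrite /phi -!expr2 eqf_sqr => /orP[]/eqP ei; [left|right]; apply/rowP => j.
  by apply: (mulfI xi); have := e i j; rewrite /phi => ->; rewrite ei.
by apply: (mulfI xi); have := e i j; rewrite /phi => ->; rewrite ei !mxE mulrNN.
Qed.

End Projective.

(** * Radial projection of the complex *)

Section Homeomorphism.
Local Open Scope classical_set_scope.
Variables (R : realType) (T : finType) (d : nat).
Notation N := d.+1.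
Variables (u : T -> 'rV[R]_N) (h : T -> R).
Hypothesis h_gt0 : forall a, 0 < h a.
Hypothesis span : forall x, (forall a, dot x (u a) = 0) -> x = 0.
Hypothesis gp : generic u h.
Hypothesis vert : forall a, face u h [set (a, false)]%SET.
Notation K := (fan_gsc h_gt0 vert).
Notation RP := (real_projective_space R d).

Definition len (y : 'rV[R]_N) : R := Num.sqrt (\sum_i y 0 i ^+ 2).

Lemma len_gt0 y : y != 0 -> 0 < len y.
Proof.
move=> y0; rewrite sqrtr_gt0 lt_def sumr_ge0 ?andbT => [|i _]; last exact: sqr_ge0.
apply: contra y0; rewrite psumr_eq0 => [/allP z|i _]; last exact: sqr_ge0.
apply/eqP/rowP => i; have := z i (mem_index_enum _); rewrite /= sqrf_eq0 => /eqP ->.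
by rewrite mxE.
Qed.

Lemma unit_sphere y : y != 0 -> @sphere R d ((len y)^-1 *: y).
Proof.
move=> y0; rewrite /sphere /=.
have -> : \sum_i ((len y)^-1 *: y) 0 i ^+ 2 = (len y) ^- 2 * \sum_i y 0 i ^+ 2.
  by rewrite mulr_sumr; apply: eq_bigr => i _; rewrite mxE exprMn exprVn.
have <- : len y ^+ 2 = \sum_i y 0 i ^+ 2.
  by apply: sqr_sqrtr; apply: sumr_ge0 => i _; exact: sqr_ge0.
by rewrite mulVf // expf_neq0 // gt_eqF // len_gt0.
Qed.

Lemma cell_bary (p : gsimplex K) (c : cell R p) : bary (svset p) (set_val c).
Proof. exact: (set_valP c). Qed.

Lemma cell_pt_neq0 (p : gsimplex K) (c : cell R p) : pt u (val p) (set_val c) != 0.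
Proof. by have [_ fp] := simpP p; exact: (pt_neq0 h_gt0 fp (cell_bary c)). Qed.

Definition to_sphere (p : gsimplex K) (c : cell R p) : set_type (@sphere R d) :=
  SigSub (mem_set (unit_sphere (cell_pt_neq0 c))).

Lemma to_sphereE (p : gsimplex K) (c : cell R p) : set_val (to_sphere c) =
  (len (pt u (val p) (set_val c)))^-1 *: pt u (val p) (set_val c).
Proof. by []. Qed.

Definition to_rp (p : gsimplex K) (c : cell R p) : RP := \pi_RP%qT (to_sphere c).

Lemma to_sphere_continuous (p : gsimplex K) : continuous (@to_sphere p).
Proof.
apply: continuous_comp_initial; apply: continuous_rV => j.
have cc a : continuous (fun c : cell R p => (set_val c : prod_topology (fun _ : T => R)) a).
  move=> c; apply: (@continuous_comp _ _ _ set_val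
    (fun x : prod_topology (fun _ : T => R) => x a)); first exact: initial_continuous.
  exact: proj_continuous.
have cp i : continuous (fun c : cell R p => pt u (val p) (set_val c) 0 i).
  have -> : (fun c : cell R p => pt u (val p) (set_val c) 0 i) =
      (fun c : cell R p => \sum_(v | v \in val p) (set_val c : prod_topology (fun _ : T => R)) v.1 * sv u v 0 i).
    apply/funext => c; rewrite /pt summxE; apply: eq_bigr => v _; by rewrite mxE.
  apply: continuous_sumR => v c.
  have cs : {for c, continuous (fun _ : cell R p => sv u v 0 i)} by exact: cst_continuous.
  exact: (cvgM (cc v.1 c) cs).
have cl : continuous (fun c : cell R p => len (pt u (val p) (set_val c))).
  move=> c; apply: (@continuous_comp _ _ _ (fun c : cell R p => \sum_i pt u (val p) (set_val c) 0 i ^+ 2)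
    (@Num.sqrt R)); last exact: sqrt_continuous.
  apply: (@continuous_sumR _ _ _ predT (fun i (c : cell R p) => pt u (val p) (set_val c) 0 i ^+ 2)).
  by move=> i c'; exact: (cvgM (cp i c') (cp i c')).
move=> c; have -> : (fun x : cell R p => (set_val \o @to_sphere p) x 0 j) =
    (fun x : cell R p => (len (pt u (val p) (set_val x)))^-1 * pt u (val p) (set_val x) 0 j).
  by apply/funext => x; rewrite /= mxE.
have n0 : len (pt u (val p) (set_val c)) != 0 by rewrite gt_eqF // len_gt0 // cell_pt_neq0.
exact: (cvgM (cvgV n0 (cl c)) (cp j c)).
Qed.

Lemma lenN (y : 'rV[R]_N) : len (- y) = len y.
Proof. by rewrite /len; congr Num.sqrt; apply: eq_bigr => i _; rewrite mxE sqrrN. Qed.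

(** Equality up to sign places both points on one line; replacing the representative of [q] by its
    antipode if necessary puts them on one ray, where [glue_face] applies. *)
Lemma to_rp_eqP (p q : gsimplex K) (c : cell R p) (c' : cell R q) :
  to_rp c = to_rp c' <-> glued (existT _ p c) (existT _ q c').
Proof.
have bp := cell_bary c; have bq := cell_bary c'.
have lp := len_gt0 (cell_pt_neq0 c); have lq := len_gt0 (cell_pt_neq0 c').
split.
  move=> /rp_eqP /= e; apply/asboolP; rewrite /coords /=.
  pose l := len (pt u (val p) (set_val c)) / len (pt u (val q) (set_val c')).
  have l0 : 0 < l by rewrite divr_gt0.
  have sc (y y' : 'rV[R]_N) (m m' : R) : 0 < m -> 0 < m' -> m^-1 *: y = m'^-1 *: y' -> y = (m / m') *: y'.
    move=> m0 m0' e'; rewrite -scalerA -e' scalerA divff ?scale1r // gt_eqF //.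
  have [t [tq te]] : exists t, (t = val q \/ t = [set opp v | v in val q]%SET) /\
      pt u (val p) (set_val c) = l *: pt u t (set_val c').
    case: e => e.
      by exists (val q); split; [left|exact: sc].
    exists [set opp v | v in val q]%SET; split; first by right.
    by rewrite pt_opps; apply: sc => //; rewrite scalerN.
  have [ec [r [rp rq br]]] := glue_face h_gt0 gp tq bp bq l0 te.
  by split; [apply/funext|exists r].
move=> /asboolP[ec [r [rp rq xr]]]; apply/rp_eqP => /=.
move: ec rp rq xr; rewrite /coords /= => ec rp rq [_ _ xr].
rewrite !to_sphereE -ec.
have := sface_pt h_gt0 rp xr; have := sface_pt h_gt0 rq xr.
by case=> -> [] ->; rewrite ?lenN ?scalerN ?opprK; [left|right|right|left].
Qed.

Lemma to_rp_surj (y : RP) : exists (p : gsimplex K) (c : cell R p), to_rp c = y.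
Proof.
pose z := set_val (repr y); have sz : @sphere R d z := set_valP (repr y).
have z0 : z != 0.
  apply/eqP => e; move: sz; rewrite /sphere /= e big1 => [/eqP|i _]; last by rewrite mxE expr0n.
  by rewrite eq_sym oner_eq0.
have [p [c [S [S0 bc ps]]]] := pt_surj h_gt0 span gp z0.
have lz : len (S *: z) = S.
  rewrite /len; have -> : \sum_i (S *: z) 0 i ^+ 2 = S ^+ 2 * \sum_i z 0 i ^+ 2.
    by rewrite mulr_sumr; apply: eq_bigr => i _; rewrite mxE exprMn.
  by rewrite (sz : \sum_i z 0 i ^+ 2 = 1) mulr1 sqrtr_sqr gtr0_norm.
have pm : @std_simplex R T (vset (p : gsimplex K)) c by exact: bc.
exists p, (SigSub (mem_set pm) : cell R (p : gsimplex K)).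
rewrite -[y]reprK; apply/rp_eqP; rewrite -/z.
have -> : set_val (to_sphere (SigSub (mem_set pm) : cell R (p : gsimplex K))) =
    (len (pt u (val p) c))^-1 *: pt u (val p) c by [].
have zz : S^-1 *: (S *: z) = z by rewrite scalerA mulVf ?scale1r // gt_eqF.
by case: ps => ->; rewrite ?lenN lz ?scalerN zz; [left|right].
Qed.

(** A continuous bijection from a compact space to a Hausdorff space is a homeomorphism, so it
    suffices that radial projection identifies exactly the glued points and is onto. *)
Theorem fan_triangulates : triangulates R K RP.
Proof.
pose F (p : {s : gsimplex K & cell R s}) : RP := @to_rp (projT1 p) (projT2 p).
have cF : continuous F.
  apply: (@sigT_continuous _ _ _ to_rp) => p c.
  apply: continuous_comp; first exact: to_sphere_continuous.
  exact: pi_continuous.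
have FP p q : F p = F q <-> glued p q by case: p => p c; case: q => q c'; exact: to_rp_eqP.
have piP p q : \pi_(realization R K)%qT p = \pi_(realization R K)%qT q <-> glued p q.
  by split=> [/(eqmodP (glued_equiv_rel R K))//|e]; apply/(eqmodP (glued_equiv_rel R K)).
have ex y : exists p, F p = y.
  by have [p [c e]] := to_rp_surj y; exists (existT _ p c).
have [G GP] := choice ex.
pose f : realization R K -> RP := F \o repr.
pose g (y : RP) : realization R K := \pi_(realization R K)%qT (G y).
have fpi p : f (\pi_(realization R K)%qT p) = F p.
  by apply/FP/piP; rewrite reprK.
apply: (@compact_hausdorff_homeomorphic _ _ f g).
- have -> : [set: realization R K] = \pi_(realization R K)%qT @` setT.
    by apply/seteqP; split=> // x _; exists (repr x); rewrite ?reprK.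
  apply: continuous_compact; first exact/continuous_subspaceT/pi_continuous.
  apply: sigT_compact; first exact: finite_finset.
  by move=> p; apply: compact_set_type; exact: compact_std_simplex.
- exact: rp_hausdorff.
- apply: repr_comp_continuous; first exact: cF.
  by move=> a b /eqP/piP/FP ->.
- by move=> x; rewrite /g -[RHS]reprK; apply/piP/FP; rewrite GP.
by move=> y; rewrite /g fpi GP.
Qed.

End Homeomorphism.

Theorem theorem1p1 (R : realType) (n k : nat) (hk : (1 <= k)%N)
    (hn : (2 * k < n)%N) :
  exists QG : sgraph (schrijver_vertex n k),
    [/\ spanning_subgraph QG (schrijver_graph n k),
        embeds_as_quadrangulation R QG (real_projective_space R (n - 2 * k)%N)
      & chromatic_number QG = (n - 2 * k + 2)%N].
Proof.
have [u [h [h_gt0 span gp [vert disj bichr]]]] := schrijver_fan R hk hn.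
have sub (a b : schrijver_vertex n k) : quad_graph u h_gt0 a b -> [disjoint sval a & sval b].
  by move=> /asboolP; exact: disj.
exists (quad_graph u h_gt0); split.
- move=> a b ab; apply/andP; split; last exact: sub.
  by move: ab => /asboolP; exact: face_edge_neq.
- exists (fan_gsc h_gt0 vert), (quad_edges h_gt0 vert); split.
  + exact: fan_triangulates.
  + exact: quad_quadrangulation.
  exact: quad_isomorphic.
rewrite /chromatic_number; case: ex_minnP => m cm mmin; apply/eqP; rewrite eqn_leq.
by rewrite (mmin _ (schrijver_colorable hk hn sub)) addn2; exact: quad_not_colorable cm.
Qed.
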